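(* Let $G$ be an $n$-vertex graph with maximum vertex degree $O(1)$ (bounded by a fixed constant). Then all maximal independent sets of $G$ can be listed in time $O(1)$ per generated set, space $O(n)$, and with polynomial delay.
   Context: A maximal independent set is an independent set not properly contained in another independent set. Polynomial delay means that the time before the first output, between consecutive outputs, and after the last output is bounded by a polynomial in $n$. Constants in the bounds may depend on the degree bound.
   Formalization: Time O(1) per generated set is read as total time O(n + number of sets): a graph without edges has only one maximal independent set but needs time of order n, so an additive O(n) term is included. *)

(* Defs.v *)
From mathcomp Require Import all_boot.
Set Implicit Arguments. Unset Strict Implicit. Unset Printing Implicit Defensive.

(* A finite simple graph on vertex set 'I_n is a symmetric irreflexive rel. *)
Definition independent n (e : rel 'I_n) (S : {set 'I_n}) : bool :=
  [forall x in S, forall y in S, ~~ e x y].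

Definition mis n (e : rel 'I_n) (S : {set 'I_n}) : bool :=
  maxset (independent e) S.

Definition max_degree_le n (e : rel 'I_n) (d : nat) : Prop :=
  forall v : 'I_n, #|[set u | e v u]| <= d.

Inductive instr :=
| IConst of nat & nat
| IAdd of nat & nat & nat
| ISub of nat & nat & nat      (* ISub r a b   : M[r] := M[a] - M[b] (trunc)*)
| ILoad of nat & nat
| IStore of nat & nat
| IJz of nat & nat
| IOut of nat
| IHalt.                       (* stop (also: pc outside the program)      *)

Record state := St { pc : nat; mem : nat -> nat }.

Definition upd (m : nat -> nat) (r v : nat) : nat -> nat :=
  fun x => if x == r then v else m x.

Definition step (p : seq instr) (s : state) : state :=
  let: St i m := s in
  match nth IHalt p i with
  | IConst r c => St i.+1 (upd m r c)
  | IAdd r a b => St i.+1 (upd m r (m a + m b))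
  | ISub r a b => St i.+1 (upd m r (m a - m b))
  | ILoad r a => St i.+1 (upd m r (m (m a)))
  | IStore a b => St i.+1 (upd m (m a) (m b))
  | IJz a t => if m a == 0 then St t m else St i.+1 m
  | IOut _ => St i.+1 m
  | IHalt => s
  end.

Definition exec (p : seq instr) (s : state) (t : nat) : state := iter t (step p) s.

Definition halted (p : seq instr) (s : state) : bool :=
  if nth IHalt p (pc s) is IHalt then true else false.

Definition is_out (p : seq instr) (s : state) : bool :=
  if nth IHalt p (pc s) is IOut _ then true else false.

(* The set output when the current instruction is an IOut: its
   characteristic vector is read from memory (an output costs one step). *)
Definition out_set (p : seq instr) n (s : state) : {set 'I_n} :=
  if nth IHalt p (pc s) is IOut a
  then [set v : 'I_n | mem s (mem s a + v) != 0]
  else set0.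

(* M[0] = n; for each vertex v < n the block of d+1 cells starting at
   address 1 + v*(d+1) holds deg(v) followed by the neighbours of v in
   increasing order; all other cells are 0. *)
Definition neighbours n (e : rel 'I_n) (v : 'I_n) : seq nat :=
  [seq val u | u <- enum 'I_n & e v u].

Definition graph_mem (d n : nat) (e : rel 'I_n) : nat -> nat :=
  fun a =>
    if a == 0 then n else
    let q := (a.-1) %/ d.+1 in
    let r := (a.-1) %% d.+1 in
    match insub q : option 'I_n with
    | Some v => if r == 0 then size (neighbours e v)
                else nth 0 (neighbours e v) r.-1
    | None => 0
    end.

(* Program p, run on the encoding of the graph e (with degree bound d),
   halts at time T, outputs exactly the maximal independent sets of e,
   each exactly once, and:
   - total time  T <= C * (n + #MIS)        (O(1) time per generated set,
                                             plus O(n) for input/first set)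
   - delay: before the first output, between consecutive outputs and after
     the last output at most C*(n+1)^k steps (polynomial delay)
   - space: at all times only cells with address < C*(n+1) are nonzero,
     and every cell holds a value <= C*(n+1)^k (words of O(log n) bits). *)
Definition lists_all_mis (d : nat) (p : seq instr) (C k : nat)
    n (e : rel 'I_n) : Prop :=
  let s0 := St 0 (graph_mem d e) in
  exists T : nat,
    halted p (exec p s0 T) /\
    (forall t, t < T -> ~~ halted p (exec p s0 t)) /\
    let ts := [seq t <- iota 0 T | is_out p (exec p s0 t)] in
    let outs := [seq out_set p n (exec p s0 t) | t <- ts] in
    uniq outs /\
    (forall S : {set 'I_n}, (S \in outs) = mis e S) /\
    T <= C * (n + #|[set S : {set 'I_n} | mis e S]|) /\
    path (fun a b => b - a <= C * (n.+1) ^ k) 0 (rcons ts T) /\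
    (forall t a, t <= T -> C * n.+1 <= a -> mem (exec p s0 t) a = 0) /\
    (forall t a, t <= T -> mem (exec p s0 t) a <= C * (n.+1) ^ k).

(* Main.v *)
(* Vertices are added one at a time, as in the reverse search of Tsukiyama et al.:
   if v is added to A, a maximal independent set T of A + v has as parent T
   itself when v is not in T, and otherwise the greedy completion of T - v inside
   A.  Every set has one or two children, determined by a ball of bounded radius
   around v, and the parent map undoes a descent, so a depth-first traversal
   needs no stack and takes constant time per node.  All leaves lie at the same
   depth, hence the delay is linear.

   The number of nodes is the sum over all prefixes of the vertex order of the
   numbers of maximal independent sets.  Isolated vertices belong to every such
   set and are left out of the order.  The order ends with a maximal family of
   disjoint closed neighbourhoods of non-isolated vertices; completing one of
   these multiplies the number of maximal independent sets by a constant greater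
   than one, while the vertices outside the family are at most a constant times
   as many as its members.  The sum is therefore dominated by its last term. *)
Require Import Defs.
From mathcomp Require Import all_boot zify.
Set Implicit Arguments. Unset Strict Implicit. Unset Printing Implicit Defensive.

(** The obstacle is the machine: it only adds and subtracts, may use linearly many cells, and finds
    its input in the very cells that registers would occupy. Doubling [n] a fixed number of times
    gives a stride [X = n * 2 ^ W] exceeding both the input and the reserved cells. A bounded number
    of arrays of length [X] fits into linear space, and each base is reached by a bounded number of
    additions. Loop bodies are written in a loop-free command language, so the size of the compiled
    code bounds the cost of one traversal step by a constant.

    Constant cost also rules out comparing whole sets. Building a candidate child and undoing it
    changes memberships only at [v] and its neighbours, so saving and comparing [d] memberships
    decides whether the candidate has the right parent.

    The order of the vertices matters for the count alone. An isolated vertex would add a level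
    without adding sets, and many of them would push the sum of the levels beyond a constant times
    the last. The disjoint neighbourhoods come last because growth is guaranteed there; it pays for
    the vertices placed before them. *)

Section MaximalIndependentSets.

Variables (n : nat) (e : rel 'I_n).
Hypotheses (e_sym : symmetric e) (e_irr : irreflexive e).
Implicit Types (A B S T : {set 'I_n}) (u v w x : 'I_n) (l : seq 'I_n).

(** * Maximal independent sets relative to a vertex set, and the parent map *)

Definition free S w := [forall u in S, ~~ e w u].
(** Kernel equation: inside [A], membership coincides with being undominated. Independence and
    maximality become a single condition that can be checked vertex by vertex. *)
Definition misin A S := (S \subset A) && [forall w in A, (w \in S) == free S w].
Definition nbs v := [seq u <- enum 'I_n | e v u].
Definition indep S := [forall w in S, free S w].

Lemma mem_nbs v u : (u \in nbs v) = e v u.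
Proof. by rewrite mem_filter mem_enum andbT. Qed.

Lemma freeP S w : reflect (forall u, u \in S -> ~~ e w u) (free S w).
Proof. exact: (iffP forall_inP). Qed.

Lemma nfreeP S w : reflect (exists2 u, u \in S & e w u) (~~ free S w).
Proof.
apply: (iffP idP) => [|[u Su ewu]]; last by apply/negP=> /freeP/(_ _ Su); rewrite ewu.
rewrite negb_forall => /existsP[u]; rewrite negb_imply negbK => /andP[? ?]; by exists u.
Qed.

Lemma misinP A S :
  reflect (S \subset A /\ forall w, w \in A -> (w \in S) = free S w) (misin A S).
Proof.
apply: (iffP andP) => -[sSA H]; split=> //.
  by move=> w Aw; exact/eqP/(forall_inP H).
by apply/forall_inP=> w Aw; rewrite H.
Qed.

Lemma misin_sub A S : misin A S -> {subset S <= A}.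
Proof. by case/misinP=> /subsetP. Qed.

Lemma misin_free A S w : misin A S -> w \in S -> free S w.
Proof. by move=> mS Sw; have /misinP[/subsetP sSA <-] := mS; rewrite ?sSA. Qed.

Lemma misin_in A S w : misin A S -> w \in A -> free S w -> w \in S.
Proof. by case/misinP=> _ H Aw; rewrite H. Qed.

Lemma free_sub S T w : {subset S <= T} -> free T w -> free S w.
Proof. by move=> sST /freeP H; apply/freeP=> u /sST/H. Qed.

Lemma freeU1 S v w : free (v |: S) w = ~~ e w v && free S w.
Proof.
apply/freeP/andP=> [H|[nwv /freeP H] u].
  split; first by apply: H; rewrite setU11.
  by apply/freeP=> u Su; apply: H; rewrite setU1r.
by rewrite in_setU1 => /predU1P[->|/H].
Qed.

Lemma indepP S : reflect (forall w, w \in S -> free S w) (indep S).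
Proof. exact: (iffP forall_inP). Qed.

Lemma misE S : mis e S = misin setT S.
Proof.
have indE T : independent e T = indep T by [].
apply/maxsetP/misinP => [[iS maxS]|[_ H]].
  split=> [|w _]; first exact: subsetT.
  apply/idP/idP=> [|fw]; first by move: iS; rewrite indE => /indepP; apply.
  have iT : independent e (w |: S).
    rewrite indE; apply/indepP=> x; rewrite in_setU1 freeU1 => /predU1P[->|Sx].
      by rewrite e_irr.
    move/freeP: fw => fw; rewrite e_sym fw //=.
    by move: iS; rewrite indE => /indepP; apply.
  by rewrite -(maxS _ iT (subsetUr _ _)) setU11.
split=> [|T]; first by rewrite indE; apply/indepP=> w Sw; rewrite -H ?inE.
rewrite indE => /indepP iT /subsetP sST; apply/setP=> w.
apply/idP/idP=> [Tw|]; last exact: sST.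
by rewrite H ?inE //; apply: free_sub sST _; apply: iT.
Qed.

Definition gstep A S w := if (w \in A) && free S w then w |: S else S.
Definition greedy A S l := foldl (gstep A) S l.

Lemma greedy_sub A S l : {subset S <= greedy A S l}.
Proof.
elim: l S => [|w l IH] S x Sx //=; apply: IH; rewrite /gstep.
by case: ifP => _ //; rewrite in_setU1 Sx orbT.
Qed.

Lemma greedy_subset A S l : S \subset A -> greedy A S l \subset A.
Proof.
elim: l S => //= w l IH S sSA; apply: IH; rewrite /gstep.
by case: ifP => // /andP[Aw _]; rewrite subUset sub1set Aw.
Qed.

Lemma greedy_indep A S l : indep S -> indep (greedy A S l).
Proof.
elim: l S => //= w l IH S iS; apply: IH; rewrite /gstep.
case: ifP => // /andP[_ fw]; apply/indepP=> x; rewrite in_setU1 freeU1.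
case/predU1P=> [->|Sx]; first by rewrite e_irr.
by rewrite e_sym (freeP _ _ fw) //=; apply: (indepP _ iS).
Qed.

Lemma greedy_max A S l w :
  w \in l -> w \in A -> free (greedy A S l) w -> w \in greedy A S l.
Proof.
elim: l S => //= x l IH S; rewrite inE => /predU1P[<-|lw] Aw fw; last exact: IH.
apply: greedy_sub; rewrite /gstep Aw /=; case: ifPn; rewrite ?setU11 //.
case/negP; apply: free_sub fw => u Su; apply: greedy_sub; rewrite /gstep.
by case: ifP; rewrite ?in_setU1 ?Su ?orbT.
Qed.

Lemma greedy_id A S l : misin A S -> greedy A S l = S.
Proof.
move=> mS; elim: l => //= w l; rewrite /gstep.
case: ifP => // /andP[Aw fw]; suff -> : w |: S = S by [].
by apply/setUidPr; rewrite sub1set (misin_in mS).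
Qed.

Lemma indep_sub S T : {subset S <= T} -> indep T -> indep S.
Proof.
by move=> sST /indepP iT; apply/indepP=> w /sST/iT; apply: free_sub.
Qed.

Lemma misin_indep A S : misin A S -> indep S.
Proof. by move=> mS; apply/indepP=> w; apply: misin_free mS. Qed.

Lemma indep_misin A S :
  S \subset A -> indep S -> (forall w, w \in A -> free S w -> w \in S) -> misin A S.
Proof.
move=> sSA /indepP iS H; apply/misinP; split=> // w Aw.
by apply/idP/idP; [apply: iS | apply: H].
Qed.

Lemma misin_ext A S :
  S \subset A -> indep S -> exists2 T, misin A T & {subset S <= T}.
Proof.
move=> sSA iS; exists (greedy A S (enum A)); last exact: greedy_sub.
apply: indep_misin => [||w Aw fw]; first exact: greedy_subset.
  exact: greedy_indep.
by apply: greedy_max; rewrite ?mem_enum.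
Qed.

(** Deleting [v] can free only neighbours of [v], so the greedy pass runs over these alone and costs
    a constant. *)
Definition par A v T := greedy A (T :\ v) (nbs v).
Definition parent A v T := if v \in T then par A v T else T.
Definition cand S v := v |: (S :\: [set u | e v u]).
Definition okchild A v S := misin (v |: A) (cand S v) && (par A v (cand S v) == S).
Definition children A v S :=
  if free S v then [:: v |: S]
  else S :: (if okchild A v S then [:: cand S v] else [::]).

Section AddVertex.

Variables (A : {set 'I_n}) (v : 'I_n).
Hypothesis Av : v \notin A.

(** A vertex of [A] outside the neighbourhood of [v] that is undominated after the deletion was
    undominated before it, hence already in [T]; the neighbours of [v] are handled by the greedy
    pass. *)
Lemma par_misin T : misin (v |: A) T -> v \in T -> misin A (par A v T).
Proof.
move=> mT Tv; have sTA : T :\ v \subset A.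
  apply/subsetP=> w; rewrite in_setD1 => /andP[nwv /(misin_sub mT)].
  by rewrite in_setU1 (negbTE nwv).
have sTT : {subset T :\ v <= T} by move=> w; rewrite in_setD1 => /andP[].
apply: indep_misin => [||w Aw fw]; first exact: greedy_subset.
  exact/greedy_indep/(indep_sub sTT)/(misin_indep mT).
have [lw|] := boolP (w \in nbs v); first exact: greedy_max fw.
rewrite mem_nbs => nvw; apply: greedy_sub; rewrite in_setD1.
have -> : w != v by apply: contraNneq Av => <-.
apply: (misin_in mT); first by rewrite setU1r.
rewrite -(setD1K Tv) freeU1 e_sym nvw /=; apply: free_sub fw; exact: greedy_sub.
Qed.

Lemma parent_misin T : misin (v |: A) T -> misin A (parent A v T).
Proof.
rewrite /parent; case: ifPn => [Tv mT|nTv mT]; first exact: par_misin.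
apply: indep_misin; last 2 first.
- exact: misin_indep mT.
- by move=> w Aw; apply: (misin_in mT); rewrite setU1r.
apply/subsetP=> w Tw; have := misin_sub mT Tw; rewrite in_setU1 => /predU1P[ewv|//].
by rewrite -ewv Tw in nTv.
Qed.

Lemma misin_add S : misin A S -> free S v -> misin (v |: A) (v |: S).
Proof.
move=> mS fv; apply: indep_misin.
- by apply/setUS/subsetP/(misin_sub mS).
- apply/indepP=> x; rewrite in_setU1 freeU1 => /predU1P[->|Sx]; first by rewrite e_irr.
  by rewrite e_sym (freeP _ _ fv) //=; apply: misin_free mS _.
- move=> w; rewrite !in_setU1 freeU1 => /predU1P[->|Aw]; rewrite ?eqxx //.
  by case/andP=> _ fw; rewrite (misin_in mS) ?orbT.
Qed.

Lemma misin_skip S : misin A S -> ~~ free S v -> misin (v |: A) S.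
Proof.
move=> mS nfv; apply: indep_misin; last 2 first.
- exact: misin_indep mS.
- move=> w; rewrite in_setU1 => /predU1P[->|]; first by rewrite (negbTE nfv).
  exact: misin_in mS.
by apply: subset_trans (subsetUr _ _); apply/subsetP/(misin_sub mS).
Qed.

(** A child [T] through [v] is forced. Greedy completion only adds vertices, so [T :\ v] lies in
    [S]; conversely a vertex of [S] not adjacent to [v] is undominated by [T], hence in [T] by
    maximality. Thus [T = cand S v]. If [v] is free for [S], the candidate is [v |: S], and [S]
    itself is no longer maximal. *)
Lemma childrenP S T : misin A S ->
  (T \in children A v S) = misin (v |: A) T && (parent A v T == S).
Proof.
move=> mS; have nSv : v \notin S by apply: contra Av; apply: misin_sub mS v.
apply/idP/andP=> [|[mT /eqP pT]].
  rewrite /children; case: ifPn => fv.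
    rewrite inE => /eqP->; rewrite misin_add //; split=> //.
    by rewrite /parent setU11 /par setU1K // greedy_id.
  rewrite inE => /predU1P[->|].
    by rewrite misin_skip // /parent (negbTE nSv).
  rewrite /okchild; case: ifP; rewrite // inE => /andP[mc pc] /eqP->.
  by rewrite mc /parent setU11.
have [Tv|nTv] := boolP (v \in T); last first.
  move: pT; rewrite /parent (negbTE nTv) => <-.
  rewrite /children; case: ifP; last by rewrite mem_head.
  by move=> fv; rewrite (misin_in mT) ?setU11 in nTv.
move: pT; rewrite /parent Tv => pT.
have sTS : {subset T :\ v <= S} by rewrite -pT; apply: greedy_sub.
have Tc : T = cand S v.
  apply/setP=> w; rewrite in_setU1 in_setD inE; have [->|nwv] /= := eqVneq w v.
    by rewrite Tv.
  apply/idP/andP=> [Tw|[nvw Sw]].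
    split; first by have /freeP := misin_free mT Tv; apply.
    by apply: sTS; rewrite in_setD1 nwv.
  apply: (misin_in mT); first by rewrite setU1r ?(misin_sub mS).
  rewrite -(setD1K Tv) freeU1 e_sym nvw; exact: free_sub sTS (misin_free mS Sw).
rewrite /children; case: ifPn => fv.
  rewrite inE Tc; apply/eqP/setP=> w; rewrite !in_setU1 !inE.
  by case Sw: (w \in S); rewrite ?andbF // (freeP _ _ fv).
by rewrite /okchild -Tc mT pT eqxx !inE eqxx orbT.
Qed.

Lemma children_uniq S : misin A S -> uniq (children A v S).
Proof.
move=> mS; rewrite /children; case: ifP => //= _; case: ifP => //= _.
rewrite inE !andbT; apply/eqP=> eS; have: v \in A.
  by apply: (misin_sub mS); rewrite eS setU11.
by apply/negP.
Qed.

(* The vertices whose domination must be tested lie at distance at most two from v. *)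
Lemma cand_misin S : misin A S -> ~~ free S v ->
  misin (v |: A) (cand S v) =
  [forall x in nbs v, forall w in nbs x,
     (w \in A) ==> (w \in cand S v) || ~~ free (cand S v) w].
Proof.
move=> mS nfv; apply/idP/forall_inP=> [mc x _|H].
  apply/forall_inP=> w _; apply/implyP=> Aw.
  have [_ /(_ w) <-] := misinP _ _ mc; first exact: orbN.
  by rewrite setU1r.
have sc : {subset S :\: [set u | e v u] <= S} by move=> w; rewrite in_setD => /andP[].
apply: indep_misin.
- by apply: setUS; apply/subsetP=> w /sc; apply: misin_sub mS w.
- apply/indepP=> w; rewrite in_setU1 freeU1 => /predU1P[->|Sw].
    by rewrite e_irr; apply/freeP=> u; rewrite in_setD inE => /andP[].
  move: (Sw); rewrite in_setD inE e_sym => /andP[-> Sw'] /=.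
  exact: free_sub sc (misin_free mS Sw').
- move=> w; rewrite in_setU1 => /predU1P[-> _|Aw fw]; first exact: setU11.
  move: (fw); rewrite freeU1 => /andP[nwv fw'].
  have [Sw|nSw] := boolP (w \in S).
    by rewrite in_setU1 in_setD inE e_sym nwv Sw orbT.
  have: ~~ free S w by apply: contra nSw; apply: misin_in mS Aw.
  (* The vertex [x] that dominates [w] in [S] was removed, so it is a neighbour of [v]; hence [w] is
     among the tested vertices. *)
  case/nfreeP=> x Sx ewx; have evx : e v x.
    by apply: contraTT ewx => nvx; apply: (freeP _ _ fw'); rewrite in_setD inE nvx.
  have := H x; rewrite mem_nbs => /(_ evx)/forall_inP/(_ w).
  by rewrite mem_nbs e_sym ewx Aw fw orbF => /(_ isT).
Qed.

End AddVertex.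

Definition nmis A := #|[set S | misin A S]|.

Lemma nmis_gt0 A : 0 < nmis A.
Proof.
have [|T mT _] := @misin_ext A set0 (sub0set _).
  by apply/indepP=> w; rewrite inE.
by apply/card_gt0P; exists T; rewrite inE.
Qed.

(** [parent] is onto: [S] is the parent of [v |: S] if [v] is free for [S], and of itself
    otherwise. *)
Lemma nmis_add A v : nmis A <= nmis (v |: A).
Proof.
have [Av|nAv] := boolP (v \in A); first by rewrite (setUidPr _) // sub1set.
apply: leq_trans (leq_imset_card (parent A v) _); apply/subset_leq_card/subsetP=> S.
rewrite inE => mS; have nSv : v \notin S by apply: contra nAv; apply: misin_sub mS v.
apply/imsetP; have [fv|fv] := boolP (free S v).
  exists (v |: S); first by rewrite inE misin_add.
  by rewrite /parent setU11 /par setU1K // greedy_id.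
by exists S; rewrite ?inE ?misin_skip // /parent (negbTE nSv).
Qed.

Lemma nmis_mono A B : A \subset B -> nmis A <= nmis B.
Proof.
move=> sAB; have -> : B = [set x in enum B] :|: A.
  apply/setP=> x; rewrite !inE mem_enum.
  by case: (boolP (x \in A)) => [/(subsetP sAB)->|]; rewrite ?orbF.
elim: (enum B) => [|x l IH]; first by rewrite [[set _ in _]]set_nil set0U.
by rewrite set_cons -setUA; apply: leq_trans IH (nmis_add _ _).
Qed.

Variable d : nat.
Hypothesis e_deg : max_degree_le e d.

Lemma size_nbs v : size (nbs v) <= d.
Proof.
apply: leq_trans (e_deg v); have/card_uniqP <- : uniq (nbs v) by rewrite filter_uniq ?enum_uniq.
by apply/eq_leq/eq_card=> u; rewrite mem_nbs inE.
Qed.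

Definition ball2 v := [set u | e v u] :|: \bigcup_(x in [set u | e v u]) [set u | e x u].

Lemma card_ball2 v : #|ball2 v| <= d + d * d.
Proof.
apply: leq_trans (leq_card_setU _ _) _; apply: leq_add; first exact: e_deg.
have: #|[set u | e v u]| <= d by exact: e_deg.
move: [set u | e v u] => X cX.
apply: leq_trans (_ : \sum_(x in X) d <= _); last by rewrite sum_nat_const leq_mul.
elim/big_rec2: _ => [|x m B _ IH]; first by rewrite cards0.
by apply: leq_trans (leq_card_setU _ _) _; apply: leq_add; first exact: e_deg.
Qed.

(** Bound for the number of traces of a set on [ball2 v]. Its inverse is the relative gain
    guaranteed by each completed closed neighbourhood. *)
Definition growth := 2 ^ (d + d * d).

(* Each maximal independent set S of A extends to one through u; replacing
   S near a neighbour v of u gives one avoiding u, and S is recovered from the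
   latter up to its trace on a ball of bounded size. *)
Lemma nmis_cluster A u : [disjoint A & u :: nbs u] -> nbs u != [::] ->
  growth.+1 * nmis A <= growth * nmis (A :|: [set x in u :: nbs u]).
Proof.
move=> dA; set B := A :|: _.
have nA x : (x == u) || e u x -> x \notin A.
  move=> ux; apply: contraTN dA => Ax; apply/pred0Pn; exists x.
  by rewrite /= Ax inE mem_nbs.
case Eu: (nbs u) => [//|v l] _.
have euv : e u v by rewrite -mem_nbs Eu mem_head.
have Bu : u \in B by rewrite !inE eqxx orbT.
have Bv : v \in B by rewrite !inE mem_nbs euv !orbT.
have nfA x S : misin A S -> x \in A -> ~~ e x u.
  by move=> mS Ax; apply: contraL Ax => exu; apply: nA; rewrite e_sym exu orbT.
(* Sets through [u]: [S] extends to [u |: S], which is maximal because every other new vertex is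
   adjacent to [u], and which determines [S] because [u] is not in [A]. *)
have H1 : nmis A <= #|[set T | misin B T & u \in T]|.
  rewrite /nmis -(@card_in_imset _ _ (fun S => u |: S)).
    apply/subset_leq_card/subsetP=> T /imsetP[S]; rewrite inE => mS ->.
    have fu : free S u.
      apply/freeP=> x /(misin_sub mS); apply: contraL => eux; apply: nA.
      by rewrite eux orbT.
    rewrite inE setU11 andbT; apply: indep_misin.
    - rewrite subUset sub1set Bu (subset_trans _ (subsetUl _ _)) //.
      exact/subsetP/(misin_sub mS).
    - apply/indepP=> x; rewrite in_setU1 freeU1 => /predU1P[->|Sx].
        by rewrite e_irr.
      by rewrite (nfA _ _ mS) ?(misin_free mS) // (misin_sub mS).
    - move=> w; rewrite in_setU freeU1 !inE mem_nbs => Bw /andP[nwu fw].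
      case/or3P: Bw => [Aw|->//|]; last by rewrite e_sym (negbTE nwu).
      by rewrite (misin_in mS) ?orbT.
  move=> S T; rewrite !inE => mS mT eST.
  rewrite -(setU1K (_ : u \notin S)) ?eST ?setU1K //.
    by apply/negP=> /(misin_sub mT); apply/negP/nA; rewrite eqxx.
  by apply/negP=> /(misin_sub mS); apply/negP/nA; rewrite eqxx.
(* Sets avoiding [u]: the neighbour [v] is forced in, its neighbours are dropped, and the result is
   completed in [B]. Having [v], it misses [u]. *)
have H2 : nmis A <= growth * #|[set T | misin B T & u \notin T]|.
  pose F S := greedy B (cand S v) (enum B).
  have FP S : misin A S -> [/\ misin B (F S), u \notin F S & {subset cand S v <= F S}].
    move=> mS; have ic : indep (cand S v).
      apply/indepP=> x; rewrite in_setU1 freeU1 => /predU1P[->|].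
        by rewrite e_irr; apply/freeP=> y; rewrite in_setD inE => /andP[].
      rewrite in_setD inE e_sym => /andP[-> Sx] /=; apply: free_sub (misin_free mS Sx).
      by move=> y; rewrite in_setD => /andP[].
    have mF : misin B (F S).
      apply: indep_misin => [||w Bw fw].
      - apply: greedy_subset; rewrite subUset sub1set Bv; apply/subsetP=> y.
        by rewrite in_setD => /andP[_ /(misin_sub mS) Ay]; rewrite in_setU Ay.
      - exact: greedy_indep.
      - by apply: greedy_max; rewrite ?mem_enum.
    have sF : {subset cand S v <= F S} by exact: greedy_sub.
    split=> //; apply: contraTN euv => Fu.
    apply: (freeP _ _ (misin_free mF Fu)); apply: sF; exact: setU11.
  pose G S := (F S, S :&: ball2 v).
  have Ginj : {in [set S | misin A S] &, injective G}.
    suff rec S : misin A S -> S = (F S :&: A :\: ball2 v) :|: (S :&: ball2 v).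
      move=> S T; rewrite !inE => mS mT [eF eX]; rewrite (rec S) // (rec T) //.
      by rewrite eF eX.
    move=> mS; have [mF _ sF] := FP S mS; apply/setP=> w.
    rewrite in_setU in_setD !in_setI.
    have [Xw|/=] := boolP (w \in ball2 v); first by rewrite andbT.
    rewrite andbF orbF in_setU inE => /norP[nvw nX].
    apply/idP/andP=> [Sw|[Fw Aw]].
      split; last exact: misin_sub mS w Sw.
      by apply: sF; rewrite in_setU1 in_setD inE nvw Sw orbT.
    (* A vertex [x] of [S] dominating [w] is not adjacent to [v], since [w] is off the ball. So [x]
       survives in [F S], which would contain both ends of an edge. *)
    apply: (misin_in mS Aw); apply/freeP=> x Sx; apply/negP=> ewx.
    have [evx|nvx] := boolP (e v x).
      by case/negP: nX; apply/bigcupP; exists x; rewrite inE // e_sym.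
    have Fx : x \in F S by apply: sF; rewrite in_setU1 in_setD inE nvx Sx orbT.
    by have := freeP _ _ (misin_free mF Fw) _ Fx; rewrite ewx.
  rewrite /nmis -(card_in_imset Ginj).
  apply: leq_trans (_ : #|setX [set T | misin B T & u \notin T] (powerset (ball2 v))| <= _).
    apply/subset_leq_card/subsetP=> Y /imsetP[S]; rewrite inE => mS ->.
    by rewrite in_setX inE; case: (FP S mS) => -> ->; rewrite /= powersetE subsetIr.
  rewrite cardsX card_powerset mulnC leq_mul2r leq_pexp2l ?card_ball2 ?orbT //.
have -> : nmis B = #|[set T | misin B T & u \in T]| + #|[set T | misin B T & u \notin T]|.
  rewrite /nmis -(cardsID [set T : {set 'I_n} | u \in T]); congr (_ + _); apply: eq_card => T.
    by rewrite !inE.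
  by rewrite !inE andbC.
by rewrite mulSn mulnDr addnC leq_add // leq_mul2l H1 orbT.
Qed.

End MaximalIndependentSets.

(** * The traversal of the reverse search tree: outputs, number of steps, delay *)

Section ReverseSearch.

Variables (n : nat) (e : rel 'I_n).
Hypotheses (e_sym : symmetric e) (e_irr : irreflexive e).
Variables (A0 : {set 'I_n}) (o : seq 'I_n) (v0 : 'I_n).
Hypotheses (o_uniq : uniq o) (o_A0 : forall x, x \in o -> x \notin A0).
Implicit Types (S T : {set 'I_n}) (h k : nat).

(** Heights count down: vertices are added from the end of [o], so its head comes last, [lv 0] is
    complete, and [v h] is the vertex added between heights [h.+1] and [h]. *)
Definition lv h := A0 :|: [set x in drop h o].
Let N := size o.
Let v h := nth v0 o h.

Lemma lvS h : h < N -> lv h = v h |: lv h.+1.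
Proof.
move=> hN; rewrite /lv (drop_nth v0) //; apply/setP=> x; rewrite !inE.
by rewrite orbCA.
Qed.

Lemma lv_notin h : h < N -> v h \notin lv h.+1.
Proof.
move=> hN; rewrite !inE negb_or o_A0 ?mem_nth //=.
by have := drop_uniq h o_uniq; rewrite (drop_nth v0 hN) => /andP[].
Qed.

(* The vertices of o from position dht on have been added; dup tells that the
   subtree below this node has been exhausted. *)
Record dstate := DState { dup : bool; dht : nat; dset : {set 'I_n} }.

Definition dout s := ~~ dup s && (dht s == 0).
Definition dfinal s := dup s && (dht s == N).

(** On the way up, membership of [v h] tells which child is being left. If [v h] is in the set, this
    is the last child, and [par] yields the parent. Otherwise it is the first child, which equals
    its parent as a set, and the candidate is tried next. *)
Definition dstep (s : dstate) : dstate :=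
  let: DState b h X := s in
  if b then
    if h == N then s
    else if v h \in X then DState true h.+1 (par e (lv h.+1) (v h) X)
    else if okchild e (lv h.+1) (v h) X then DState false h (cand e X (v h))
    else DState true h.+1 X
  else if h is k.+1 then
    DState false k (if free e X (v k) then v k |: X else X)
  else DState true 0 X.

Definition dvalid s := misin e (lv (dht s)) (dset s) && (dht s <= N).

Definition douts k s :=
  [seq dset (iter i dstep s) | i <- iota 0 k & dout (iter i dstep s)].

Lemma doutsD a b s : douts (a + b) s = douts a s ++ douts b (iter a dstep s).
Proof.
rewrite /douts iotaD filter_cat map_cat add0n; congr (_ ++ _).
rewrite -[a in iota a]addn0 iotaDl filter_map -map_comp.
have it i : iter i dstep (iter a dstep s) = iter (a + i) dstep s.
  by rewrite addnC iterD.
rewrite (eq_filter (a2 := fun i => dout (iter i dstep (iter a dstep s)))); last first.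
  by move=> i; rewrite /= it.
by apply: eq_map => i /=; rewrite it.
Qed.

Fixpoint leaves h S : seq {set 'I_n} :=
  if h is k.+1 then flatten [seq leaves k T | T <- children e (lv k.+1) (v k) S]
  else [:: S].

Fixpoint nodes h S : nat :=
  if h is k.+1 then (\sum_(T <- children e (lv k.+1) (v k) S) nodes k T).+1
  else 1.

Lemma nodes_gt0 h S : 0 < nodes h S.
Proof. by case: h. Qed.

Definition dseg (P : dstate -> Prop) s k l s' :=
  [/\ iter k dstep s = s', douts k s = l & forall i, i < k -> P (iter i dstep s)].

Lemma dseg_trans (P : dstate -> Prop) s k l s' k' l' s'' :
  dseg P s k l s' -> dseg P s' k' l' s'' -> dseg P s (k + k') (l ++ l') s''.
Proof.
move=> [E1 O1 P1] [E2 O2 P2]; split.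
- by rewrite addnC iterD E1.
- by rewrite doutsD O1 E1 O2.
- move=> i; case: (ltnP i k) => [/P1//|ki lik].
  have -> : i = (i - k) + k by rewrite subnK.
  by rewrite iterD E1; apply: P2; rewrite ltn_subLR.
Qed.

Lemma dseg_sub (P Q : dstate -> Prop) s k l s' :
  (forall x, P x -> Q x) -> dseg P s k l s' -> dseg Q s k l s'.
Proof. by move=> PQ [E1 O1 P1]; split=> // i /P1/PQ. Qed.

Lemma dseg1 (P : dstate -> Prop) s s' :
  dstep s = s' -> P s -> dseg P s 1 (if dout s then [:: dset s] else [::]) s'.
Proof. by move=> E Ps; split=> [||[]] //; rewrite /douts /=; case: (dout s). Qed.

(** Taken at the height of the root, it says that the traversal does not reach its final state
    early. *)
Definition below h s := ~~ (dup s && (h <= dht s)).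

(** Each node of the subtree occurs once descending and once ascending. The last of these
    [2 * nodes h S] states is the endpoint, which explains the predecessor. *)
Lemma dseg_subtree h S : h <= N -> misin e (lv h) S ->
  dseg (below h) (DState false h S) (2 * nodes h S).-1 (leaves h S) (DState true h S).
Proof.
elim: h S => [|k IH] S hN mS.
  exact: (@dseg1 _ (DState false 0 S)).
set vk := v k; pose A := lv k.+1; have nA : vk \notin A by exact: lv_notin.
have eA : lv k = vk |: A by exact: lvS.
have nS : vk \notin S by apply: contra nA; apply: misin_sub mS vk.
have IHT T : misin e (vk |: A) T ->
  dseg (below k.+1) (DState false k T) (2 * nodes k T).-1 (leaves k T) (DState true k T).
  rewrite -eA => mT; apply: dseg_sub (IH T (ltnW hN) mT) => x.
  by rewrite /below; apply: contra => /andP[-> /ltnW->].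
have chP T := childrenP e_sym e_irr nA T mS.
pose T1 := if free e S vk then vk |: S else S.
have D1 : dseg (below k.+1) (DState false k.+1 S) 1 [::] (DState false k T1).
  exact: (@dseg1 _ (DState false k.+1 S)).
have nk : (k == N) = false by rewrite ltn_eqF.
rewrite /= -/vk -/A /children; case: ifP D1 => fv D1.
  have : T1 \in children e A vk S by rewrite /children fv /T1 fv mem_head.
  rewrite chP => /andP[mT1 pT1]; rewrite /T1 fv in D1 mT1 pT1.
  have D3 : dseg (below k.+1) (DState true k (vk |: S)) 1 [::] (DState true k.+1 S).
    apply: (@dseg1 _ (DState true k (vk |: S))); rewrite /below /= ?ltnn //.
    rewrite nk -/vk setU11; congr DState.
    by move: pT1; rewrite /parent setU11 => /eqP.
  have := dseg_trans (dseg_trans D1 (IHT _ mT1)) D3.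
  rewrite /= cats0 big_seq1; congr dseg.
  by have := nodes_gt0 k (vk |: S); lia.
rewrite /T1 fv in D1.
have mS' : misin e (vk |: A) S by apply: misin_skip => //; rewrite fv.
have D2 := dseg_trans D1 (IHT _ mS').
case: ifP => ok.
  have : cand e S vk \in children e A vk S by rewrite /children fv ok !inE eqxx orbT.
  rewrite chP => /andP[mc pc].
  have D3 : dseg (below k.+1) (DState true k S) 1 [::] (DState false k (cand e S vk)).
    apply: (@dseg1 _ (DState true k S)); rewrite /below /= ?ltnn //.
    by rewrite nk -/vk (negbTE nS) ok.
  have D4 : dseg (below k.+1) (DState true k (cand e S vk)) 1 [::] (DState true k.+1 S).
    apply: (@dseg1 _ (DState true k (cand e S vk))); rewrite /below /= ?ltnn //.
    rewrite nk -/vk setU11; congr DState.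
    by move: pc; rewrite /parent setU11 => /eqP.
  have := dseg_trans (dseg_trans (dseg_trans D2 D3) (IHT _ mc)) D4.
  rewrite /= !cats0 big_cons big_seq1; congr dseg.
  have := nodes_gt0 k S; have := nodes_gt0 k (cand e S vk); lia.
have D3 : dseg (below k.+1) (DState true k S) 1 [::] (DState true k.+1 S).
  apply: (@dseg1 _ (DState true k S)); rewrite /below /= ?ltnn //.
  by rewrite nk -/vk (negbTE nS) ok.
have := dseg_trans D2 D3.
rewrite /= !cats0 big_seq1; congr dseg.
by have := nodes_gt0 k S; lia.
Qed.

(** The node of height [h] above the leaf [T]. Being a function of the leaf, it shows both that
    every set is reached and that siblings have disjoint lists of leaves. *)
Fixpoint anc h T := if h is k.+1 then parent e (lv k.+1) (v k) (anc k T) else T.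

Lemma anc_misin h T : h <= N -> misin e (lv 0) T -> misin e (lv h) (anc h T).
Proof.
move=> hN mT; elim: h hN => //= k IH kN.
by apply: parent_misin; rewrite ?lv_notin -?lvS // IH // ltnW.
Qed.

Lemma mem_leaves h S T : h <= N -> misin e (lv h) S ->
  (T \in leaves h S) = misin e (lv 0) T && (anc h T == S).
Proof.
elim: h S => [|k IH] S hN mS.
  rewrite inE eq_sym /=; case: eqP => [<-|]; rewrite ?andbT ?andbF //.
have chP T' := childrenP e_sym e_irr (lv_notin hN) T' mS.
apply/flatten_mapP/andP=> [[T']|[mT /eqP pT]].
  rewrite chP -lvS // => /andP[mT' pT'].
  by rewrite IH 1?ltnW //= => /andP[-> /eqP->].
have mA := anc_misin (ltnW hN) mT; exists (anc k T).
  by rewrite chP -lvS // mA -[S]pT eqxx.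
by rewrite IH 1?ltnW // mT eqxx.
Qed.

Lemma leaves_uniq h S : h <= N -> misin e (lv h) S -> uniq (leaves h S).
Proof.
elim: h S => [|k IH] S hN mS //=.
have: {subset children e (lv k.+1) (v k) S <= [pred T | misin e (lv k) T]}.
  by move=> T; rewrite (childrenP e_sym e_irr (lv_notin hN)) // inE -lvS // => /andP[].
have := children_uniq (lv_notin hN) mS; move: (children _ _ _ _).
elim=> //= T l IHl /andP[nTl ul] sl.
have mT : misin e (lv k) T by apply: sl; apply: mem_head.
have sl' : {subset l <= [pred T | misin e (lv k) T]}.
  by move=> x xl; apply: sl; rewrite inE xl orbT.
rewrite cat_uniq IH 1?ltnW // IHl // andbT; apply/hasPn=> U /flatten_mapP[T' lT'].
rewrite mem_leaves 1?ltnW ?sl' // => [/andP[mU /eqP aU]|]; last exact: sl'.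
by rewrite mem_leaves 1?ltnW // mU aU /=; apply: contraNneq nTl => <-.
Qed.

(** Grouping the sets of height [k] by their parents turns the double sum over nodes and children
    into one sum over the next level. *)
Lemma nodes_sum h : h <= N ->
  \sum_(S | misin e (lv h) S) nodes h S = \sum_(k < h.+1) nmis e (lv k).
Proof.
elim: h => [_|k IH hN].
  rewrite big_ord_recr big_ord0 /= sum1dep_card add0n /nmis; apply: eq_card => S.
  by rewrite inE.
rewrite big_ord_recr /= -IH 1?ltnW //.
have nA := lv_notin hN.
rewrite (eq_bigr (fun S => 1 + \sum_(T | misin e (lv k) T &&
  (parent e (lv k.+1) (v k) T == S)) nodes k T)); last first.
  move=> S mS; rewrite /= -add1n; congr (_ + _).
  rewrite big_uniq ?children_uniq //; apply: eq_bigl => T.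
  by rewrite childrenP // -lvS.
rewrite big_split /= addnC; congr (_ + _).
  rewrite [RHS](partition_big (parent e (lv k.+1) (v k)) (misin e (lv k.+1))) //.
  by move=> T mT; apply: parent_misin; rewrite -?lvS.
by rewrite sum1dep_card /nmis; apply: eq_card => S; rewrite inE.
Qed.

Lemma dstep_valid s : dvalid s -> dvalid (dstep s).
Proof.
case: s => b h S /andP[] /= mS hN; case: b => /=.
  case: ifPn => hN'; first by rewrite /dvalid /= mS.
  have {hN hN'} hN : h < N by rewrite ltn_neqAle hN'.
  have nA := lv_notin hN; rewrite lvS // in mS; rewrite /dvalid.
  case: ifPn => vS /=; first by rewrite par_misin.
  case: ifPn => [/andP[mc _]|_] /=; first by rewrite lvS // mc ltnW.
  by rewrite hN andbT; have := parent_misin e_sym e_irr nA mS; rewrite /parent (negbTE vS).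
case: h mS hN => [|k] mS hN; rewrite /dvalid /= ?mS // lvS // (ltnW hN) andbT.
by case: ifPn => fv; [apply: misin_add | apply: misin_skip].
Qed.

(* Bounds the number of steps before the next output. *)
Definition dpot s := if dup s then (N - dht s) + N.+1 else dht s.

(** An ascent passes at most [N - dht s] levels before it turns, and the descent then starts from at
    most [N]; the summand [N.+1] in the potential pays for that turn. *)
Lemma dpot_step s : dvalid s -> ~~ dout s -> ~~ dfinal s -> dpot (dstep s) < dpot s.
Proof.
case: s => b h S /andP[] /= mS hN; rewrite /dout /dfinal /dpot /=; case: b => /=.
  move=> _ hN'; have {hN hN'} hN : h < N by rewrite ltn_neqAle hN'.
  rewrite ltn_eqF //; case: (v h \in S) => /=; first by lia.
  by case: (okchild _ _ _ _) => /=; lia.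
by case: h mS hN => [|k] //= _ _ _ _.
Qed.

(** Uniqueness of the set at the starting level makes the forest a single tree with root [S0]. *)
Theorem reverse_search S0 : (forall S, misin e A0 S = (S == S0)) ->
  exists K, [/\ dfinal (iter K dstep (DState false N S0)),
    forall i, i < K -> ~~ dfinal (iter i dstep (DState false N S0)),
    uniq (douts K (DState false N S0)) /\
      (forall S, (S \in douts K (DState false N S0)) = misin e (A0 :|: [set x in o]) S)
  & K <= 2 * \sum_(h < N.+1) nmis e (lv h)].
Proof.
move=> mA; have lvN : lv N = A0.
  by apply/setP=> x; rewrite !inE drop_size in_nil orbF.
have lv0 : lv 0 = A0 :|: [set x in o] by rewrite /lv drop0.
have mS0 : misin e (lv N) S0 by rewrite lvN mA.
have [E O P] := dseg_subtree (leqnn N) mS0.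
exists (2 * nodes N S0).-1; split.
- by rewrite E /dfinal /= eqxx.
- move=> i /P; apply: contra; rewrite /dfinal => /andP[-> /eqP->]; exact: leqnn.
- rewrite O; split=> [|S]; first exact: leaves_uniq.
  rewrite mem_leaves // lv0 -mA; case mS: (misin e _ S) => //=.
  by rewrite -lvN anc_misin // lv0.
- rewrite -nodes_sum // lvN (big_pred1 S0) //; exact: leq_pred.
Qed.

End ReverseSearch.

(** * Bounding the sum of all levels by the last level *)

Section LevelSum.

Variables (n : nat) (e : rel 'I_n).
Hypotheses (e_sym : symmetric e) (e_irr : irreflexive e).
Variable d : nat.
Hypothesis e_deg : max_degree_le e d.
Variable A0 : {set 'I_n}.

Let M (l : seq 'I_n) := nmis e (A0 :|: [set x in l]).
Let tot (l : seq 'I_n) := \sum_(h < (size l).+1) M (drop h l).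

Lemma tot_cons x l : tot (x :: l) = M (x :: l) + tot l.
Proof. by rewrite /tot big_ord_recl drop0. Qed.

Lemma M_cons x l : M l <= M (x :: l).
Proof.
apply: nmis_mono => //; apply: setUS; apply/subsetP=> y; rewrite !inE => ->.
exact: orbT.
Qed.

Lemma M_cat l1 l2 : M l2 <= M (l1 ++ l2).
Proof. by elim: l1 => //= x l IH; apply: leq_trans IH (M_cons _ _). Qed.

Lemma tot_cat l1 l2 : tot (l1 ++ l2) <= size l1 * M (l1 ++ l2) + tot l2.
Proof.
elim: l1 => //= x l IH; rewrite tot_cons mulSn -addnA leq_add2l.
by apply: leq_trans IH _; rewrite leq_add2r leq_mul2l M_cons orbT.
Qed.

Lemma tot_triv l : tot l <= (size l).+1 * M l.
Proof.
rewrite -{1}[l]cats0; apply: leq_trans (tot_cat _ _) _.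
rewrite cats0 mulSn addnC leq_add2r /tot /= big_ord_recr big_ord0 /= add0n.
by have := M_cat l [::]; rewrite cats0.
Qed.

Let K := growth d.
Let cl u := u :: nbs e u.
Let W us := flatten [seq cl u | u <- us].

Section Clusters.

Variables (us left : seq 'I_n).
Hypotheses (o_uniq : uniq (W us ++ left))
  (o_A0 : forall x, x \in W us ++ left -> x \notin A0)
  (us_nbs : forall u, u \in us -> nbs e u != [::])
  (left_nbs : forall x, x \in left -> exists2 y, e y x & y \in W us).

Lemma cluster_growth u l : uniq (cl u ++ l) ->
  (forall x, x \in cl u -> x \notin A0) -> nbs e u != [::] ->
  K.+1 * M l <= K * M (cl u ++ l).
Proof.
move=> ul dl nu; set A := A0 :|: [set x in l].
have dA : [disjoint A & u :: nbs e u].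
  rewrite disjoint_sym disjoint_has; apply/hasPn=> x xu /=.
  rewrite /A !inE negb_or dl //=.
  move: ul; rewrite cat_uniq => /and3P[_ /hasPn H _].
  by apply/negP=> /H; rewrite /= xu.
have := nmis_cluster e_sym e_irr e_deg dA nu.
congr (_ <= _ * nmis e _).
apply/setP=> x; rewrite /A in_setU in_setU [in RHS]in_setU 3!in_set mem_cat.
by rewrite -orbA; congr (_ || _); rewrite orbC.
Qed.

(** Supplies the growth inequality at each cluster, so that the disjointness conditions are
    discharged only once for both counts below. *)
Lemma cluster_ind (P : seq 'I_n -> Prop) : P [::] ->
  (forall u us', K.+1 * M (W us' ++ left) <= K * M (W (u :: us') ++ left) ->
    P us' -> P (u :: us')) -> P us.
Proof.
move=> P0 PS; elim: (us) o_uniq o_A0 us_nbs => // u us' IH ul dl nu.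
have eW : W (u :: us') ++ left = cl u ++ (W us' ++ left) by rewrite catA.
apply: PS; rewrite eW in ul dl *.
  apply: cluster_growth => //; last by apply: nu; apply: mem_head.
  by move=> x xu; apply: dl; rewrite mem_cat xu.
apply: IH => [|x xl|x xl].
- by move: ul; rewrite cat_uniq => /and3P[].
- by apply: dl; rewrite mem_cat xl orbT.
- by apply: nu; rewrite inE xl orbT.
Qed.

Lemma size_W us' : size (W us') <= size us' * d.+1.
Proof.
elim: us' => //= u us' IH; rewrite size_cat mulSn addSn ltnS leq_add //.
exact: size_nbs.
Qed.

(** A geometric series. A cluster contributes at most [d.+1] levels, none larger than the one it
    completes, and the completed levels grow by the factor [K.+1 / K]; summing gives the factor
    [K.+1]. *)
Lemma tot_clusters : tot (W us ++ left) <= d.+1 * K.+1 * M (W us ++ left) + tot left.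
Proof.
apply: (@cluster_ind (fun us' =>
  tot (W us' ++ left) <= d.+1 * K.+1 * M (W us' ++ left) + tot left))
  => [|u us'' G IH]; first exact: leq_addl.
have -> : W (u :: us'') ++ left = cl u ++ (W us'' ++ left) by rewrite catA.
have {}G : K.+1 * M (W us'' ++ left) <= K * M (cl u ++ (W us'' ++ left)) by move: G; rewrite catA.
apply: leq_trans (tot_cat _ _) _.
have sc : size (cl u) <= d.+1 by rewrite ltnS size_nbs.
move: G IH sc; set a := M (cl u ++ _); set b := M (W us'' ++ _).
move: (tot left) (tot (W us'' ++ left)) (size _) => t t' c G IH sc.
have : d.+1 * K.+1 * b <= d.+1 * (K * a) by rewrite -mulnA leq_mul2l G orbT.
have : c * a <= d.+1 * a by rewrite leq_mul2r sc orbT.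
rewrite !mulnA !mulnS mulnDl; lia.
Qed.

(** Bernoulli's inequality for [1 + 1 / K], cleared of denominators. Growth linear in the number of
    clusters is what the vertices outside them require. *)
Lemma growth_clusters : (K + size us) * M left <= K * M (W us ++ left).
Proof.
have K0 : 0 < K by rewrite /K /growth expn_gt0.
apply: (@cluster_ind (fun us' =>
  (K + size us') * M left <= K * M (W us' ++ left))) => [|u us'' G IH]; first by rewrite addn0.
rewrite -(leq_pmul2l K0) /=.
apply: leq_trans (_ : K.+1 * (K * M (W us'' ++ left)) <= _); last first.
  by rewrite mulnCA leq_mul2l G orbT.
apply: leq_trans (_ : K.+1 * ((K + size us'') * M left) <= _).
  by rewrite !mulnA leq_mul2r; apply/orP; right; lia.
by rewrite leq_mul2l IH orbT.
Qed.

Lemma size_left : size left <= size us * (d.+1 * d).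
Proof.
have ul : uniq left by move: o_uniq; rewrite cat_uniq => /and3P[].
apply: leq_trans (_ : size (flatten [seq nbs e y | y <- W us]) <= _).
  apply: uniq_leq_size => // x /left_nbs[y eyx Wy]; apply/flatten_mapP.
  by exists y; rewrite ?mem_nbs.
rewrite mulnA; apply: leq_trans (_ : size (W us) * d <= _).
  elim: (W us) => //= y l IH; rewrite size_cat mulSn leq_add //; exact: size_nbs.
by rewrite leq_mul2r size_W orbT.
Qed.

(** Within [left] no growth is guaranteed, so each of its levels is estimated by [M left]. Their
    number is at most proportional to the number of clusters, and [growth_clusters] absorbs this
    factor. *)
Lemma level_sum :
  tot (W us ++ left) <= (d.+1 * K.+1 + (d.+1 * d).+1 * K) * M (W us ++ left).
Proof.
apply: leq_trans tot_clusters _; rewrite mulnDl leq_add2l.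
apply: leq_trans (tot_triv _) _; rewrite -mulnA.
apply: leq_trans (_ : (d.+1 * d).+1 * ((K + size us) * M left) <= _).
  rewrite mulnA leq_mul2r; apply/orP; right.
  have K0 : 0 < K by rewrite /K /growth expn_gt0.
  by have := size_left; move: (d.+1 * d) => q; nia.
by rewrite leq_mul2l growth_clusters orbT.
Qed.

End Clusters.

End LevelSum.

(** * A loop-free command language and its compilation *)

Inductive expr :=
| EReg of nat
| ECst of nat
| EX
| EAdd of expr & expr
| ESub of expr & expr
| EArr of nat & expr.

(** Without a loop construct, each compiled instruction is executed at most once, so code size
    bounds running time. *)
Inductive cmd :=
| CSkip
| CAsg of nat & expr
| CSto of nat & expr & expr
| CSeq of cmd & cmd
| CIf of expr & cmd & cmd.

(* Bounds all register and array indices, constants and stack depths that occur. *)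
Fixpoint ewt (e : expr) : nat :=
  match e with
  | EReg r => r.+1
  | ECst c => c.+1
  | EX => 1
  | EAdd e1 e2 | ESub e1 e2 => (ewt e1 + ewt e2).+1
  | EArr q e => (q + ewt e).+1
  end.

Fixpoint cwt (c : cmd) : nat :=
  match c with
  | CSkip => 1
  | CAsg r e => (r + ewt e).+1
  | CSto q e1 e2 => (q + ewt e1 + ewt e2).+1
  | CSeq c1 c2 => cwt c1 + cwt c2
  | CIf e c1 c2 => ewt e + cwt c1 + cwt c2
  end.

Record astate := AState { rg : nat -> nat; ar : nat -> nat -> nat }.

Definition setr a r v := AState (upd (rg a) r v) (ar a).
Definition seta a q i v :=
  AState (rg a) (fun q' => if q' == q then upd (ar a q) i v else ar a q').

Section Compile.

(* Cell 0 holds X; register r is cell r.+1, temporary k is cell B.+1 + k, and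
   entry i < X of array q is cell q * X + i. *)
Variable B : nat.
Let K := (2 * B).+1.
Definition tmp k := B.+1 + k.

(** Stack evaluation: the value goes to temporary [k] and only temporaries from [k] on are touched.
    A copy is a clearing followed by an addition, and [q] additions of cell 0 replace the
    multiplication by [X]. *)
Fixpoint compE (e : expr) (k : nat) : seq instr :=
  let t := tmp k in
  match e with
  | EReg r => [:: IConst t 0; IAdd t t r.+1]
  | ECst c => [:: IConst t c]
  | EX => [:: IConst t 0; IAdd t t 0]
  | EAdd e1 e2 => compE e1 k ++ compE e2 k.+1 ++ [:: IAdd t t (tmp k.+1)]
  | ESub e1 e2 => compE e1 k ++ compE e2 k.+1 ++ [:: ISub t t (tmp k.+1)]
  | EArr q e => compE e k ++ nseq q (IAdd t t 0) ++ [:: ILoad t t]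
  end.

Fixpoint csize (c : cmd) : nat :=
  match c with
  | CSkip => 0
  | CAsg r e => size (compE e 0) + 2
  | CSto q e1 e2 => size (compE e1 0) + q + size (compE e2 1) + 1
  | CSeq c1 c2 => csize c1 + csize c2
  | CIf e c1 c2 => size (compE e 0) + 1 + csize c1 + 2 + csize c2
  end.

(** Jump targets are absolute, hence the argument [b]. Clearing temporary 0 before [IJz] makes the
    jump unconditional. *)
Fixpoint compC (c : cmd) (b : nat) : seq instr :=
  match c with
  | CSkip => [::]
  | CAsg r e => compE e 0 ++ [:: IConst r.+1 0; IAdd r.+1 r.+1 (tmp 0)]
  | CSto q e1 e2 =>
      compE e1 0 ++ nseq q (IAdd (tmp 0) (tmp 0) 0) ++ compE e2 1 ++
      [:: IStore (tmp 0) (tmp 1)]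
  | CSeq c1 c2 => compC c1 b ++ compC c2 (b + csize c1)
  | CIf e c1 c2 =>
      let b1 := b + size (compE e 0) + 1 in
      let b2 := b1 + csize c1 + 2 in
      compE e 0 ++ [:: IJz (tmp 0) b2] ++ compC c1 b1 ++
      [:: IConst (tmp 0) 0; IJz (tmp 0) (b2 + csize c2)] ++ compC c2 b2
  end.

Lemma size_compC c b : size (compC c b) = csize c.
Proof.
elim: c b => //= [r e|q e1 e2|c1 IH1 c2 IH2|e c1 IH1 c2 IH2] b.
- by rewrite size_cat.
- by rewrite !size_cat size_nseq /=; lia.
- by rewrite size_cat IH1 IH2.
- by rewrite !size_cat /= size_cat /= IH1 IH2; lia.
Qed.

Variable qo : nat.

(** Address of entry 1, not entry 0, of array [q]: vertex [v] is stored at index [v.+1], while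
    [IOut] expects it at offset [v]. *)
Fixpoint base q := if q is q'.+1 then EAdd (base q') EX else ECst 1.

Lemma ewt_base q : ewt (base q) = 2 * q + 2.
Proof. by elim: q => //= q ->; lia. Qed.

(** A while loop with a conditional output after each round. Address [b3] is just behind [IOut], and
    [b3 + 2] is the first address after the loop. *)
Definition compL e body eo b :=
  let b1 := b + size (compE e 0) + 1 in
  let b2 := b1 + csize body in
  let b3 := b2 + size (compE eo 0) + 1 + size (compE (base qo) 0) + 1 in
  compE e 0 ++ [:: IJz (tmp 0) (b3 + 2)] ++ compC body b1 ++
  compE eo 0 ++ [:: IJz (tmp 0) b3] ++ compE (base qo) 0 ++
  [:: IOut (tmp 0); IConst (tmp 0) 0; IJz (tmp 0) b].

Definition lsize e body eo :=
  size (compE e 0) + 1 + csize body + size (compE eo 0) + 1 + size (compE (base qo) 0) + 3.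

Lemma size_compL e body eo b : size (compL e body eo b) = lsize e body eo.
Proof.
rewrite /compL /lsize; do !(rewrite size_cat || rewrite size_compC || cbn [size]); lia.
Qed.

Variables (p : seq instr) (X : nat).
Hypothesis KX : K <= X.

Definition code_at b (l : seq instr) :=
  forall i, i < size l -> nth IHalt p (b + i) = nth IHalt l i.

Lemma code_cat b l1 l2 :
  code_at b (l1 ++ l2) -> code_at b l1 /\ code_at (b + size l1) l2.
Proof.
move=> H; split=> i il.
  by rewrite H ?size_cat ?ltn_addr // nth_cat il.
rewrite -addnA H ?size_cat ?ltn_add2l // nth_cat ltnNge leq_addr /=.
by rewrite addKn.
Qed.

Lemma code_cons b i l : code_at b (i :: l) -> nth IHalt p b = i /\ code_at b.+1 l.
Proof.
move=> H; split=> [|j jl]; first by rewrite -[b]addn0 H.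
by rewrite addSnnS H.
Qed.

(** Expression values stay below [B * X]; forming an array address adds at most another [B * X],
    which gives the factor 2. *)
Definition good (m : nat -> nat) :=
  (forall c, m c <= 2 * B * X) /\ (forall c, B * X <= c -> m c = 0).

Definition quiet (s : state) := [/\ ~~ halted p s, ~~ is_out p s & good (Defs.mem s)].

Definition go s t s' := exec p s t = s' /\ forall u, u < t -> quiet (exec p s u).

Lemma execD s t t' : exec p s (t + t') = exec p (exec p s t) t'.
Proof. by rewrite /exec addnC iterD. Qed.

Lemma go0 s : go s 0 s.
Proof. by []. Qed.

Lemma go_trans s t s' t' s'' : go s t s' -> go s' t' s'' -> go s (t + t') s''.
Proof.
move=> [E1 Q1] [E2 Q2]; split; first by rewrite execD E1.
move=> u ut; case: (ltnP u t) => [/Q1//|tu].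
by rewrite -(subnKC tu) execD E1; apply: Q2; rewrite ltn_subLR.
Qed.

Lemma go_eq s t b m t' b' : go s t (St b m) -> t = t' -> b = b' -> go s t' (St b' m).
Proof. by move=> G <- <-. Qed.

Definition silent i := if i is IHalt then false else if i is IOut _ then false else true.

Lemma go1 b m i : nth IHalt p b = i -> silent i -> good m ->
  go (St b m) 1 (step p (St b m)).
Proof.
move=> E Si Gm; split=> // -[|//] _; split=> //=.
  by rewrite /halted /= E; case: i Si {E}.
by rewrite /is_out /= E; case: i Si {E}.
Qed.

Fixpoint expr_val (e : expr) (a : astate) : nat :=
  match e with
  | EReg r => rg a r
  | ECst c => c
  | EX => X
  | EAdd e1 e2 => expr_val e1 a + expr_val e2 a
  | ESub e1 e2 => expr_val e1 a - expr_val e2 a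
  | EArr q e => ar a q (expr_val e a)
  end.

(** The lower bound on the address constrains array 0 only, whose first [K] cells are cell 0, the
    registers and the temporaries. *)
Fixpoint expr_ok (e : expr) (a : astate) : bool :=
  match e with
  | EReg _ | ECst _ | EX => true
  | EAdd e1 e2 | ESub e1 e2 => expr_ok e1 a && expr_ok e2 a
  | EArr q e => [&& expr_ok e a, expr_val e a < X & K <= q * X + expr_val e a]
  end.

Record rep (a : astate) (m : nat -> nat) : Prop := Rep {
  rep_X : m 0 = X;
  rep_rg : forall r, r < B -> m r.+1 = rg a r;
  rep_ar : forall q i, q < B -> i < X -> K <= q * X + i -> m (q * X + i) = ar a q i;
  rep_rg_le : forall r, rg a r <= X;
  rep_ar_lt : forall q i, ar a q i < X;
  rep_good : good m }.

Lemma X_gt0 : 0 < X.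
Proof. by apply: leq_trans KX; rewrite /K. Qed.

Lemma eval_le e a : (forall r, rg a r <= X) -> (forall q i, ar a q i < X) ->
  expr_val e a <= ewt e * X.
Proof.
move=> Hr Ha; have X0 := X_gt0.
elim: e => //= [r|c||e1 IH1 e2 IH2|e1 IH1 e2 IH2|q e IH]; rewrite ?mul1n //.
- by apply: leq_trans (Hr r) _; rewrite leq_pmull.
- by apply: leq_trans (leqnSn c) _; rewrite leq_pmulr.
- by rewrite mulSn mulnDl; lia.
- by rewrite mulSn mulnDl; lia.
- by apply: leq_trans (ltnW (Ha _ _)) _; rewrite leq_pmull.
Qed.

Lemma good_upd m c v : good m -> v <= 2 * B * X -> c < K -> 0 < B -> good (upd m c v).
Proof.
move=> [G1 G2] Hv Hc B0; split=> c'; rewrite /upd; case: (c' =P c) => [Ec|_] // Hc'.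
  by exfalso; have := leq_pmull X B0; lia.
exact: G2.
Qed.

Lemma rep_tmp a m k v : rep a m -> k < B -> v <= 2 * B * X -> rep a (upd m (tmp k) v).
Proof.
move=> R kB vB; case: (R) => RX Rr Ra Rr1 Ra1 RG; split=> //.
- by move=> r rB; rewrite /upd -Rr // ifN // /tmp; lia.
- by move=> q i qB iX Hi; rewrite /upd ifN ?Ra //; rewrite /tmp /K in Hi *; lia.
- by apply: good_upd => //; rewrite /tmp /K; lia.
Qed.

Lemma tmp_upd m k v : upd m (tmp k) v (tmp k) = v.
Proof. by rewrite /upd eqxx. Qed.

Lemma tmp_updN m j k v : j < k -> upd m (tmp k) v (tmp j) = m (tmp j).
Proof. by move=> jk; rewrite /upd ifN // /tmp; lia. Qed.

Lemma go_tmp a m b i k v : rep a m -> nth IHalt p b = i -> silent i ->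
  step p (St b m) = St b.+1 (upd m (tmp k) v) -> k < B -> v <= 2 * B * X ->
  go (St b m) 1 (St b.+1 (upd m (tmp k) v)) /\ rep a (upd m (tmp k) v).
Proof.
move=> R C Si E kB vB; split; last exact: rep_tmp.
by rewrite -E; apply: go1 C Si (rep_good R).
Qed.

Lemma addX_go q k a m b : rep a m -> k < B -> m (tmp k) <= B * X -> q <= B ->
  code_at b (nseq q (IAdd (tmp k) (tmp k) 0)) ->
  exists m', [/\ go (St b m) q (St (b + q) m'), rep a m',
    m' (tmp k) = m (tmp k) + q * X & forall j, j < k -> m' (tmp j) = m (tmp j)].
Proof.
move=> R kB mB; elim: q => [|q IH] qB C.
  by exists m; rewrite !addn0; split=> //; apply: go0.
have eS : nseq q.+1 (IAdd (tmp k) (tmp k) 0) =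
    nseq q (IAdd (tmp k) (tmp k) 0) ++ [:: IAdd (tmp k) (tmp k) 0].
  by rewrite -[[:: _]]/(nseq 1 _) cat_nseq /ncons -iterD addn1.
rewrite eS in C; have [C1] := code_cat C; rewrite size_nseq => /code_cons[C2 _].
have [m1 [G1 R1 E1 F1]] := IH (ltnW qB) C1.
pose v := m1 (tmp k) + X.
have [|//||G2 R2] := @go_tmp a m1 (b + q) _ k v R1 C2 isT.
- by rewrite /= C2 (rep_X R1).
- by rewrite /v E1; have : q.+1 * X <= B * X by [rewrite leq_mul2r qB orbT]; lia.
exists (upd m1 (tmp k) v); rewrite addnS; split=> //.
- by have := go_trans G1 G2; rewrite addn1.
- by rewrite tmp_upd /v E1 mulSn; lia.
- by move=> j jk; rewrite tmp_updN // F1.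
Qed.

Lemma compE_go e k a m b : rep a m -> expr_ok e a -> ewt e + k <= B ->
  code_at b (compE e k) ->
  exists m', [/\ go (St b m) (size (compE e k)) (St (b + size (compE e k)) m'),
    rep a m', m' (tmp k) = expr_val e a & forall j, j < k -> m' (tmp j) = m (tmp j)].
Proof.
move=> R; have X0 := X_gt0; have [Hr Ha] := (rep_rg_le R, rep_ar_lt R).
have evB e0 : ewt e0 <= B -> expr_val e0 a <= B * X.
  by move=> eB; apply: leq_trans (eval_le e0 Hr Ha) _; rewrite leq_mul2r eB orbT.
have XB : 0 < B -> X <= B * X by move=> B0; apply: leq_pmull.
elim: e k m b R => [r|c||e1 IH1 e2 IH2|e1 IH1 e2 IH2|q e IH] k m b R /= Ok W C.
- have [C1 /code_cons[C2 _]] := code_cons C.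
  have [|||G1 R1] := @go_tmp a m b _ k 0 R C1 isT; rewrite /= ?C1 //; first by lia.
  pose m1 := upd m (tmp k) 0; have E1 : m1 (tmp k) = 0 by exact: tmp_upd.
  rewrite -/m1 in G1 R1.
  have [|||G2 R2] := @go_tmp a m1 b.+1 _ k (rg a r) R1 C2 isT; rewrite /= ?C2.
  + by rewrite E1 (rep_rg R1) //; lia.
  + by lia.
  + by have := Hr r; lia.
  exists (upd m1 (tmp k) (rg a r)); rewrite addn2; split=> //.
  + exact: go_trans G1 G2.
  + exact: tmp_upd.
  + by move=> j jk; rewrite /m1 !tmp_updN.
- have [C1 _] := code_cons C.
  have [|||G1 R1] := @go_tmp a m b _ k c R C1 isT; rewrite /= ?C1 //; first by lia.
    apply: leq_trans (leq_pmulr c X0) _; rewrite leq_mul2r; apply/orP; right; lia.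
  exists (upd m (tmp k) c); rewrite addn1; split=> //; first exact: tmp_upd.
  by move=> j jk; rewrite tmp_updN.
- have [C1 /code_cons[C2 _]] := code_cons C.
  have [|||G1 R1] := @go_tmp a m b _ k 0 R C1 isT; rewrite /= ?C1 //.
  pose m1 := upd m (tmp k) 0; have E1 : m1 (tmp k) = 0 by exact: tmp_upd.
  rewrite -/m1 in G1 R1.
  have [|||G2 R2] := @go_tmp a m1 b.+1 _ k X R1 C2 isT; rewrite /= ?C2.
  + by rewrite E1 (rep_X R1).
  + by lia.
  + by have := XB; lia.
  exists (upd m1 (tmp k) X); rewrite addn2; split=> //.
  + exact: go_trans G1 G2.
  + exact: tmp_upd.
  + by move=> j jk; rewrite /m1 !tmp_updN.
- have [C1 C23] := code_cat C; have [C2 /code_cons[C3 _]] := code_cat C23.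
  have /andP[Ok1 Ok2] := Ok.
  have [m1 [G1 R1 E1 F1]] := IH1 k m b R Ok1 ltac:(lia) C1.
  have [m2 [G2 R2 E2 F2]] := IH2 k.+1 m1 _ R1 Ok2 ltac:(lia) C2.
  pose v := expr_val e1 a + expr_val e2 a.
  have [|||G3 R3] := @go_tmp a m2 _ _ k v R2 C3 isT; rewrite /= ?C3.
  + by rewrite E2 F2 // E1.
  + by lia.
  + by have := evB e1; have := evB e2; rewrite /v; lia.
  exists (upd m2 (tmp k) v); rewrite !size_cat /=; split=> //.
  + by apply: go_eq (go_trans (go_trans G1 G2) G3) _ _; lia.
  + exact: tmp_upd.
  + by move=> j jk; rewrite tmp_updN // F2 ?F1 // ltnW.
- have [C1 C23] := code_cat C; have [C2 /code_cons[C3 _]] := code_cat C23.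
  have /andP[Ok1 Ok2] := Ok.
  have [m1 [G1 R1 E1 F1]] := IH1 k m b R Ok1 ltac:(lia) C1.
  have [m2 [G2 R2 E2 F2]] := IH2 k.+1 m1 _ R1 Ok2 ltac:(lia) C2.
  pose v := expr_val e1 a - expr_val e2 a.
  have [|||G3 R3] := @go_tmp a m2 _ _ k v R2 C3 isT; rewrite /= ?C3.
  + by rewrite E2 F2 // E1.
  + by lia.
  + by have := evB e1; have := evB e2; rewrite /v; lia.
  exists (upd m2 (tmp k) v); rewrite !size_cat /=; split=> //.
  + by apply: go_eq (go_trans (go_trans G1 G2) G3) _ _; lia.
  + exact: tmp_upd.
  + by move=> j jk; rewrite tmp_updN // F2 ?F1 // ltnW.
- have [C1 C23] := code_cat C; have [C2] := code_cat C23.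
  rewrite size_nseq => /code_cons[C3 _]; have /and3P[Ok1 iX Ki] := Ok.
  have [m1 [G1 R1 E1 F1]] := IH k m b R Ok1 ltac:(lia) C1.
  have kB : k < B by lia.
  have m1B : m1 (tmp k) <= B * X by rewrite E1; apply: evB; lia.
  have qB : q <= B by lia.
  have [m2 [G2 R2 E2 F2]] := addX_go R1 kB m1B qB C2.
  pose v := ar a q (expr_val e a).
  have [|||G3 R3] := @go_tmp a m2 _ _ k v R2 C3 isT; rewrite /= ?C3 //.
  + by rewrite E2 E1 [expr_val e a + _]addnC (rep_ar R2) //; lia.
  + by have := Ha q (expr_val e a); rewrite /v; lia.
  exists (upd m2 (tmp k) v); rewrite !size_cat /= size_nseq; split=> //.
  + by apply: go_eq (go_trans (go_trans G1 G2) G3) _ _; lia.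
  + exact: tmp_upd.
  + by move=> j jk; rewrite tmp_updN // F2 ?F1 // ltnW.
Qed.

(** Weakest precondition, including the bounds that preserve [rep]. The condition [0 < q] makes
    array 0 read-only, since it shares cells with the registers. *)
Fixpoint cmd_wp (c : cmd) (Q : astate -> Prop) (a : astate) : Prop :=
  match c with
  | CSkip => Q a
  | CAsg r e => expr_ok e a && (expr_val e a <= X) /\ Q (setr a r (expr_val e a))
  | CSto q e1 e2 =>
      [&& 0 < q, expr_ok e1 a, expr_ok e2 a, expr_val e1 a < X & expr_val e2 a < X] /\
      Q (seta a q (expr_val e1 a) (expr_val e2 a))
  | CSeq c1 c2 => cmd_wp c1 (cmd_wp c2 Q) a
  | CIf e c1 c2 => expr_ok e a /\ (if expr_val e a == 0 then cmd_wp c2 Q a else cmd_wp c1 Q a)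
  end.

Lemma wp_sub c (Q Q' : astate -> Prop) a :
  (forall a', Q a' -> Q' a') -> cmd_wp c Q a -> cmd_wp c Q' a.
Proof.
elim: c Q Q' a => [|r e|q e1 e2|c1 IH1 c2 IH2|e c1 IH1 c2 IH2] Q Q' a QQ /=.
- exact: QQ.
- by case=> H /QQ.
- by case=> H /QQ.
- by apply: IH1 => a'; apply: IH2.
- by case=> H1 H2; split=> //; case: eqP H2 => _; [apply: IH2|apply: IH1].
Qed.

Lemma rep_setr a m r v : rep a m -> r < B -> v <= X -> rep (setr a r v) (upd m r.+1 v).
Proof.
move=> R rB vX; case: (R) => RX Rr Ra Rr1 Ra1 RG; split=> //=.
- by move=> r' r'B; rewrite /upd eqSS; case: eqP => // _; apply: Rr.
- by move=> q i qB iX Hi; rewrite /upd ifN ?Ra //; rewrite /K in Hi; lia.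
- by move=> r'; rewrite /upd; case: (r' =P r).
- apply: good_upd => //; first by have := @leq_pmull X (2 * B); lia.
    by rewrite /K; lia.
  by lia.
Qed.

Lemma rep_seta a m q i v : rep a m -> 0 < q < B -> i < X -> v < X ->
  rep (seta a q i v) (upd m (q * X + i) v).
Proof.
move=> R /andP[q0 qB] iX vX; case: (R) => RX Rr Ra Rr1 Ra1 RG.
have qX : X <= q * X by rewrite leq_pmull.
split=> //=.
- by rewrite /upd ifN //; have := X_gt0; lia.
- by move=> r rB; rewrite /upd ifN ?Rr //; have := KX; rewrite /K; lia.
- move=> q' i' q'B i'X Hi'; rewrite /upd.
  have -> : (q' * X + i' == q * X + i) = (q' == q) && (i' == i).
    apply/eqP/andP=> [E|[/eqP-> /eqP->] //].
    (* Both indices are below [X], so division by [X] recovers the array from the address. *)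
    have Eq : q' = q.
      have := congr1 (fun z => z %/ X) E.
      by rewrite !divnMDl ?divn_small ?addn0 ?X_gt0.
    by rewrite Eq in E *; rewrite eqxx -(eqn_add2l (q * X)) E eqxx.
  case: (q' =P q) Hi' => [-> Hi'|_ Hi'] /=; last exact: Ra.
  by case: (i' =P i) => //= _; rewrite Ra.
- by move=> q' i'; case: eqP => // _; rewrite /upd; case: eqP.
- case: RG => G1 G2; split=> c; rewrite /upd; case: (c =P _) => // Ec.
    by have := leq_pmull X (ltn_trans q0 qB); lia.
    move=> Hc; have : q.+1 * X <= B * X by rewrite leq_mul2r qB orbT.
    by rewrite mulSn; lia.
  exact: G2.
Qed.

Lemma compC_go c b m a Q : rep a m -> cmd_wp c Q a -> cwt c <= B ->
  code_at b (compC c b) ->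
  exists t m' a', [/\ t <= csize c, go (St b m) t (St (b + csize c) m'),
    rep a' m' & Q a'].
Proof.
elim: c b m a Q => [|r e|q e1 e2|c1 IH1 c2 IH2|e c1 IH1 c2 IH2] b m a Q R /=.
- by move=> Qa _ _; exists 0, m, a; rewrite addn0; split=> //; apply: go0.
- case=> /andP[Ok eX] Qa W C; have [C1 C2] := code_cat C.
  have We : ewt e + 0 <= B by lia.
  have [m1 [G1 R1 E1 _]] := compE_go R Ok We C1.
  have [C3 /code_cons[C4 _]] := code_cons C2.
  have rB : r < B by lia.
  have G2 := go1 C3 isT (rep_good R1); rewrite /= C3 in G2.
  have R2 := rep_setr R1 rB (leq0n X).
  have G3 := go1 C4 isT (rep_good R2); rewrite /= C4 in G3.
  have R3 := rep_setr R2 rB eX.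
  set m3 := upd _ _ (_ + _) in G3.
  have Em3 : m3 = upd (upd m1 r.+1 0) r.+1 (expr_val e a).
    have Et : upd m1 r.+1 0 (tmp 0) = expr_val e a by rewrite -E1 /upd ifN // /tmp; lia.
    by rewrite /m3 Et [upd m1 r.+1 0 r.+1]/upd eqxx.
  exists (size (compE e 0) + 2), m3, (setr a r (expr_val e a)); split=> //.
  + by apply: go_eq (go_trans (go_trans G1 G2) G3) _ _; lia.
  + rewrite Em3; case: R3 => H1 H2 H3 H4 H5 H6; split=> // r'.
      by move=> r'B; rewrite H2 //= /upd; case: eqP.
    by have := H4 r'; rewrite /= /upd; case: eqP.
- case=> /and5P[q0 Ok1 Ok2 iX vX] Qa W C.
  have [C1 C2] := code_cat C; have [C3 C4] := code_cat C2.
  have [C5 C6] := code_cat C4; have [C7 _] := code_cons C6.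
  rewrite size_nseq in C5 C6 C7 C4.
  have We1 : ewt e1 + 0 <= B by lia.
  have [m1 [G1 R1 E1 _]] := compE_go R Ok1 We1 C1.
  have B0 : 0 < B by lia. have qB : q <= B by lia.
  have m1B : m1 (tmp 0) <= B * X.
    by rewrite E1; apply: leq_trans (ltnW iX) _; apply: leq_pmull.
  have [m2 [G2 R2 E2 _]] := addX_go R1 B0 m1B qB C3.
  have We2 : ewt e2 + 1 <= B by case: (e1) W => /=; lia.
  have [m3 [G3 R3 E3 F3]] := compE_go R2 Ok2 We2 C5.
  have G4 := go1 C7 isT (rep_good R3).
  rewrite /= C7 F3 // E2 E1 E3 [_ + q * X]addnC in G4.
  have qB' : 0 < q < B by lia.
  exists (size (compE e1 0) + q + size (compE e2 1) + 1),
    (upd m3 (q * X + expr_val e1 a) (expr_val e2 a)), (seta a q (expr_val e1 a) (expr_val e2 a)).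
  split=> //; last exact: rep_seta.
  by apply: go_eq (go_trans (go_trans (go_trans G1 G2) G3) G4) _ _; lia.
- move=> W1 W C; have [C1 C2] := code_cat C; rewrite size_compC in C2.
  have [t1 [m1 [a1 [T1 G1 R1 Q1]]]] := IH1 _ _ _ _ R W1 ltac:(lia) C1.
  have [t2 [m2 [a2 [T2 G2 R2 Q2]]]] := IH2 _ _ _ _ R1 Q1 ltac:(lia) C2.
  exists (t1 + t2), m2, a2; split=> //; first by lia.
  by apply: go_eq (go_trans G1 G2) _ _; lia.
- case=> Ok Hif W C.
  have [C1 C2] := code_cat C; have [C3 C4] := code_cons C2.
  have [C5 C6] := code_cat C4; have [C7 /code_cons[C8 C9]] := code_cons C6.
  rewrite size_compC in C6 C7 C8 C9.
  have We : ewt e + 0 <= B by lia.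
  have [m1 [G1 R1 E1 _]] := compE_go R Ok We C1.
  have G2 := go1 C3 isT (rep_good R1); rewrite /= C3 E1 in G2.
  have B0 : 0 < B by case: (e) W => /=; lia.
  case: eqP Hif G2 => [_ H2 G2|_ H1 G2].
    have C9' : code_at (b + size (compE e 0) + 1 + csize c1 + 2)
        (compC c2 (b + size (compE e 0) + 1 + csize c1 + 2)).
      by move: C9; congr code_at; lia.
    have [t2 [m2 [a2 [T2 G3 R2 Q2]]]] := IH2 _ _ _ _ R1 H2 ltac:(lia) C9'.
    exists (size (compE e 0) + 1 + t2), m2, a2; split=> //; first by lia.
    by apply: go_eq (go_trans (go_trans G1 G2) G3) _ _; lia.
  have {}G2 : go (St (b + size (compE e 0)) m1) 1 (St (b + size (compE e 0) + 1) m1).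
    by apply: go_eq G2 _ _; lia.
  have {}C5 : code_at (b + size (compE e 0) + 1) (compC c1 (b + size (compE e 0) + 1)).
    by move: C5; rewrite addn1.
  have [t2 [m2 [a2 [T2 G3 R2 Q2]]]] := IH1 _ _ _ _ R1 H1 ltac:(lia) C5.
  have C7' : nth IHalt p (b + size (compE e 0) + 1 + csize c1) = IConst (tmp 0) 0.
    by rewrite -C7; congr nth; lia.
  have [|//||G4 R4] := @go_tmp a2 m2 _ _ 0 0 R2 C7' isT; rewrite /= ?C7' //.
  have C8' : nth IHalt p (b + size (compE e 0) + 1 + csize c1).+1 =
      IJz (tmp 0) (b + size (compE e 0) + 1 + csize c1 + 2 + csize c2).
    by rewrite -C8; congr nth; lia.
  have G5 := go1 C8' isT (rep_good R4); rewrite /= C8' tmp_upd /= in G5.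
  exists (size (compE e 0) + 1 + t2 + 2), (upd m2 (tmp 0) 0), a2; split=> //; first by lia.
  by apply: go_eq (go_trans (go_trans (go_trans (go_trans G1 G2) G3) G4) G5) _ _; lia.
Qed.

Variables (n : nat) (s0 : state).
Hypotheses (nX : n < X) (qoB : 0 < qo < B) (wB : 2 * qo + 2 <= B).

Definition olog t :=
  [seq (u, out_set p n (exec p s0 u)) | u <- iota 0 t & is_out p (exec p s0 u)].

(** All that the final statement needs about the past of a run: no halt, memory within bounds, and
    the outputs with their times. *)
Record conf (t : nat) (s : state) (L : seq (nat * {set 'I_n})) : Prop := Conf {
  conf_exec : exec p s0 t = s;
  conf_halt : forall u, u < t -> ~~ halted p (exec p s0 u);
  conf_good : forall u, u < t -> good (Defs.mem (exec p s0 u));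
  conf_log : olog t = L }.

Lemma ologD t t' : olog (t + t') = olog t ++
  [seq (t + u, out_set p n (exec p (exec p s0 t) u)) |
     u <- iota 0 t' & is_out p (exec p (exec p s0 t) u)].
Proof.
rewrite /olog iotaD filter_cat map_cat add0n; congr (_ ++ _).
rewrite -{1}[t]addn0 iotaDl filter_map -map_comp.
have E u : exec p s0 (t + u) = exec p (exec p s0 t) u by rewrite execD.
by under eq_filter => u do rewrite /= E; apply: eq_map => u /=; rewrite E.
Qed.

Lemma conf_go t s L t' s' : conf t s L -> go s t' s' -> conf (t + t') s' L.
Proof.
move=> [E H G Lg] [E' Q]; split.
- by rewrite execD E.
- move=> u; case: (ltnP u t) => [/H//|tu]; rewrite -{1 2}(subnKC tu) ltn_add2l execD E.
  by case/Q.
- move=> u; case: (ltnP u t) => [/G//|tu]; rewrite -{1 2}(subnKC tu) ltn_add2l execD E.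
  by case/Q.
- rewrite ologD Lg E (eq_in_filter (a2 := pred0)) ?filter_pred0 ?cats0 // => u.
  by rewrite mem_iota => /Q[_ /negbTE].
Qed.

Lemma conf_out t b m L r : conf t (St b m) L -> nth IHalt p b = IOut r -> good m ->
  conf t.+1 (St b.+1 m) (rcons L (t, [set v : 'I_n | m (m r + v) != 0])).
Proof.
move=> [E H G Lg] C Gm; have e1 : exec p s0 t.+1 = St b.+1 m.
  by rewrite -addn1 execD E /= C.
split=> //.
- move=> u; rewrite ltnS leq_eqVlt => /predU1P[->|/H//].
  by rewrite E /halted /= C.
- move=> u; rewrite ltnS leq_eqVlt => /predU1P[->|/G//].
  by rewrite E.
- by rewrite -addn1 ologD Lg E /is_out /out_set /= C /= addn0 cats1 C.
Qed.

Definition oset (a : astate) : {set 'I_n} := [set v : 'I_n | ar a qo v.+1 != 0].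

Lemma eval_base q a : expr_val (base q) a = q * X + 1.
Proof. by elim: q => //= q ->; rewrite mulSn; lia. Qed.

Lemma ok_base q a : expr_ok (base q) a.
Proof. by elim: q => //= q ->. Qed.

Section Loop.

Variables (e : expr) (body : cmd) (eo : expr) (b : nat).
Hypotheses (we : ewt e <= B) (wb : cwt body <= B) (weo : ewt eo <= B)
  (Cb : code_at b (compL e body eo b)).

Lemma loop_iter t m L a (Q : astate -> Prop) :
  conf t (St b m) L -> rep a m -> expr_ok e a -> expr_val e a != 0 ->
  cmd_wp body (fun a' => expr_ok eo a' /\ Q a') a ->
  exists t' m' a' u, [/\ rep a' m', Q a', t <= u < t', t' <= t + lsize e body eo
    & conf t' (St b m') (if expr_val eo a' == 0 then L else rcons L (u, oset a'))].
Proof.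
move=> Cf R Ok Ev W; have B0 : 0 < B by case: (e) we => /=; lia.
have We : ewt e + 0 <= B by rewrite addn0.
have Weo : ewt eo + 0 <= B by rewrite addn0.
have Wba : ewt (base qo) + 0 <= B by rewrite ewt_base addn0.
have [C1 /code_cons[C2 C3]] := code_cat Cb.
have [C4 C5] := code_cat C3; rewrite size_compC in C5.
have [C6 /code_cons[C7 C8]] := code_cat C5.
have [C9 /code_cons[C10 /code_cons[C11 /code_cons[C12 _]]]] := code_cat C8.
have [m1 [G1 R1 E1 _]] := compE_go R Ok We C1.
have G2 := go1 C2 isT (rep_good R1); rewrite /= C2 E1 (negbTE Ev) in G2.
rewrite -addn1 in C4.
have [t3 [m3 [a3 [T3 G3 R3 [Ok3 Q3]]]]] := compC_go R1 W wb C4.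
rewrite addn1 in G3.
have [m4 [G4 R4 E4 _]] := compE_go R3 Ok3 Weo C6.
have G5 := go1 C7 isT (rep_good R4); rewrite /= C7 E4 in G5.
have Cf4 := conf_go Cf (go_trans (go_trans (go_trans G1 G2) G3) G4).
have fin t5 b5 m5 L5 : b5 = ((b + size (compE e 0)).+1 + csize body + size (compE eo 0)).+1
      + size (compE (base qo) 0) + 1 ->
    conf t5 (St b5 m5) L5 -> rep a3 m5 ->
    conf (t5 + 2) (St b (upd m5 (tmp 0) 0)) L5 /\ rep a3 (upd m5 (tmp 0) 0).
  move=> ->; rewrite addn1 => Cf5 R5.
  have [|//||G6 R6] := @go_tmp a3 m5 _ _ 0 0 R5 C11 isT; rewrite /= ?C11 //.
  have G7 := go1 C12 isT (rep_good R6); rewrite /= C12 tmp_upd /= in G7.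
  by split=> //; exact: conf_go Cf5 (go_trans G6 G7).
have [E0|E0] := eqVneq (expr_val eo a3) 0.
  rewrite E0 /= in G5; have Cf5 := conf_go Cf4 G5.
  have [|Cf6 R6] := fin _ _ _ _ _ Cf5 R4; first by lia.
  eexists; exists (upd m4 (tmp 0) 0), a3, t; split; [by []|by []| | |rewrite E0 eqxx; exact: Cf6].
    by lia.
  by rewrite /lsize; lia.
rewrite (negbTE E0) in G5; have Cf5 := conf_go Cf4 G5.
have [m6 [G6 R6 E6 _]] := compE_go R4 (ok_base qo a3) Wba C9.
have Cf6 := conf_out (conf_go Cf5 G6) C10 (rep_good R6).
have Eo : [set v : 'I_n | m6 (m6 (tmp 0) + v) != 0] = oset a3.
  apply/setP=> v; rewrite !inE E6 eval_base -addnA add1n (rep_ar R6) //.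
  - by case/andP: qoB.
  - by apply: leq_ltn_trans (ltn_ord v) nX.
  - by have := KX; have : X <= qo * X by [apply: leq_pmull; case/andP: qoB]; lia.
rewrite Eo in Cf6.
have [|Cf7 R7] := fin _ _ _ _ _ Cf6 R6; first by lia.
eexists; exists (upd m6 (tmp 0) 0), a3; eexists.
split; [by []|by []| | |rewrite (negbTE E0); exact: Cf7]; first by lia.
by rewrite /lsize; lia.
Qed.

Lemma loop_exit t m L a : conf t (St b m) L -> rep a m -> expr_ok e a -> expr_val e a = 0 ->
  exists t' m', [/\ rep a m', t' <= t + lsize e body eo
    & conf t' (St (b + lsize e body eo) m') L].
Proof.
move=> Cf R Ok Ev.
have We : ewt e + 0 <= B by rewrite addn0.
have [C1 /code_cons[C2 C3]] := code_cat Cb.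
have [m1 [G1 R1 E1 _]] := compE_go R Ok We C1.
have G2 := go1 C2 isT (rep_good R1); rewrite /= C2 E1 Ev /= in G2.
exists (t + (size (compE e 0) + 1)), m1; split=> //; first by rewrite /lsize; lia.
by apply: conf_go Cf _; apply: go_eq (go_trans G1 G2) _ _; rewrite /lsize; lia.
Qed.

(* At time t no gap between outputs exceeds D, nor would the current one after
   slack further steps. *)
Definition timely D slack (L : seq (nat * {set 'I_n})) t :=
  path (fun x y => y - x <= D) 0 (map fst L) /\
  t - last 0 (map fst L) + slack <= D.

Let c := lsize e body eo.

(** [pot] bounds the wait for the next output, counted in iterations; it is positive because the
    iteration that outputs must itself be paid. The bound [c * P.+1] on a gap consists of at most
    [P] iterations and the rest of the iteration that made the previous output. The exit test adds
    the final [c]. *)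
Lemma loop_run (I : nat -> astate -> Prop) (k : nat) (out : pred nat)
    (os : nat -> {set 'I_n}) (pot : nat -> nat) D t m L a P :
  (forall i a, i < k -> I i a -> [/\ expr_ok e a, expr_val e a != 0 &
     cmd_wp body (fun a' => expr_ok eo a' /\ [/\ I i.+1 a', (expr_val eo a' != 0) = out i
       & out i -> oset a' = os i]) a]) ->
  (forall a, I k a -> expr_ok e a /\ expr_val e a = 0) ->
  (forall i, i < k -> ~~ out i -> pot i.+1 < pot i) ->
  (forall i, i < k -> 0 < pot i) ->
  (forall i, i <= k -> pot i <= P) -> c * P.+1 <= D ->
  conf t (St b m) L -> rep a m -> I 0 a -> timely D (c * pot 0) L t ->
  exists t' m' a' L', [/\ rep a' m' /\ I k a', t' <= t + c * k.+1,
    conf t' (St (b + c) m') (L ++ L'),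
    map snd L' = [seq os i | i <- iota 0 k & out i]
    & timely (D + c) (c * pot k) (L ++ L') t'].
Proof.
move=> Hb He Hpot Hpos HP HD Cf R I0 Tm.
have iter j : j <= k -> exists t' m' a' L', [/\ rep a' m' /\ I j a', t' <= t + c * j,
    conf t' (St b m') (L ++ L'),
    map snd L' = [seq os i | i <- iota 0 j & out i]
    & timely D (c * pot j) (L ++ L') t'].
  elim: j => [_|j IH jk].
    by exists t, m, a, [::]; rewrite muln0 addn0 cats0.
  have [t1 [m1 [a1 [L1 [[R1 I1] T1 Cf1 S1 [P1 Tm1]]]]]] := IH (ltnW jk).
  have [Ok1 Ev1 W1] := Hb _ _ jk I1.
  have [t2 [m2 [a2 [u [R2 [I2 O2 OS2] /andP[u1 u2] T2 Cf2]]]]] := loop_iter Cf1 R1 Ok1 Ev1 W1.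
  rewrite -/c in T2; have pj := Hpos _ jk.
  have Pj : c * pot j.+1 <= c * P by rewrite leq_mul2l HP ?orbT.
  have eI : iota 0 j.+1 = rcons (iota 0 j) j by rewrite -addn1 iotaD cats1.
  rewrite eI filter_rcons; move: Cf2; case: eqP O2 => [_ /esym/negbT O2|_ /esym O2] Cf2.
    exists t2, m2, a2, L1; rewrite (negbTE O2); split=> //; first by rewrite mulnS; lia.
    split=> //; have := Hpot _ jk O2; rewrite -(leq_pmul2l (m := c)) ?mulnS;
      last by rewrite /c /lsize; lia.
    by lia.
  exists t2, m2, a2, (rcons L1 (u, oset a2)); rewrite O2 map_rcons S1 map_rcons OS2 //.
  have Lr : L ++ rcons L1 (u, os j) = rcons (L ++ L1) (u, os j) by rewrite rcons_cat.
  rewrite OS2 // in Cf2; rewrite Lr; split=> //; first by rewrite mulnS; lia.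
  have cp : c <= c * pot j by rewrite leq_pmulr.
  split; rewrite map_rcons ?last_rcons ?rcons_path ?P1 /=; first by lia.
  by move: HD; rewrite mulnS; lia.
have [t1 [m1 [a1 [L1 [[R1 I1] T1 Cf1 S1 [P1 Tm1]]]]]] := iter k (leqnn k).
have [Ok1 Ev1] := He _ I1.
have [t2 [m2 [R2 T2 Cf2]]] := loop_exit Cf1 R1 Ok1 Ev1.
exists t2, m2, a1, L1; split=> //; first by rewrite mulnS; rewrite -/c in T2; lia.
split; last by rewrite -/c in T2; lia.
by apply: sub_path P1 => x y; rewrite /=; lia.
Qed.

End Loop.

End Compile.

(** * The listing program *)

Fixpoint sumE (f : nat -> expr) m :=
  if m is m'.+1 then EAdd (sumE f m') (f m') else ECst 0.

Fixpoint for_loop (f : nat -> cmd) m :=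
  if m is m'.+1 then CSeq (for_loop f m') (f m') else CSkip.

Notation "c1 ;; c2" := (CSeq c1 c2) (at level 100, right associativity).

(* Array 0 overlays the input and array 1 holds its first cells, saved before
   they are reused as registers.  The arrays qIN, qPR, qMK hold the current set,
   the vertices added so far and the vertices already placed in the order qORD;
   qadj j gives the j-th neighbour.  Vertices are numbered from 1, with 0 for a
   missing neighbour.  The registers numbered from 13 on save the memberships of
   the neighbours; rST and rK are set by the initialisation code to X / n and to
   the number of reserved cells. *)
Notation rV := 0. Notation rC := 1. Notation rST := 2. Notation rP := 3.
Notation rH := 4. Notation rN := 5. Notation rU := 6. Notation rFL := 7.
Notation rT := 8. Notation rD := 9. Notation rBad := 10. Notation rv := 11.
Notation rK := 12. Notation rb j := (j.+4.+4.+4.+1).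
Notation qIN := 2. Notation qPR := 3. Notation qMK := 4. Notation qORD := 5.
Notation qadj j := (j.+4.+2).

Section Program.

Variable d : nat.

Definition adjE j x := EArr (qadj j) x.
Definition domE x := sumE (fun j => EArr qIN (adjE j x)) d.
Definition nb j := adjE j (EReg rv).

Definition clearC := for_loop (fun j => CSto qIN (nb j) (ECst 0)) d.
Definition saveC := for_loop (fun j => CAsg (rb j) (EArr qIN (nb j))) d.
Definition restoreC := for_loop (fun j => CSto qIN (nb j) (EReg (rb j))) d.
(** Truncated subtraction serves as conjunction: the membership bit minus the number of dominating
    neighbours is nonzero exactly for an undominated vertex of [A]. For a missing neighbour the
    result is zero. *)
Definition greedyC := for_loop (fun j =>
  CIf (ESub (EArr qPR (nb j)) (domE (nb j))) (CSto qIN (nb j) (ECst 1)) CSkip) d.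
(** Each summand is 1 exactly when the end [w] of a walk of length two from [v] is an undominated
    vertex of [A] outside the set, that is, a violation of the test in [cand_misin]. *)
Definition badE := sumE (fun j => sumE (fun k =>
  let w := adjE k (nb j) in
  ESub (EArr qPR w) (EAdd (EArr qIN w) (domE w))) d) d.
Definition diffE := sumE (fun j => EAdd
  (ESub (EArr qIN (nb j)) (EReg (rb j))) (ESub (EReg (rb j)) (EArr qIN (nb j)))) d.

Definition undoC := CSto qIN (EReg rv) (ECst 0) ;; greedyC.
Definition incC r := CAsg r (EAdd (EReg r) (ECst 1)).

(** The candidate is tried in place. Its maximality is recorded in [rBad] before [undoC] alters the
    set; the result of [undoC] is then compared with the saved bits. On failure these bits restore
    the set. On success the undo has itself restored it, and the candidate is built again. *)
Definition upC :=
  CAsg rv (EArr qORD (EReg rH)) ;;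
  CSto qPR (EReg rv) (ECst 0) ;;
  CIf (EArr qIN (EReg rv)) (undoC ;; incC rH)
   (saveC ;; clearC ;; CSto qIN (EReg rv) (ECst 1) ;; 
      CIf badE (CAsg rBad (ECst 1)) (CAsg rBad (ECst 0)) ;; undoC ;;
    CIf (EAdd (EReg rBad) diffE) (restoreC ;; incC rH)
     (clearC ;; CSto qIN (EReg rv) (ECst 1) ;; CSto qPR (EReg rv) (ECst 1) ;;
      CAsg rU (ECst 0))).

Definition downC :=
  CAsg rH (ESub (EReg rH) (ECst 1)) ;;
  CAsg rv (EArr qORD (EReg rH)) ;;
  CSto qPR (EReg rv) (ECst 1) ;;
  CIf (domE (EReg rv)) CSkip (CSto qIN (EReg rv) (ECst 1)).

Definition dfsC :=
  CAsg rFL (ECst 0) ;;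
  CIf (EReg rU) upC
    (CIf (EReg rH) downC (CAsg rFL (ECst 1) ;; CAsg rU (ECst 1))).

Definition dfs_cond := EAdd (ESub (ECst 1) (EReg rU)) (ESub (EReg rN) (EReg rH)).

(** Input cells below [K] have been taken over by registers and are read from their copy in array 1,
    at an index lower by one because cell 0 is not copied. *)
Definition readC r :=
  CAsg rT (EAdd (EReg rP) (ECst r.+1)) ;;
  CIf (ESub (EReg rK) (EReg rT))
    (CAsg rT (EArr 1 (ESub (EReg rT) (ECst 1)))) (CAsg rT (EArr 0 (EReg rT))).

Definition rowC := for_loop (fun j =>
  readC j.+1 ;;
  CIf (ESub (EReg rD) (ECst j)) (CSto (qadj j) (EReg rv) (EAdd (EReg rT) (ECst 1))) CSkip) d.

Definition pushC x :=
  CSto qORD (EReg rH) x ;; CSto qMK x (ECst 1) ;; incC rH.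

Definition clusterC :=
  pushC (EReg rv) ;; for_loop (fun j => CIf (nb j) (pushC (nb j)) CSkip) d.

(** A single pass finds a maximal family: [v] opens a cluster if neither [v] nor any neighbour is
    marked, and a vertex passed over lies in a cluster or has a neighbour in one. Only the row of
    [v] itself is consulted. *)
Definition scanC :=
  CAsg rv (EAdd (EReg rV) (ECst 1)) ;;
  readC 0 ;; CAsg rD (EReg rT) ;; rowC ;;
  CIf (EReg rD)
    (CIf (EAdd (EArr qMK (EReg rv)) (sumE (fun j => EArr qMK (nb j)) d)) CSkip clusterC)
    (CSto qIN (EReg rv) (ECst 1) ;; CSto qPR (EReg rv) (ECst 1) ;; CSto qMK (EReg rv) (ECst 1)) ;;
  incC rV ;; CAsg rP (EAdd (EReg rP) (ECst d.+1)) ;; CAsg rC (EAdd (EReg rC) (EReg rST)).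

(** Cell 0 holds [X], and [n] is no longer stored anywhere. As [rC] advances by [X / n] per vertex,
    it reaches [X] after [n] rounds, and [rV] then supplies [n] to the later loop. *)
Definition scan_cond := ESub EX (EReg rC).

Definition restC := incC rv ;; CIf (EArr qMK (EReg rv)) CSkip (pushC (EReg rv)).
Definition rest_cond := ESub (EReg rV) (EReg rv).

End Program.

(** * Correctness of the program pieces against the abstract traversal *)

Section Correctness.

Variables (d n : nat) (e : rel 'I_n) (B X : nat).
Hypotheses (e_sym : symmetric e) (e_irr : irreflexive e) (e_deg : max_degree_le e d).
Hypotheses (KX : (2 * B).+1 <= X) (nX : n < X).
Implicit Types (a : astate) (g : nat -> nat) (S A M : {set 'I_n}) (o : seq 'I_n)
  (v w : 'I_n) (F : 'I_n -> nat -> nat).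

Let wp := cmd_wp B X.
Let ok := expr_ok B X.
Let eval := expr_val X.

Lemma wp_seq c1 c2 (P Q : astate -> Prop) a :
  wp c1 P a -> (forall a', P a' -> wp c2 Q a') -> wp (c1 ;; c2) Q a.
Proof. by move=> W1 W2; apply: wp_sub W1. Qed.

Lemma wp_for f m (I : nat -> astate -> Prop) a :
  (forall j a, j < m -> I j a -> wp (f j) (I j.+1) a) -> I 0 a ->
  wp (for_loop f m) (I m) a.
Proof.
elim: m => //= m IH Hf I0; apply: wp_seq (IH _ I0) _ => [j a' jm|a' Im].
  by apply: Hf; rewrite ltnS ltnW.
exact: Hf.
Qed.

Lemma wp_if c1 c2 x (Q : astate -> Prop) a : ok x a ->
  (eval x a != 0 -> wp c1 Q a) -> (eval x a = 0 -> wp c2 Q a) -> wp (CIf x c1 c2) Q a.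
Proof. by move=> Ok H1 H2; split=> //; case: (altP eqP) => [/H2|/H1]. Qed.

Lemma ok_arr q x a : 0 < q -> ok x a -> eval x a < X -> ok (EArr q x) a.
Proof.
move=> q0 Ok xX; rewrite /ok /= -/ok Ok xX /=; apply: leq_trans KX _.
by have : X <= q * X by [apply: leq_pmull]; lia.
Qed.

Lemma eval_sumE f m a : eval (sumE f m) a = \sum_(j < m) eval (f j) a.
Proof. by elim: m => [|m IH]; rewrite ?big_ord0 ?big_ord_recr //= -IH. Qed.

Lemma ok_sumE f m a : (forall j, j < m -> ok (f j) a) -> ok (sumE f m) a.
Proof.
elim: m => // m IH H; rewrite -[ok _ _]/(ok (sumE f m) a && ok (f m) a) H // andbT.
apply: IH => j jm; by apply: H; rewrite ltnS ltnW.
Qed.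

Definition vid v : nat := v.+1.
(** Number 0 denotes no vertex and belongs to no set, so missing neighbours vanish from all sums. *)
Definition memid S x : nat := [exists v, (vid v == x) && (v \in S)].
Definition rarr (f : nat -> nat) S := forall x, x <= n -> f x = memid S x.
Definition adjid v j := nth 0 [seq vid u | u <- nbs e v] j.

Lemma memidS S v : memid S (vid v) = (v \in S).
Proof.
rewrite /memid; congr nat_of_bool; apply/existsP/idP=> [[w /andP[/eqP/succn_inj/val_inj<-]]|] //.
by exists v; rewrite eqxx.
Qed.

Lemma memid0 S : memid S 0 = 0.
Proof. by rewrite /memid; case: existsP => // -[w]. Qed.

Lemma memid_le S x : memid S x <= 1.
Proof. exact: leq_b1. Qed.

Lemma vid_le v : vid v <= n.
Proof. exact: ltn_ord. Qed.

Lemma adjid_cases v j : adjid v j = 0 /\ size (nbs e v) <= j \/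
  exists u, [/\ j < size (nbs e v), nth v (nbs e v) j = u, adjid v j = vid u & e v u].
Proof.
rewrite /adjid; case: (ltnP j (size (nbs e v))) => js; last first.
  by left; rewrite nth_default ?size_map.
right; exists (nth v (nbs e v) j); rewrite (nth_map v) //; split=> //.
by rewrite -mem_nbs mem_nth.
Qed.

Lemma adjid_le v j : adjid v j <= n.
Proof. by case: (adjid_cases v j) => [[-> _]|[u [_ _ -> _]]] //; apply: vid_le. Qed.

(** [F] describes the adjacency arrays. It is a parameter because the scan fills them row by row;
    during the search it is [adjid]. *)
Record dst g S A M o F a : Prop := Dst {
  dst_rg : rg a = g;
  dst_in : rarr (ar a qIN) S;
  dst_pr : rarr (ar a qPR) A;
  dst_mk : rarr (ar a qMK) M;
  dst_ord : forall k, k < size o -> ar a qORD k = nth 0 [seq vid u | u <- o] k;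
  dst_raw0 : forall x, 2 * B < x < X -> ar a 0 x = graph_mem d e x;
  dst_raw1 : forall x, x < 2 * B -> ar a 1 x = graph_mem d e x.+1;
  dst_adj0 : forall j, ar a (qadj j) 0 = 0;
  dst_adj : forall v j, j < d -> ar a (qadj j) (vid v) = F v j }.

Lemma wp_asg r x g S A M o F a (Q : astate -> Prop) : dst g S A M o F a ->
  ok x a -> eval x a <= X ->
  (forall a', dst (upd g r (eval x a)) S A M o F a' -> ar a' = ar a -> Q a') ->
  wp (CAsg r x) Q a.
Proof.
move=> D Ok xX H; split; first exact/andP; apply: H => //.
by case: D => H1 *; split=> //=; rewrite H1.
Qed.

Lemma rarr_upd f S v (b : bool) : rarr f S ->
  rarr (upd f (vid v) b) (if b then v |: S else S :\ v).
Proof.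
move=> R x xn; rewrite /upd; case: (x =P _) => [->|nx].
  by rewrite memidS; case: b; rewrite ?setU11 ?setD11.
rewrite R // /memid; congr nat_of_bool; apply: eq_existsb => w.
case: (vid w =P x) => //= wx; have nwv : w != v by apply/eqP=> wv; case: nx; rewrite -wx wv.
by case: b; rewrite !inE ?nwv // (negbTE nwv).
Qed.

Lemma rarr_upd0 f S : rarr f S -> rarr (upd f 0 0) S.
Proof.
by move=> R x xn; rewrite /upd; case: (x =P 0) => [->|_]; rewrite ?memid0 ?R.
Qed.

Lemma wp_sto q x y a i c (Q : astate -> Prop) : 0 < q -> ok x a -> ok y a ->
  eval x a = i -> eval y a = c -> i < X -> c < X -> Q (seta a q i c) ->
  wp (CSto q x y) Q a.
Proof. by move=> q0 Okx Oky <- <- iX cX HQ; split=> //; apply/and5P. Qed.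

Lemma wp_in x y g S A M o F a v (b : bool) (Q : astate -> Prop) :
  dst g S A M o F a -> ok x a -> ok y a -> eval x a = vid v -> eval y a = b ->
  (forall a', dst g (if b then v |: S else S :\ v) A M o F a' -> Q a') ->
  wp (CSto qIN x y) Q a.
Proof.
move=> D Okx Oky Ex Ey H; have vn := vid_le v.
apply: wp_sto Okx Oky Ex Ey _ _ _ => //; [by lia|by have := ltn_ord v; case: (b); lia|].
by apply: H; case: D => *; split=> //=; apply: rarr_upd.
Qed.

Lemma wp_in0 x y g S A M o F a (Q : astate -> Prop) :
  dst g S A M o F a -> ok x a -> ok y a -> eval x a = 0 -> eval y a = 0 ->
  (forall a', dst g S A M o F a' -> Q a') -> wp (CSto qIN x y) Q a.
Proof.
move=> D Okx Oky Ex Ey H.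
apply: wp_sto Okx Oky Ex Ey _ _ _ => //; [by lia|by lia|].
by apply: H; case: D => *; split=> //=; apply: rarr_upd0.
Qed.

Lemma wp_pr x y g S A M o F a v (b : bool) (Q : astate -> Prop) :
  dst g S A M o F a -> ok x a -> ok y a -> eval x a = vid v -> eval y a = b ->
  (forall a', dst g S (if b then v |: A else A :\ v) M o F a' -> Q a') ->
  wp (CSto qPR x y) Q a.
Proof.
move=> D Okx Oky Ex Ey H; have vn := vid_le v.
apply: wp_sto Okx Oky Ex Ey _ _ _ => //; [by lia|by have := ltn_ord v; case: (b); lia|].
by apply: H; case: D => *; split=> //=; apply: rarr_upd.
Qed.

Lemma wp_mk x y g S A M o F a v (b : bool) (Q : astate -> Prop) :
  dst g S A M o F a -> ok x a -> ok y a -> eval x a = vid v -> eval y a = b ->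
  (forall a', dst g S A (if b then v |: M else M :\ v) o F a' -> Q a') ->
  wp (CSto qMK x y) Q a.
Proof.
move=> D Okx Oky Ex Ey H; have vn := vid_le v.
apply: wp_sto Okx Oky Ex Ey _ _ _ => //; [by lia|by have := ltn_ord v; case: (b); lia|].
by apply: H; case: D => *; split=> //=; apply: rarr_upd.
Qed.

Section Neighbours.

Variables (g : nat -> nat) (v : 'I_n) (M : {set 'I_n}) (o : seq 'I_n).
Hypothesis gv : g rv = vid v.

Lemma ev_nb S A j a : dst g S A M o adjid a -> j < d ->
  [/\ ok (nb j) a, eval (nb j) a = adjid v j & adjid v j < X].
Proof.
move=> D jd; have vn := vid_le v; have an := adjid_le v j; split; last by lia.
- apply: ok_arr => //; first by rewrite /eval /= (dst_rg D) gv; lia.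
- by rewrite /eval /= (dst_rg D) gv (dst_adj D).
Qed.

Lemma ev_dom S A x a y : dst g S A M o adjid a -> ok x a -> eval x a = y -> y <= n ->
  [/\ ok (domE d x) a, y = 0 -> eval (domE d x) a = 0
   & forall w, y = vid w -> eval (domE d x) a = \sum_(j < d) memid S (adjid w j)].
Proof.
move=> D Ok Ex yn.
have Ea j : j < d -> eval (adjE j x) a = ar a (qadj j) y by rewrite -Ex.
have al j : j < d -> ar a (qadj j) y <= n.
  case: y yn {Ex Ea} => [|y] yn jd; first by rewrite (dst_adj0 D).
  by have := dst_adj D (Ordinal yn) jd; rewrite /vid /= => ->; apply: adjid_le.
split.
- apply: ok_sumE => j jd; apply: ok_arr => //; first by apply: ok_arr; rewrite ?Ex //; lia.
  by rewrite Ea //; have := al _ jd; lia.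
- move=> y0; rewrite eval_sumE big1 // => j _.
  rewrite -[eval _ _]/(ar a qIN (eval (adjE j x) a)) Ea // y0 (dst_adj0 D).
  by rewrite (dst_in D) // memid0.
- move=> w yw; rewrite eval_sumE; apply: eq_bigr => j _.
  rewrite -[eval _ _]/(ar a qIN (eval (adjE j x) a)) Ea //.
  by rewrite (dst_in D) ?al // yw (dst_adj D).
Qed.

Lemma dom_free S w : (\sum_(j < d) memid S (adjid w j) == 0) = free e S w.
Proof.
rewrite sum_nat_eq0; apply/forallP/freeP=> [H u Su|H j].
  apply/negP=> ewu; have iu : index u (nbs e w) < size (nbs e w).
    by rewrite index_mem mem_nbs.
  have := H (Ordinal (leq_trans iu (size_nbs e_deg w))).
  by rewrite /adjid /= (nth_map w) // nth_index ?mem_nbs // memidS Su.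
apply/implyP=> _; case: (adjid_cases w j) => [[-> _]|[u [_ _ -> ewu]]].
  by rewrite memid0.
by rewrite memidS; apply/eqP; have := H u; case: (u \in S) => // /(_ isT); rewrite ewu.
Qed.

Definition N_set j : {set 'I_n} := [set u in take j (nbs e v)].

Lemma N_setE : N_set d = [set u | e v u].
Proof. by apply/setP=> u; rewrite inE take_oversize ?size_nbs // mem_nbs inE. Qed.

Lemma N_set_over j : size (nbs e v) <= j -> N_set j.+1 = N_set j.
Proof. by move=> H; rewrite /N_set !take_oversize // leqW. Qed.

Lemma N_setS j u : j < size (nbs e v) -> nth v (nbs e v) j = u ->
  N_set j.+1 = u |: N_set j.
Proof.
by move=> H <-; apply/setP=> x; rewrite !inE (take_nth v) // mem_rcons inE.
Qed.

Lemma clearC_wp S A a (Q : astate -> Prop) : dst g S A M o adjid a ->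
  (forall a', dst g (S :\: [set u | e v u]) A M o adjid a' -> Q a') ->
  wp (clearC d) Q a.
Proof.
move=> D HQ; apply: wp_sub (wp_for (I := fun j => dst g (S :\: N_set j) A M o adjid) _ _).
- by move=> a'; rewrite N_setE; apply: HQ.
- move=> j a' jd D'; have [Ok1 E1 _] := ev_nb D' jd.
  case: (adjid_cases v j) => [[E0 js]|[u [js nu Eu _]]].
    by apply: wp_in0 D' Ok1 _ _ _ _ => //; [rewrite E1|rewrite N_set_over].
  apply: (wp_in (v := u) (b := false)) D' Ok1 _ _ _ _ => //; first by rewrite E1.
  by rewrite (N_setS js nu) setDDl setUC.
- suff -> : S :\: N_set 0 = S by [].
  by apply/setP=> x; rewrite !inE take0.
Qed.

Lemma greedyC_wp S A a (Q : astate -> Prop) : dst g S A M o adjid a ->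
  (forall a', dst g (greedy e A S (nbs e v)) A M o adjid a' -> Q a') ->
  wp (greedyC d) Q a.
Proof.
move=> D HQ.
apply: wp_sub (wp_for (I := fun j => dst g (greedy e A S (take j (nbs e v))) A M o adjid) _ _).
- by move=> a'; rewrite take_oversize ?size_nbs //; apply: HQ.
- move=> j a' jd D'; have [Ok1 E1 aX] := ev_nb D' jd.
  have [Ok2 Z2 E2] := ev_dom D' Ok1 E1 (adjid_le v j).
  set t := ESub _ _; have Et : eval t a' = memid A (adjid v j) - eval (domE d (nb j)) a'.
    rewrite /t -[LHS]/(ar a' qPR (eval (nb j) a') - eval (domE d (nb j)) a').
    by rewrite E1 (dst_pr D') // adjid_le.
  apply: wp_if.
  + by apply/andP; split=> //; apply: ok_arr; rewrite // E1.
  + rewrite Et; case: (adjid_cases v j) => [[E0 js]|[u [js nu Eu _]]].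
      by rewrite E0 memid0.
    rewrite (E2 u Eu) Eu memidS => H.
    have /andP[Au fu] : (u \in A) && free e (greedy e A S (take j (nbs e v))) u.
      by rewrite -dom_free; move: H; case: (u \in A); lia.
    apply: (wp_in (v := u) (b := true)) D' Ok1 _ _ _ _ => //; first by rewrite E1.
    by move=> a''; rewrite (take_nth v) // /greedy foldl_rcons nu /gstep Au fu.
  + rewrite Et; case: (adjid_cases v j) => [[E0 js]|[u [js nu Eu _]]] H.
      by move: D'; rewrite !take_oversize // ltnW.
    rewrite (E2 u Eu) Eu memidS in H.
    suff : dst g (greedy e A S (take j.+1 (nbs e v))) A M o adjid a' by [].
    rewrite (take_nth v) // /greedy foldl_rcons nu /gstep ifF //.
    apply/negP=> /andP[Au]; rewrite -dom_free => /eqP f0.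
    by move: H; rewrite Au; move: f0; rewrite /greedy => ->.
- by rewrite take0.
Qed.

Lemma undoC_wp S A a (Q : astate -> Prop) : dst g S A M o adjid a ->
  (forall a', dst g (par e A v S) A M o adjid a' -> Q a') -> wp (undoC d) Q a.
Proof.
move=> D HQ; apply: wp_seq.
  apply: (wp_in (v := v) (b := false) D _ _ _ _ (fun a' H => H)) => //.
  by rewrite /eval /= (dst_rg D) gv.
by move=> a' D'; apply: greedyC_wp D' HQ.
Qed.

Lemma adjid_index x u : e x u -> exists2 j, j < d & adjid x j = vid u.
Proof.
move=> exu; have iu : index u (nbs e x) < size (nbs e x) by rewrite index_mem mem_nbs.
exists (index u (nbs e x)); first exact: leq_trans iu (size_nbs e_deg x).
by rewrite /adjid (nth_map x) // nth_index ?mem_nbs.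
Qed.

Lemma ok_add x y a : ok x a -> ok y a -> ok (EAdd x y) a.
Proof. by move=> H1 H2; apply/andP. Qed.

Lemma ok_sub x y a : ok x a -> ok y a -> ok (ESub x y) a.
Proof. by move=> H1 H2; apply/andP. Qed.

Lemma ev_adj S A x a y k : dst g S A M o adjid a -> ok x a -> eval x a = y -> y <= n ->
  k < d -> [/\ ok (adjE k x) a, y = 0 -> eval (adjE k x) a = 0,
    forall w, y = vid w -> eval (adjE k x) a = adjid w k & eval (adjE k x) a <= n].
Proof.
move=> D Ok Ex yn kd.
have Ea : eval (adjE k x) a = ar a (qadj k) y by rewrite -Ex.
have H0 : y = 0 -> eval (adjE k x) a = 0 by move=> y0; rewrite Ea y0 (dst_adj0 D).
have Hw w : y = vid w -> eval (adjE k x) a = adjid w k by move=> yw; rewrite Ea yw (dst_adj D).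
split=> //; first by apply: ok_arr; rewrite ?Ex //; lia.
case: (posnP y) => [/H0->//|y0]; have yn' : y.-1 < n by lia.
by rewrite (Hw (Ordinal yn')) ?adjid_le // /vid /= prednK.
Qed.

Lemma ev_bad S A a : dst g S A M o adjid a -> ok (badE d) a /\
  (eval (badE d) a == 0) = [forall x in nbs e v, forall w in nbs e x,
     (w \in A) ==> (w \in S) || ~~ free e S w].
Proof.
move=> D.
pose t j k := let w := adjE k (nb j) in
  ESub (EArr qPR w) (EAdd (EArr qIN w) (domE d w)).
have Et j k : j < d -> k < d -> ok (t j k) a /\
    (eval (t j k) a == 0) = ~~ [exists x, exists w, [&& adjid v j == vid x,
      adjid x k == vid w, w \in A, w \notin S & free e S w]].
  move=> jd kd; have [Ok1 E1 a1] := ev_nb D jd.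
  have [Ok2 E20 E2 a2] := ev_adj D Ok1 E1 (adjid_le v j) kd.
  have [Ok3 E30 E3] := ev_dom D Ok2 (erefl _) a2.
  have aX : eval (adjE k (nb j)) a < X by lia.
  split.
    by apply: ok_sub; [apply: ok_arr|apply: ok_add => //; apply: ok_arr].
  rewrite -[eval (t j k) a]/(ar a qPR (eval (adjE k (nb j)) a) -
    (ar a qIN (eval (adjE k (nb j)) a) + eval (domE d (adjE k (nb j))) a)).
  rewrite (dst_pr D) // (dst_in D) //.
  have zero : eval (adjE k (nb j)) a = 0 -> ~ (exists x, exists w,
      [&& adjid v j == vid x, adjid x k == vid w, w \in A, w \notin S & free e S w]).
    by move=> Ez [x [w /and3P[/eqP ex /eqP ew _]]]; move: Ez; rewrite (E2 x) // ew.
  case: (adjid_cases v j) => [[E0 _]|[x [_ _ ex _]]].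
    rewrite E20 // memid0 sub0n eqxx; symmetry; apply/existsP=> -[x /existsP[w H]].
    by case: zero; [exact: E20|exists x, w].
  case: (adjid_cases x k) => [[E0 _]|[w [_ _ ew _]]].
    rewrite (E2 x) // E0 memid0 sub0n eqxx; symmetry; apply/existsP=> -[y /existsP[w H]].
    by case: zero; [rewrite (E2 x)|exists y, w].
  rewrite (E3 w) ?(E2 x) // ew !memidS.
  have -> : [exists x0, exists w0, [&& adjid v j == vid x0, adjid x0 k == vid w0,
       w0 \in A, w0 \notin S & free e S w0]] = [&& w \in A, w \notin S & free e S w].
    apply/existsP/idP=> [[x0 /existsP[w0]]|H].
      rewrite ex => /and3P[/eqP/succn_inj/val_inj<-]; rewrite ew.
      by move=> /eqP/succn_inj/val_inj<-.
    by exists x; apply/existsP; exists w; rewrite ex ew !eqxx.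
  by rewrite -dom_free; case: (w \in A); case: (w \in S); lia.
split.
  by apply: ok_sumE => j jd; apply: ok_sumE => k kd; case: (Et j k jd kd).
rewrite eval_sumE sum_nat_eq0; apply/forallP/forall_inP=> [H x|H j].
  rewrite mem_nbs => /adjid_index[j jd ej]; apply/forall_inP=> w.
  rewrite mem_nbs => /adjid_index[k kd ek]; apply/implyP=> Aw.
  have := H (Ordinal jd); rewrite eval_sumE sum_nat_eq0 => /forallP/(_ (Ordinal kd)).
  rewrite /= (proj2 (Et j k jd kd)) => /existsPn/(_ x)/existsPn/(_ w).
  by rewrite ej ek !eqxx Aw /= negb_and negbK.
apply/implyP=> _; rewrite eval_sumE sum_nat_eq0; apply/forallP=> k; apply/implyP=> _.
rewrite (proj2 (Et j k (ltn_ord j) (ltn_ord k))).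
apply/existsP=> -[x /existsP[w /and5P[/eqP ex /eqP ew Aw nSw fw]]].
have xv : x \in nbs e v.
  case: (adjid_cases v j) => [[E0 _]|[y [_ _ ey evy]]]; first by rewrite E0 in ex.
  by rewrite ey in ex; rewrite -(val_inj (succn_inj ex)) mem_nbs.
have wx : w \in nbs e x.
  case: (adjid_cases x k) => [[E0 _]|[y [_ _ ey evy]]]; first by rewrite E0 in ew.
  by rewrite ey in ew; rewrite -(val_inj (succn_inj ew)) mem_nbs.
by have := forall_inP (H x xv) w wx; rewrite Aw (negbTE nSw) fw.
Qed.

End Neighbours.

Section SavedMembership.

Variables (v : 'I_n) (M : {set 'I_n}) (o : seq 'I_n).

Lemma saveC_wp g S A a (Q : astate -> Prop) : g rv = vid v ->
  dst g S A M o adjid a ->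
  (forall g' a', dst g' S A M o adjid a' -> (forall r, r < 13 -> g' r = g r) ->
     (forall j, j < d -> g' (rb j) = memid S (adjid v j)) -> Q a') ->
  wp (saveC d) Q a.
Proof.
move=> gv D HQ; pose I j a' := exists g', [/\ dst g' S A M o adjid a',
  forall r, r < 13 -> g' r = g r & forall i, i < j -> g' (rb i) = memid S (adjid v i)].
apply: (@wp_sub _ _ _ (I d)); first by move=> a' [g' [D' H1 H2]]; apply: HQ D' H1 H2.
apply: wp_for => [j a' jd [g' [D' H1 H2]]|]; last by exists g.
have gv' : g' rv = vid v by rewrite H1.
have [Ok1 E1 aX] := ev_nb gv' D' jd.
have Ev : eval (EArr qIN (nb j)) a' = memid S (adjid v j).
  by rewrite -[LHS]/(ar a' qIN (eval (nb j) a')) E1 (dst_in D') ?adjid_le.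
apply: (wp_asg D').
- by apply: ok_arr => //; rewrite E1.
- by rewrite Ev; have := memid_le S (adjid v j); lia.
move=> a'' D'' _; exists (upd g' (rb j) (eval (EArr qIN (nb j)) a')); split=> //.
- by move=> r r13; rewrite /upd; case: eqP => [rE|_]; [lia|apply: H1].
- move=> i; rewrite ltnS leq_eqVlt => /predU1P[->|ij]; rewrite /upd ?eqxx //.
  by case: eqP => [[ei]|_]; [rewrite ei ltnn in ij|apply: H2].
Qed.

Lemma restoreC_wp g S P A a (Q : astate -> Prop) : g rv = vid v ->
  dst g P A M o adjid a -> (forall j, j < d -> g (rb j) = memid S (adjid v j)) ->
  (forall u, ~~ e v u -> (u \in P) = (u \in S)) ->
  (forall a', dst g S A M o adjid a' -> Q a') ->
  wp (restoreC d) Q a.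
Proof.
move=> gv D Hb PS HQ.
pose T j := [set u | if u \in N_set v j then u \in S else u \in P].
apply: wp_sub (wp_for (I := fun j => dst g (T j) A M o adjid) _ _).
- move=> a'; suff -> : T d = S by apply: HQ.
  apply/setP=> u; rewrite inE N_setE inE; case: ifPn => // /PS.
  by [].
- move=> j a' jd D'; have [Ok1 E1 _] := ev_nb gv D' jd.
  have E2 : eval (EReg (rb j)) a' = memid S (adjid v j).
    by rewrite -Hb // -(dst_rg D').
  case: (adjid_cases v j) => [[E0 js]|[u [js nu Eu _]]].
    by apply: (wp_in0 D' Ok1) => //; rewrite ?E1 ?E2 ?E0 ?memid0 // /T N_set_over.
  apply: (wp_in (v := u) (b := u \in S) D' Ok1) => //; first by rewrite E1.
    by rewrite E2 Eu memidS.
  suff -> : (if u \in S then u |: T j else T j :\ u) = T j.+1 by [].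
  apply/setP=> x; rewrite [in RHS]inE (N_setS js nu) in_setU1.
  have [->|nx] /= := eqVneq x u; first by case: ifP => Su; rewrite !inE eqxx Su.
  by case: ifP => _; rewrite !inE ?(negbTE nx).
- suff -> : T 0 = P by [].
  by apply/setP=> x; rewrite inE /N_set take0 inE.
Qed.

Lemma ev_diff g S P A a : g rv = vid v ->
  dst g P A M o adjid a -> (forall j, j < d -> g (rb j) = memid S (adjid v j)) ->
  ok (diffE d) a /\ (eval (diffE d) a == 0) = [forall u in nbs e v, (u \in P) == (u \in S)].
Proof.
move=> gv D Hb; split.
  apply: ok_sumE => j jd; have [Ok1 E1 aX] := ev_nb gv D jd.
  have Ok2 : ok (EArr qIN (nb j)) a by apply: ok_arr => //; rewrite E1.
  by apply: ok_add; apply: ok_sub.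
have Et j : j < d -> eval (EAdd (ESub (EArr qIN (nb j)) (EReg (rb j)))
    (ESub (EReg (rb j)) (EArr qIN (nb j)))) a =
    memid P (adjid v j) - memid S (adjid v j) + (memid S (adjid v j) - memid P (adjid v j)).
  move=> jd; have [Ok1 E1 aX] := ev_nb gv D jd.
  have E2 : ar a qIN (eval (nb j) a) = memid P (adjid v j).
    by rewrite E1 (dst_in D) ?adjid_le.
  have E3 : rg a (rb j) = memid S (adjid v j) by rewrite (dst_rg D) Hb.
  by rewrite -E2 -E3.
rewrite eval_sumE sum_nat_eq0; apply/forallP/forall_inP=> [H u|H j].
  rewrite mem_nbs => /adjid_index[j jd ej]; have := H (Ordinal jd).
  by rewrite Et // ej !memidS /=; case: (u \in P); case: (u \in S).
apply/implyP=> _; rewrite Et //.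
case: (adjid_cases v j) => [[-> _]|[u [_ _ -> evu]]]; first by rewrite !memid0.
by rewrite !memidS (eqP (H u _)) ?mem_nbs // subnn.
Qed.

End SavedMembership.

Section SearchStep.

Local Arguments cmd_wp : simpl never.
Local Arguments dstep : simpl never.

Variables (A0 M : {set 'I_n}) (o : seq 'I_n) (v0 : 'I_n).
Hypotheses (o_uniq : uniq o) (o_A0 : forall x, x \in o -> x \notin A0).

Let lev := lv A0 o.
Let step := dstep e A0 o v0.

Lemma wp_cat c1 c2 Q a : wp c1 (wp c2 Q) a -> wp (c1 ;; c2) Q a.
Proof. by []. Qed.

Definition dfs_st (s : dstate n) g a := [/\ dst g (dset s) (lev (dht s)) M o adjid a,
  g rH = dht s, g rU = dup s & g rN = size o].

Lemma size_o : size o <= n.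
Proof. by rewrite -(card_uniqP o_uniq) -[X in _ <= X]card_ord max_card. Qed.

Lemma lev_rem h : h < size o -> lev h :\ nth v0 o h = lev h.+1.
Proof. by move=> hN; rewrite /lev (lvS A0 v0 hN) setU1K // lv_notin. Qed.

Lemma ev_reg g S A M' o' F a r : dst g S A M' o' F a -> eval (EReg r) a = g r.
Proof. by move=> D; rewrite /eval /= (dst_rg D). Qed.

Lemma ev_ord g S A a h : dst g S A M o adjid a -> h < size o -> g rH = h ->
  ok (EArr qORD (EReg rH)) a /\ eval (EArr qORD (EReg rH)) a = vid (nth v0 o h).
Proof.
move=> D hN gh; have on := size_o; split.
  by apply: ok_arr => //; rewrite (ev_reg _ D) gh; lia.
rewrite -[LHS]/(ar a qORD (eval (EReg rH) a)) (ev_reg _ D) gh (dst_ord D) //.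
exact: nth_map.
Qed.

Lemma incH_wp g S A F a h (Q : astate -> Prop) : dst g S A M o F a -> g rH = h -> h < n ->
  (forall a', dst (upd g rH h.+1) S A M o F a' -> Q a') -> wp (incC rH) Q a.
Proof.
move=> D gh hn H; have Ev : eval (EAdd (EReg rH) (ECst 1)) a = h.+1.
  by rewrite -[LHS]/(eval (EReg rH) a + 1) (ev_reg _ D) gh addn1.
by apply: (wp_asg D) => //; rewrite Ev; [lia|move=> a' D' _; apply: H].
Qed.

Lemma downC_wp s g a (Q : astate -> Prop) :
  dvalid e A0 o s -> dup s = false -> 0 < dht s -> dfs_st s g a ->
  (forall g' a', dfs_st (step s) g' a' -> g' rFL = g rFL -> Q a') -> wp (downC d) Q a.
Proof.
case: s => b h S /andP[/= mS hN] -> h0 [/= D gH gU gN] HQ.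
case: h h0 mS hN D gH HQ => // k _ mS kN D gH HQ; have on := size_o.
have E1 : eval (ESub (EReg rH) (ECst 1)) a = k.
  by rewrite -[LHS]/(eval (EReg rH) a - 1) (ev_reg _ D) gH subn1.
apply: wp_cat; apply: (wp_asg D) => //; rewrite E1; first by lia.
move=> a1 D1 _; set g1 := upd g rH k in D1.
have [Ok2 E2] := ev_ord D1 kN (erefl _); set v := nth v0 o k in E2.
have vn := vid_le v.
apply: wp_cat; apply: (wp_asg D1) => //; rewrite E2; first by lia.
move=> a2 D2 _; set g2 := upd g1 rv (vid v) in D2.
have Ev : eval (EReg rv) a2 = vid v by rewrite (ev_reg _ D2).
apply: (wp_seq (P := dst g2 S (lev k) M o adjid)).
  apply: (wp_pr (v := v) (b := true) D2) => // a3.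
  by rewrite /= /lev -lvS.
move=> a3 D3; have Ev3 : eval (EReg rv) a3 = vid v by rewrite (ev_reg _ D3).
have [Ok4 _ E4] := ev_dom (erefl _ : g2 rv = vid v) D3 (isT : ok (EReg rv) a3) Ev3 vn.
have fin (T : {set 'I_n}) a' : dst g2 T (lev k) M o adjid a' ->
    T = (if free e S v then v |: S else S) -> Q a'.
  by move=> D' eT; apply: (HQ g2 a') => //; split; rewrite //= -/v -eT.
apply: wp_if => //; rewrite (E4 v) //.
  by move=> H; apply: fin D3 _; rewrite -(dom_free S v) (negbTE H).
move=> /eqP H; apply: (wp_in (v := v) (b := true) D3) => // a' D'.
by apply: fin D' _; rewrite -(dom_free S v) H.
Qed.

Lemma upC_wp s g a (Q : astate -> Prop) :
  dvalid e A0 o s -> dup s -> dht s < size o -> dfs_st s g a ->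
  (forall g' a', dfs_st (step s) g' a' -> g' rFL = g rFL -> Q a') -> wp (upC d) Q a.
Proof.
case: s => b h S /andP[/= mS _] bT hN [/= D gH gU gN] HQ; have on := size_o.
rewrite {b}bT in gU HQ.
have [Ok1 E1] := ev_ord D hN gH; set v := nth v0 o h in E1; have vn := vid_le v.
apply: wp_cat; apply: (wp_asg D) => //; rewrite E1; first by lia.
move=> a1 D1 _; set g1 := upd g rv (vid v) in D1.
have g1v : g1 rv = vid v by [].
set A := lev h.+1.
apply: (wp_seq (P := dst g1 S A M o adjid)).
  apply: (wp_pr (v := v) (b := false) D1) => // [|a2].
    by rewrite (ev_reg _ D1).
  by rewrite /= lev_rem.
move=> a2 D2; have E2 : eval (EReg rv) a2 = vid v by rewrite (ev_reg _ D2).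
have E3 : eval (EArr qIN (EReg rv)) a2 = (v \in S).
  by rewrite -[LHS]/(ar a2 qIN (eval (EReg rv) a2)) E2 (dst_in D2) // memidS.
have nA : v \notin A by apply: lv_notin.
have stepE : step (DState true h S) =
    if v \in S then DState true h.+1 (par e A v S)
    else if okchild e A v S then DState false h (cand e S v) else DState true h.+1 S.
  by rewrite /step /dstep ltn_eqF.
rewrite stepE {stepE} in HQ.
have fin g' (T : {set 'I_n}) a' : dst g' T A M o adjid a' ->
    (forall r, r < 13 -> r != rv -> r != rBad -> g' r = g r) ->
    (forall g'' a'', dfs_st (DState true h.+1 T) g'' a'' -> g'' rFL = g rFL -> Q a'') ->
    wp (incC rH) Q a'.
  move=> D' Hg H; apply: (incH_wp D' (h := h)); [by rewrite Hg|lia|].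
  move=> a'' D''; apply: (H (upd g' rH h.+1) a''); last by rewrite -(Hg rFL).
  split=> //; first by rewrite /upd /= Hg // gU.
  by rewrite /upd /= Hg.
apply: wp_if; first by apply: ok_arr => //; rewrite E2; lia.
  rewrite E3 => Sv'; have Sv : v \in S by case: (v \in S) Sv'.
  apply: (wp_seq (P := dst g1 (par e A v S) A M o adjid)).
    exact: undoC_wp D2 (fun a' H => H).
  move=> a3 D3; apply: fin D3 _ _; last by rewrite Sv in HQ.
  by move=> r _ nr _; rewrite /g1 /upd (negbTE nr).
rewrite E3 => nSv'; have nSv : (v \in S) = false by case: (v \in S) nSv'.
rewrite nSv in HQ.
(* As [v] is not in [S], the set is its own parent and hence maximal in [A] as well. *)
have mSA : misin e A S.
  have mS' : misin e (v |: A) S by rewrite /A /lev -lvS.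
  by have := parent_misin e_sym e_irr nA mS'; rewrite /parent nSv.
have nfS : ~~ free e S v.
  apply/negP=> fS; suff : v \in S by rewrite nSv.
  by apply: (misin_in mS _ fS); rewrite (lvS A0 v0 hN) setU11.
apply: (wp_seq (P := fun a' => exists g', [/\ dst g' S A M o adjid a',
    forall r, r < 13 -> g' r = g1 r
    & forall j, j < d -> g' (rb j) = memid S (adjid v j)])).
  by apply: (saveC_wp g1v D2) => g' a' D' H1 H2; exists g'.
move=> a3 [g3 [D3 H31 H32]]; have g3v : g3 rv = vid v by rewrite H31.
apply: (wp_seq (P := dst g3 (S :\: [set u | e v u]) A M o adjid)).
  exact: clearC_wp D3 (fun a' H => H).
move=> a4 D4; apply: (wp_seq (P := dst g3 (cand e S v) A M o adjid)).
  by apply: (wp_in (v := v) (b := true) D4) => //; rewrite (ev_reg _ D4).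
move=> a5 D5; have [Ok5 E5] := ev_bad g3v D5.
rewrite -cand_misin // in E5.
pose bad := ~~ misin e (v |: A) (cand e S v).
pose g6 := upd g3 rBad bad; have g6v : g6 rv = vid v by exact: g3v.
apply: (wp_seq (P := dst g6 (cand e S v) A M o adjid)).
  apply: wp_if => // Hb.
    have bT : bad by rewrite /bad -E5.
    by apply: (wp_asg D5) => // [|a6 D6 _]; [rewrite /eval /=; lia|rewrite /g6 bT].
  have bF : bad = false by rewrite /bad -E5 Hb.
  by apply: (wp_asg D5) => // a6 D6 _; rewrite /g6 bF.
move=> a6 D6; set P := par e A v (cand e S v).
apply: (wp_seq (P := dst g6 P A M o adjid)).
  exact: undoC_wp D6 (fun a' H => H).
move=> a7 D7; have g6b j : j < d -> g6 (rb j) = memid S (adjid v j) by exact: H32.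
have [Ok7 E7] := ev_diff g6v D7 g6b.
(* The greedy pass touches neighbours of [v] only. Elsewhere the undone candidate agrees with [S],
   so the comparison on neighbours decides equality. *)
have PS u : ~~ e v u -> (u \in P) = (u \in S).
  move=> nvu; rewrite /P /par /greedy.
  have H l T : u \notin l -> (u \in foldl (gstep e A) T l) = (u \in T).
    elim: l T => //= x l IH T; rewrite inE negb_or => /andP[nux nul].
    by rewrite IH // /gstep; case: ifP => // _; rewrite !inE (negbTE nux).
  rewrite H ?mem_nbs // !inE nvu; have [->|] := eqVneq u v; last by [].
  by rewrite nSv.
have Eok : okchild e A v S = ~~ bad && (eval (diffE d) a7 == 0).
  rewrite /okchild /bad negbK E7; congr (_ && _); apply/eqP/forall_inP=> [PSe u _|H].
    by rewrite /P PSe.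
  apply/setP=> u; have [evu|nvu] := boolP (e v u); last exact: PS.
  by apply/eqP/H; rewrite mem_nbs.
have E8 : eval (EAdd (EReg rBad) (diffE d)) a7 = bad + eval (diffE d) a7.
  by rewrite -[LHS]/(eval (EReg rBad) a7 + eval (diffE d) a7) (ev_reg _ D7).
apply: wp_if; first exact: ok_add.
  rewrite E8 => Hne; apply: (wp_seq (P := dst g6 S A M o adjid)).
    exact: restoreC_wp g6v D7 g6b PS (fun a' H => H).
  move=> a8 D8; apply: fin D8 _ _.
    by move=> r r13 n1 n2; rewrite /g6 /upd (negbTE n2) H31 // /g1 /upd (negbTE n1).
  move=> g'' a''; have -> : DState true h.+1 S = (if okchild e A v S then
    DState false h (cand e S v) else DState true h.+1 S).
    by rewrite Eok; case: (bad) Hne => //=; case: eqP => // ->.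
  exact: HQ.
rewrite E8 => /eqP; rewrite addn_eq0 eqb0 => /andP[nb0 nd0].
have Ec : okchild e A v S by rewrite Eok nb0 nd0.
rewrite Ec in HQ; have {Ec} Ec : P = S.
  by move: Ec; rewrite /okchild => /andP[_ /eqP].
rewrite Ec in D7.
apply: (wp_seq (P := dst g6 (S :\: [set u | e v u]) A M o adjid)).
  exact: clearC_wp D7 (fun a' H => H).
move=> a8 D8; apply: (wp_seq (P := dst g6 (cand e S v) A M o adjid)).
  by apply: (wp_in (v := v) (b := true) D8) => //; rewrite (ev_reg _ D8).
move=> a9 D9; apply: (wp_seq (P := dst g6 (cand e S v) (lev h) M o adjid)).
  apply: (wp_pr (v := v) (b := true) D9) => //; first by rewrite (ev_reg _ D9).
  by move=> a'; rewrite /lev (lvS A0 v0 hN).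
move=> a10 D10; apply: (wp_asg D10) => // a11 D11 _.
have g6r r : r < 13 -> r != rv -> r != rBad -> g6 r = g r.
  by move=> r13 n1 n2; rewrite /g6 /upd (negbTE n2) H31 // /g1 /upd (negbTE n1).
apply: (HQ _ _ _ _).
  by split; first exact: D11; rewrite //= /upd /= g6r.
by rewrite /upd /= g6r.
Qed.

Lemma dfsC_wp s g a (Q : astate -> Prop) :
  dvalid e A0 o s -> ~~ dfinal o s -> dfs_st s g a ->
  (forall g' a', dfs_st (step s) g' a' -> g' rFL = dout s -> Q a') -> wp (dfsC d) Q a.
Proof.
move=> V nF [D gH gU gN] HQ; have hN := andP V; rewrite /= in hN; case: hN => _ hN.
apply: wp_cat; apply: (wp_asg D) => // a1 D1 _; set g1 := upd g rFL 0 in D1.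
have St1 : dfs_st s g1 a1 by split.
have E1 : eval (EReg rU) a1 = dup s by rewrite (ev_reg _ D1).
have E2 : eval (EReg rH) a1 = dht s by rewrite (ev_reg _ D1).
apply: wp_if => //; rewrite E1.
  case U: (dup s) => // _; apply: (upC_wp V U _ St1).
    by move: nF; rewrite /dfinal U ltn_neqAle hN andbT.
  by move=> g' a' St' F'; apply: HQ St' _; rewrite F' /dout U.
case U: (dup s) => // _; apply: wp_if => //; rewrite E2.
  rewrite -lt0n => h0; apply: (downC_wp V U h0 St1).
  by move=> g' a' St' F'; apply: HQ St' _; rewrite F' /dout U -[_ == 0]negbK -lt0n h0.
move=> h0; apply: wp_cat; apply: (wp_asg D1) => //; first by rewrite /eval /=; lia.
move=> a2 D2 _; apply: (wp_asg D2) => //; first by rewrite /eval /=; lia.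
move=> a3 D3 _; apply: (HQ (upd (upd g1 rFL 1) rU 1) a3); last by rewrite /dout U h0.
move: D3 gH gN U h0; case: (s) => b h S /= D3 gH gN U h0.
by rewrite U h0 in D3 gH *; split.
Qed.

End SearchStep.

(** * Reading the graph and fixing the order of the vertices *)

Section Scan.

Local Arguments cmd_wp : simpl never.
Local Arguments expr_val : simpl never.
Local Arguments expr_ok : simpl never.

Variable st : nat.
Hypotheses (st_gt0 : 0 < st) (X_st : X = n * st) (X_cells : n * d.+1 < X).

Lemma neighboursE v : neighbours e v = map val (nbs e v).
Proof. by []. Qed.

Lemma gm_row v r : r <= d -> graph_mem d e (v * d.+1 + r.+1) =
  if r == 0 then size (nbs e v) else nth 0 (map val (nbs e v)) r.-1.
Proof.
move=> rd; rewrite /graph_mem addnS /= divnMDl // modnMDl divn_small ?ltnS //.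
by rewrite modn_small ?ltnS // addn0 valK neighboursE size_map.
Qed.

Lemma gm_row_le v r : r <= d -> graph_mem d e (v * d.+1 + r.+1) < X.
Proof.
move=> rd; rewrite gm_row //; have nd : n <= n * d.+1 by rewrite leq_pmulr.
case: eqP => _.
  apply: leq_ltn_trans (size_nbs e_deg v) _; apply: leq_ltn_trans X_cells.
  by apply: leq_trans (leqnSn d) (leq_pmull _ _); case: (v) => m /=; lia.
case: (ltnP r.-1 (size (map val (nbs e v)))) => H; last by rewrite nth_default //; lia.
have /mapP[u _ ->] := mem_nth 0 H.
exact: ltn_trans (ltn_ord u) nX.
Qed.

Lemma cell_lt v r : r <= d -> v * d.+1 + r.+1 < X.
Proof.
by move=> rd; apply: leq_ltn_trans X_cells; have := ltn_ord v; nia.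
Qed.

Lemma readC_wp r v g S A M o F a (Q : astate -> Prop) : r <= d ->
  dst g S A M o F a -> g rP = v * d.+1 -> g rK = (2 * B).+1 ->
  (forall g' a', dst g' S A M o F a' -> (forall x, x != rT -> g' x = g x) ->
    g' rT = graph_mem d e (v * d.+1 + r.+1) -> Q a') ->
  wp (readC r) Q a.
Proof.
move=> rd D gP gK HQ; have cX := cell_lt v rd; have gX := gm_row_le v rd.
set c := v * d.+1 + r.+1 in cX gX HQ.
have E1 : eval (EAdd (EReg rP) (ECst r.+1)) a = c.
  by rewrite -[LHS]/(eval (EReg rP) a + r.+1) (ev_reg _ D) gP.
apply: wp_cat; apply: (wp_asg D) => //; rewrite E1; first by lia.
move=> a1 D1 _; set g1 := upd g rT c in D1.
have ET : eval (EReg rT) a1 = c by rewrite (ev_reg _ D1).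
have EK : eval (EReg rK) a1 = (2 * B).+1 by rewrite (ev_reg _ D1) -gK.
have fin g2 a2 x : dst (upd g1 rT x) S A M o F a2 -> x = graph_mem d e c -> Q a2.
  move=> D2 Ex; apply: (HQ _ _ D2); last by rewrite /upd /= Ex.
  by move=> y ny; rewrite /g1 /upd (negbTE ny).
apply: wp_if => //; rewrite -[eval _ _]/(eval (EReg rK) a1 - eval (EReg rT) a1) ET EK.
  move=> Hlt; have E2 : eval (ESub (EReg rT) (ECst 1)) a1 = c.-1.
    by rewrite -[LHS]/(eval (EReg rT) a1 - 1) ET subn1.
  have E3 : eval (EArr 1 (ESub (EReg rT) (ECst 1))) a1 = graph_mem d e c.
    rewrite -[LHS]/(ar a1 1 (eval (ESub (EReg rT) (ECst 1)) a1)) E2 (dst_raw1 D1); last by lia.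
    by rewrite prednK // /c; lia.
  apply: (wp_asg D1); [by apply: ok_arr => //; rewrite E2; lia|by rewrite E3; lia|].
  by move=> a2 D2 _; apply: fin D2 _.
move=> Hge; have E3 : eval (EArr 0 (EReg rT)) a1 = graph_mem d e c.
  by rewrite -[LHS]/(ar a1 0 (eval (EReg rT) a1)) ET (dst_raw0 D1) //; lia.
apply: (wp_asg D1); [|by rewrite E3; lia|by move=> a2 D2 _; apply: fin D2 _].
by apply/and3P; split=> //; rewrite -/(eval (EReg rT) a1) ET; lia.
Qed.

Lemma wp_adj j x y g S A M o F F' a v c (Q : astate -> Prop) :
  dst g S A M o F a -> ok x a -> ok y a -> eval x a = vid v -> eval y a = c -> c < X ->
  (forall v' j', j' < d -> F' v' j' = if (v' == v) && (j' == j) then c else F v' j') ->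
  (forall a', dst g S A M o F' a' -> Q a') ->
  wp (CSto (qadj j) x y) Q a.
Proof.
move=> D Okx Oky Ex Ey cX HF H; have vn := vid_le v.
apply: wp_sto Okx Oky Ex Ey _ cX _ => //; first by lia.
apply: H; case: D => H1 H2 H3 H4 H5 H6 H7 H8 H9; split=> //= [j'|v' j' jd].
  by case: eqP => // _; rewrite /upd /=.
rewrite HF // !eqSS; case: (j' =P j) jd => [->|_] jd; last by rewrite andbF H9.
rewrite andbT /upd; case: (v' =P v) => [->|nv]; first by rewrite eqxx.
by rewrite ifN ?H9 //; apply/eqP=> /succn_inj/val_inj.
Qed.

Definition rows i (v : 'I_n) j := if v < i then adjid v j else 0.

Lemma rowC_wp v g S A M o a (Q : astate -> Prop) :
  dst g S A M o (rows v) a -> g rP = v * d.+1 -> g rK = (2 * B).+1 ->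
  g rv = vid v -> g rD = size (nbs e v) ->
  (forall g' a', dst g' S A M o (rows v.+1) a' -> (forall x, x != rT -> g' x = g x) ->
    Q a') ->
  wp (rowC d) Q a.
Proof.
move=> D gP gK gv gD HQ.
(* Row [v] filled up to column [k]: this interpolates between [rows v] and [rows v.+1]. *)
pose G k (v' : 'I_n) j := if (v' == v) && (k <= j) then 0 else rows v.+1 v' j.
pose I k a' := exists g', dst g' S A M o (G k) a' /\ forall x, x != rT -> g' x = g x.
have eqF F F' g' a' : (forall v' j', j' < d -> F' v' j' = F v' j') ->
    dst g' S A M o F a' -> dst g' S A M o F' a'.
  by move=> HF [H1 H2 H3 H4 H5 H6 H7 H8 H9]; split=> // v' j' jd; rewrite HF ?H9.
apply: (@wp_sub _ _ _ (I d)).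
  move=> a' [g' [D' H]]; apply: (HQ g' a') H; apply: eqF D' => v' j' jd.
  by rewrite /G [d <= j']leqNgt jd andbF.
apply: wp_for => [j a' jd [g' [D' H]]|]; last first.
  exists g; split=> //; apply: eqF D => v' j' jd; rewrite /G andbT /rows ltnS.
  have [->|nv] := eqVneq v' v; first by rewrite ltnn.
  by rewrite [v' <= v]leq_eqVlt (negbTE nv : (val v' == val v) = false).
apply: wp_cat; apply: (readC_wp (v := v) (r := j.+1) jd D'); rewrite ?H //.
move=> g2 a2 D2 H2 E2; rewrite gm_row //= in E2.
have H2' x : x != rT -> g2 x = g x by move=> nx; rewrite H2 ?H.
have ED : eval (EReg rD) a2 = size (nbs e v) by rewrite (ev_reg _ D2) H2'.
have ET : eval (EReg rT) a2 = nth 0 (map val (nbs e v)) j by rewrite (ev_reg _ D2).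
have Ev : eval (EReg rv) a2 = vid v by rewrite (ev_reg _ D2) H2'.
apply: wp_if => //; rewrite -[eval _ _]/(eval (EReg rD) a2 - j) ED.
  move=> js; have {}js : j < size (nbs e v) by lia.
  have Ea : eval (EAdd (EReg rT) (ECst 1)) a2 = adjid v j.
    rewrite -[LHS]/(eval (EReg rT) a2 + 1) ET /adjid (nth_map v) // (nth_map v) //.
    by rewrite addn1.
  apply: (wp_adj (F' := G j.+1) D2 _ _ Ev Ea) => //.
  - by have := adjid_le v j; lia.
  - move=> v' j' jd'; rewrite /G; have [->|nv] //= := eqVneq v' v.
    have [->|nj] := eqVneq j' j; first by rewrite ltnn /rows ltnSn.
    by rewrite [j <= j']leq_eqVlt eq_sym (negbTE nj).
  - by move=> a3 D3; exists g2.
move=> sj; have {}sj : size (nbs e v) <= j by lia.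
exists g2; split=> //; apply: eqF D2 => v' j' jd'; rewrite /G.
have [->|nv] //= := eqVneq v' v.
rewrite [j <= j']leq_eqVlt; case: eqP => [<-|_] //=.
by rewrite ltnn /rows ltnSn /adjid nth_default ?size_map.
Qed.

Definition MO A o := A :|: [set x in o].

Lemma MO_rcons A o u : u |: MO A o = MO A (rcons o u).
Proof. by apply/setP=> x; rewrite !inE mem_rcons inE orbCA. Qed.

Lemma uniq_size_lt o : uniq o -> size o < X.
Proof.
move=> uo; apply: leq_ltn_trans nX.
by rewrite -(card_uniqP uo) -[X in _ <= X]card_ord max_card.
Qed.

Lemma pushC_wp x u g S A o F a (Q : astate -> Prop) :
  dst g S A (MO A o) o F a -> g rH = size o -> uniq (rcons o u) ->
  (forall M' o' a', dst g S A M' o' F a' -> ok x a' /\ eval x a' = vid u) ->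
  (forall a', dst (upd g rH (size (rcons o u))) S A (MO A (rcons o u)) (rcons o u) F a' -> Q a') ->
  wp (pushC x) Q a.
Proof.
move=> D gH uo Hx HQ; have so := uniq_size_lt uo; rewrite size_rcons in so HQ.
have un := vid_le u; have [Ok1 E1] := Hx _ _ _ D.
apply: wp_cat; have EH : eval (EReg rH) a = size o by rewrite (ev_reg _ D).
apply: wp_sto EH E1 _ _ _ => //; [by lia|by lia|].
set a1 := seta _ _ _ _.
have D1 : dst g S A (MO A o) (rcons o u) F a1.
  case: D => H1 H2 H3 H4 H5 H6 H7 H8 H9; split=> //= k; rewrite size_rcons ltnS.
  rewrite leq_eqVlt map_rcons nth_rcons size_map /upd => /predU1P[->|ks].
    by rewrite eqxx ltnn.
  by rewrite ltn_eqF // H5 // ks.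
have [Ok2 E2] := Hx _ _ _ D1.
apply: wp_seq; first exact: (wp_mk (v := u) (b := true) D1 Ok2 _ E2 _ (fun a' H => H)).
rewrite /= MO_rcons => a2 D2; have Ev : eval (EAdd (EReg rH) (ECst 1)) a2 = (size o).+1.
  by rewrite -[LHS]/(eval (EReg rH) a2 + 1) (ev_reg _ D2) gH addn1.
by apply: (wp_asg D2) => //; rewrite Ev; [lia|move=> a' D' _; apply: HQ].
Qed.

Lemma ev_nbF g S A M o F a v j : dst g S A M o F a -> g rv = vid v -> j < d ->
  F v j = adjid v j -> ok (nb j) a /\ eval (nb j) a = adjid v j.
Proof.
move=> D gv jd Fv; have vn := vid_le v; split.
  by apply: ok_arr => //; first by rewrite (ev_reg _ D) gv; lia.
by rewrite -[LHS]/(ar a (qadj j) (eval (EReg rv) a)) (ev_reg _ D) gv (dst_adj D).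
Qed.

Lemma clusterC_wp v g A o F a (Q : astate -> Prop) :
  dst g A A (MO A o) o F a -> g rH = size o -> g rv = vid v ->
  (forall j, j < d -> F v j = adjid v j) ->
  uniq (o ++ v :: nbs e v) ->
  (forall g' a', let o' := o ++ v :: nbs e v in dst g' A A (MO A o') o' F a' ->
     g' rH = size o' -> (forall x, x != rH -> g' x = g x) -> Q a') ->
  wp (clusterC d) Q a.
Proof.
move=> D gH gv Fv uo HQ.
pose oj j := o ++ v :: take j (nbs e v).
have uoj j : uniq (oj j).
  apply: subseq_uniq uo; rewrite cat_subseq // -cat1s -[v :: nbs e v]cat1s.
  by rewrite cat_subseq // take_subseq.
have o0 : oj 0 = rcons o v by rewrite /oj take0 cats1.
apply: wp_cat; apply: (pushC_wp (u := v) D gH).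
- by rewrite -o0.
- by move=> M' o' a' D'; rewrite (ev_reg _ D').
rewrite -o0 => a1 D1.
pose I j a' := exists g', [/\ dst g' A A (MO A (oj j)) (oj j) F a', g' rH = size (oj j)
  & forall x, x != rH -> g' x = g x].
apply: (@wp_sub _ _ _ (I d)).
  by move=> a' [g']; rewrite /oj take_oversize ?size_nbs // => -[D' H1 H2]; apply: HQ D' H1 H2.
apply: wp_for => [j a2 jd [g2 [D2 H1 H2]]|]; last first.
  exists (upd g rH (size (oj 0))); split=> // x nx.
  by rewrite /upd (negbTE nx).
have gv2 : g2 rv = vid v by rewrite H2.
have [Ok2 E2] := ev_nbF D2 gv2 jd (Fv j jd).
apply: wp_if => //; rewrite E2; case: (adjid_cases v j) => [[-> js]|[u [js nu -> _]]] //.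
  have ojS : oj j.+1 = rcons (oj j) u.
    by rewrite /oj (take_nth v) // nu -rcons_cons rcons_cat.
  move=> _; apply: (pushC_wp (u := u) D2 H1).
  - by rewrite -ojS.
  - move=> M' o' a' D'; have [Ok' E'] := ev_nbF D' gv2 jd (Fv j jd).
    by split=> //; rewrite E' /adjid (nth_map v) // nu.
  rewrite -ojS => a' D'; exists (upd g2 rH (size (oj j.+1))); split=> // x nx.
  by rewrite /upd (negbTE nx) H2.
have ojS : oj j.+1 = oj j by rewrite /oj !take_oversize // leqW.
by move=> _; exists g2; rewrite ojS.
Qed.

Definition iso i := [set v : 'I_n | (v < i) && (nbs e v == [::])].
Definition clusters us := flatten [seq u :: nbs e u | u <- us].

(** The last clause is maximality of the family, restricted to the vertices already scanned. *)
Definition scan_st i a := exists g us, let o := clusters us in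
  [/\ dst g (iso i) (iso i) (MO (iso i) o) o (rows i) a,
      [/\ g rV = i, g rP = i * d.+1, g rC = i * st, g rST = st &
        g rK = (2 * B).+1 /\ g rH = size o],
      uniq o, (forall x, x \in o -> nbs e x != [::])
    & (forall v, v < i -> nbs e v != [::] -> v \notin o -> exists2 y, e v y & y \in o)].

Lemma isoS v : iso v.+1 = if nbs e v == [::] then v |: iso v else iso v.
Proof.
apply/setP=> x; have [->|nx] := eqVneq x v.
  by case: ifP => Ev; rewrite !inE ?eqxx ?ltnSn ?ltnn Ev.
have lt : (x < v.+1) = (x < v) by rewrite ltnS leq_eqVlt (negbTE (nx : val x != val v)).
by case: ifP => _; rewrite !inE lt ?(negbTE nx).
Qed.

Lemma scanC_wp v a (Q : astate -> Prop) : scan_st v a ->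
  (forall a', scan_st v.+1 a' -> Q a') -> wp (scanC d) Q a.
Proof.
case=> g [us [D [gV gP gC gST [gK gH]] uo no ho]] HQ; set o := clusters us in D gH uo no ho.
have vn := vid_le v; have nv := ltn_ord v; have X0 : 0 < X by lia.
have E1 : eval (EAdd (EReg rV) (ECst 1)) a = vid v.
  by rewrite -[LHS]/(eval (EReg rV) a + 1) (ev_reg _ D) gV addn1.
apply: wp_cat; apply: (wp_asg D) => //; rewrite E1; first by lia.
move=> a1 D1 _; apply: wp_cat; apply: (readC_wp (v := v) (r := 0) _ D1) => //.
move=> g2 a2 D2 H2 T2; rewrite gm_row //= in T2.
have sX : size (nbs e v) <= X.
  apply: leq_trans (size_nbs e_deg v) _; apply: leq_trans (ltnW X_cells).
  by apply: leq_trans (leqnSn d) (leq_pmull _ _); lia.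
have E2 : eval (EReg rT) a2 = size (nbs e v) by rewrite (ev_reg _ D2).
apply: wp_cat; apply: (wp_asg D2) => //; rewrite E2 //.
move=> a3 D3 _; set g3 := upd g2 rD _ in D3.
have g3E x : x != rT -> x != rD -> x != rv -> g3 x = g x.
  by move=> n1 n2 n3; rewrite /g3 /upd (negbTE n2) H2 // /upd (negbTE n3).
have g3v : g3 rv = vid v by rewrite /g3 /upd /= H2.
have gP3 : g3 rP = v * d.+1 by rewrite g3E.
have gK3 : g3 rK = (2 * B).+1 by rewrite g3E.
apply: wp_cat; apply: (rowC_wp D3 gP3 gK3 g3v (erefl _)).
move=> g4 a4 D4 H4.
have g4E x : x != rT -> x != rD -> x != rv -> g4 x = g x.
  by move=> n1 n2 n3; rewrite H4 // g3E.
have g4v : g4 rv = vid v by rewrite H4.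
have rv_v j : rows v.+1 v j = adjid v j by rewrite /rows ltnSn.
pose mid a' := exists g' us', let o' := clusters us' in
  [/\ dst g' (iso v.+1) (iso v.+1) (MO (iso v.+1) o') o' (rows v.+1) a',
    g' rH = size o' /\ (forall x, x != rT -> x != rD -> x != rv -> x != rH -> g' x = g x),
    uniq o', (forall x, x \in o' -> nbs e x != [::])
  & (forall w, w < v.+1 -> nbs e w != [::] -> w \notin o' -> exists2 y, e w y & y \in o')].
apply: (wp_seq (P := mid)).
  have E4 : eval (EReg rD) a4 = size (nbs e v).
    by rewrite (ev_reg _ D4) H4 // /g3 /upd /=.
  have Ev4 : eval (EReg rv) a4 = vid v by rewrite (ev_reg _ D4).
  apply: wp_if => //; rewrite E4.
    move=> s0; have nv0 : nbs e v != [::] by rewrite -size_eq0.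
    have iE : iso v.+1 = iso v by rewrite isoS (negbTE nv0).
    (* Marks on isolated vertices do not interfere: for any other vertex, being marked means being
       in [o]. *)
    have nM w : nbs e w != [::] -> (w \in MO (iso v) o) = (w \in o).
      by move=> nw; rewrite !inE (negbTE nw) andbF.
    have nbn w : w \in nbs e v -> nbs e w != [::].
      rewrite mem_nbs => evw; have : v \in nbs e w by rewrite mem_nbs e_sym.
      by case: (nbs e w).
    have Ok5 : ok (EArr qMK (EReg rv)) a4 by apply: ok_arr => //; rewrite Ev4; lia.
    have E5 : eval (EArr qMK (EReg rv)) a4 = (v \in o).
      by rewrite -[LHS]/(ar a4 qMK (eval (EReg rv) a4)) Ev4 (dst_mk D4) // memidS nM.
    have nj j : j < d -> ok (EArr qMK (nb j)) a4 /\ eval (EArr qMK (nb j)) a4 =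
        memid (MO (iso v) o) (adjid v j).
      move=> jd; have [Okj Ej] := ev_nbF D4 g4v jd (rv_v j).
      have aj := adjid_le v j; split; first by apply: ok_arr; rewrite ?Ej //; lia.
      by rewrite -[LHS]/(ar a4 qMK (eval (nb j) a4)) Ej (dst_mk D4).
    have Ok6 : ok (sumE (fun j => EArr qMK (nb j)) d) a4.
      by apply: ok_sumE => j jd; case: (nj j jd).
    have E6 : (eval (sumE (fun j => EArr qMK (nb j)) d) a4 == 0) =
        ~~ has (fun w => w \in o) (nbs e v).
      rewrite eval_sumE sum_nat_eq0; apply/forallP/hasPn=> [H w vw|H j].
        move: (vw); rewrite mem_nbs => /adjid_index[j jd ej].
        have := H (Ordinal jd); rewrite /= (proj2 (nj j jd)) ej memidS nM ?nbn //.
        by case: (w \in o).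
      apply/implyP=> _; rewrite (proj2 (nj j _)) //.
      case: (adjid_cases v j) => [[-> _]|[u [_ _ -> evu]]]; first by rewrite memid0.
      by rewrite memidS nM ?(negbTE (H u _)) ?nbn ?mem_nbs.
    apply: wp_if; first exact: ok_add.
      rewrite -[eval _ _]/(eval (EArr qMK (EReg rv)) a4 +
        eval (sumE (fun j => EArr qMK (nb j)) d) a4) addn_eq0 E5 E6 eqb0 negb_and !negbK.
      move=> Hno; exists g4, us; rewrite -/o iE; split=> //.
        by split; [rewrite g4E|move=> x *; apply: g4E].
      move=> w; rewrite ltnS leq_eqVlt => /predU1P[/val_inj->|]; last exact: ho.
      move=> _ nvo; rewrite (negbTE nvo) in Hno; have [y] := hasP Hno.
      by rewrite mem_nbs; exists y.
    rewrite -[eval _ _]/(eval (EArr qMK (EReg rv)) a4 +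
        eval (sumE (fun j => EArr qMK (nb j)) d) a4) => /eqP.
    rewrite addn_eq0 E5 E6 eqb0 => /andP[nvo nno].
    have uo' : uniq (o ++ v :: nbs e v).
      rewrite cat_uniq uo /= mem_nbs e_irr filter_uniq ?enum_uniq // andbT.
      by rewrite negb_or nvo nno.
    apply: (clusterC_wp (v := v) D4 _ g4v _ uo') => //; first by rewrite g4E.
    move=> g5 a5 /= D5 H5 H6; exists g5, (rcons us v).
    have -> : clusters (rcons us v) = o ++ v :: nbs e v.
      by rewrite /clusters -cats1 map_cat flatten_cat /= cats0.
    rewrite iE; split=> //.
    - by split=> // x *; rewrite H6 ?g4E.
    - move=> x; rewrite mem_cat inE => /orP[/no//|/predU1P[->//|/nbn//]].
    - move=> w; rewrite ltnS leq_eqVlt => /predU1P[/val_inj->|wv].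
        by rewrite mem_cat mem_head orbT.
      move=> nw; rewrite mem_cat negb_or => /andP[nwo _].
      by have [y ewy oy] := ho w wv nw nwo; exists y; rewrite // mem_cat oy.
  move=> s0; have v0 : nbs e v = [::] by apply: size0nil.
  have iE : iso v.+1 = v |: iso v by rewrite isoS v0.
  apply: (wp_seq (P := dst g4 (v |: iso v) (iso v) (MO (iso v) o) o (rows v.+1))).
    exact: (wp_in (v := v) (b := true) D4).
  move=> a5 D5; have Ev5 : eval (EReg rv) a5 = vid v by rewrite (ev_reg _ D5).
  apply: (wp_seq (P := dst g4 (v |: iso v) (v |: iso v) (MO (iso v) o) o (rows v.+1))).
    exact: (wp_pr (v := v) (b := true) D5).
  move=> a6 D6; have Ev6 : eval (EReg rv) a6 = vid v by rewrite (ev_reg _ D6).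
  apply: (wp_mk (v := v) (b := true) D6) => // a7; rewrite /= => D7.
  exists g4, us; rewrite -/o iE; split=> //.
  - by rewrite /MO -setUA.
  - by split; [rewrite g4E|move=> x *; apply: g4E].
  - move=> w; rewrite ltnS leq_eqVlt => /predU1P[/val_inj->|]; last exact: ho.
    by rewrite v0.
move=> a5 [g5 [us5 [D5 [H5 H6] u5 n5 h5]]].
have E6 : eval (EAdd (EReg rV) (ECst 1)) a5 = v.+1.
  by rewrite -[LHS]/(eval (EReg rV) a5 + 1) (ev_reg _ D5) H6 // gV addn1.
apply: wp_cat; apply: (wp_asg D5) => //; rewrite E6; first by lia.
move=> a6 D6 _.
have E7 : eval (EAdd (EReg rP) (ECst d.+1)) a6 = v.+1 * d.+1.
  by rewrite -[LHS]/(eval (EReg rP) a6 + d.+1) (ev_reg _ D6) /upd /= H6 // gP mulSn addnC.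
apply: wp_cat; apply: (wp_asg D6) => //; rewrite E7.
  by apply: leq_trans (ltnW X_cells); rewrite leq_mul2r nv orbT.
move=> a7 D7 _.
have E8 : eval (EAdd (EReg rC) (EReg rST)) a7 = v.+1 * st.
  rewrite -[LHS]/(eval (EReg rC) a7 + eval (EReg rST) a7) !(ev_reg _ D7) /upd /=.
  by rewrite !H6 // gC gST mulSn addnC.
apply: (wp_asg D7) => //; rewrite E8; first by rewrite X_st leq_mul2r nv orbT.
move=> a8 D8 _; apply: HQ; eexists; exists us5; split; first exact: D8.
- by split; rewrite /upd //= ?(H6 rST) ?(H6 rK) // H5.
- by [].
- by [].
- by [].
Qed.

Definition rest_st us i a := exists g left, let o := clusters us ++ left in
  [/\ dst g (iso n) (iso n) (MO (iso n) o) o (rows n) a,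
      [/\ g rV = n, g rv = i & g rH = size o],
      uniq o, (forall v, v < i -> v \in MO (iso n) o)
    & (forall x, x \in left -> nbs e x != [::] /\ exists2 y, e x y & y \in clusters us)].

(** A vertex still unmarked after the scan is not isolated and lies in no cluster, so maximality of
    the family supplies the neighbour that the count of [left] relies on. *)
Lemma restC_wp us v a (Q : astate -> Prop) :
  (forall v, nbs e v != [::] -> v \notin clusters us -> exists2 y, e v y & y \in clusters us) ->
  rest_st us v a -> (forall a', rest_st us v.+1 a' -> Q a') -> wp restC Q a.
Proof.
move=> Hus [g [left [D [gV gv gH] uo co Hl]]] HQ; set o := _ ++ left in D gH uo co.
have vn := vid_le v.
have E1 : eval (EAdd (EReg rv) (ECst 1)) a = vid v.
  by rewrite -[LHS]/(eval (EReg rv) a + 1) (ev_reg _ D) gv addn1.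
apply: wp_cat; apply: (wp_asg D) => //; rewrite E1; first by lia.
move=> a1 D1 _; set g1 := upd g rv _ in D1.
have Ev : eval (EReg rv) a1 = vid v by rewrite (ev_reg _ D1).
have E2 : eval (EArr qMK (EReg rv)) a1 = (v \in MO (iso n) o).
  by rewrite -[LHS]/(ar a1 qMK (eval (EReg rv) a1)) Ev (dst_mk D1) // memidS.
apply: wp_if; first by apply: ok_arr => //; rewrite Ev; lia.
  rewrite E2 => Mv; apply: HQ; exists g1, left; split=> //.
  move=> w; rewrite ltnS leq_eqVlt => /predU1P[/val_inj->|/co//].
  by move: Mv; case: (_ \in _).
rewrite E2 => nMv'; have nMv : v \notin MO (iso n) o by case: (v \in _) nMv'.
have nv : nbs e v != [::] by move: nMv; rewrite !inE ltn_ord => /norP[].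
have nvo : v \notin o by move: nMv; rewrite !inE => /norP[].
have uo' : uniq (rcons o v) by rewrite rcons_uniq nvo.
apply: (pushC_wp (u := v) D1) => //.
  by move=> M' o' a' D'; rewrite (ev_reg _ D').
move=> a2 D2; apply: HQ; eexists; exists (rcons left v).
rewrite -rcons_cat -/o; split; first exact: D2.
- by split.
- by [].
- move=> w; rewrite ltnS leq_eqVlt -MO_rcons in_setU1 => /predU1P[/val_inj->|/co->].
    by rewrite eqxx.
  by rewrite orbT.
- move=> x; rewrite mem_rcons inE => /predU1P[->|/Hl//]; split=> //.
  by apply: Hus => //; move: nvo; rewrite mem_cat => /norP[].
Qed.

End Scan.

End Correctness.

(** * Setting up the memory layout *)

Section Boot.

Variable B : nat.

(* Doubling cell 0 moves it past the input, whose first cells are then saved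
   from there on, with cell 1 as scratch space. *)
Definition boot (W Lz : nat) : seq instr :=
  IJz 0 Lz :: flatten [seq [:: IAdd 0 0 0] | i <- iota 0 W] ++ IStore 0 1 ::
  flatten [seq [:: IConst 1 1; IAdd 0 0 1; IStore 0 i.+2] | i <- iota 0 (2 * B).-1] ++
  [:: IConst 1 (2 * B).-1, ISub 0 0 1 &
   flatten [seq [:: IConst i.+1 0] | i <- iota 0 (2 * B)]] ++
  [:: IConst rST.+1 (2 ^ W); IConst rK.+1 (2 * B).+1].

Variables (p : seq instr) (n X W Lz : nat) (gm : nat -> nat).
Hypotheses (n0 : 0 < n) (XW : X = 2 ^ W * n) (KX : (2 * B).+1 <= X) (B13 : 13 < B).
Hypotheses (gm0 : gm 0 = n) (gm_lt : forall c, gm c < X) (gm_out : forall c, X <= c -> gm c = 0).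

Let go := go B p X.

(** Sharper than [good]: the copies end at cell [X + 2 * B - 1], which is below [2 * X]. *)
Definition small m := (forall c, m c <= 2 * X) /\ forall c, 2 * X <= c -> m c = 0.

Lemma small_good m : small m -> good B X m.
Proof.
case=> H1 H2; have : 2 * X <= B * X by [rewrite leq_mul2r; lia].
have : 2 * X <= 2 * B * X by rewrite leq_mul2r; lia.
by move=> L1 L2; split=> c; [apply: leq_trans (H1 c) L1 | move/(leq_trans L2)/H2].
Qed.

Lemma small_upd m c v : small m -> c < 2 * X -> v <= 2 * X -> small (upd m c v).
Proof.
case=> H1 H2 cX vX; split=> x; rewrite /upd; case: (x =P c) => [Ex|_] //; first by lia.
exact: H2.
Qed.

Lemma go_small m b i m' : nth IHalt p b = i -> silent i -> small m ->
  step p (St b m) = St b.+1 m' -> go (St b m) 1 (St b.+1 m').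
Proof. by move=> C Si Sm <-; apply: (go1 C Si); apply: small_good. Qed.

Lemma go_flatten (blk : nat -> seq instr) (I : nat -> (nat -> nat) -> Prop) b m k :
  I 0 m -> code_at p b (flatten [seq blk i | i <- iota 0 k]) ->
  (forall i m b, i < k -> I i m -> code_at p b (blk i) ->
    exists m', go (St b m) (size (blk i)) (St (b + size (blk i)) m') /\ I i.+1 m') ->
  let l := size (flatten [seq blk i | i <- iota 0 k]) in
  exists m', go (St b m) l (St (b + l) m') /\ I k m'.
Proof.
move=> I0 C Hs /=; elim: k C Hs => [|k IH] C Hs.
  by exists m; rewrite addn0; split=> //; apply: go0.
have E : [seq blk i | i <- iota 0 k.+1] = rcons [seq blk i | i <- iota 0 k] (blk k).
  by rewrite -map_rcons -cats1 -addn1 iotaD.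
rewrite E flatten_rcons in C *; have [C1 C2] := code_cat C.
have [i m1 b1 ik|m1 [G1 I1]] := IH C1; first by apply: Hs; apply: ltnW.
have [m2 [G2 I2]] := Hs k m1 _ (ltnSn k) I1 C2.
exists m2; rewrite size_cat addnA; split=> //; exact: go_trans G1 G2.
Qed.

Definition astate0 := AState (upd (upd (fun=> 0) rST (2 ^ W)) rK (2 * B).+1)
  (fun q i => if q == 0 then (if 2 * B < i < X then gm i else 0)
    else if q == 1 then (if i < 2 * B then gm i.+1 else 0) else 0).

Lemma boot_go : code_at p 0 (boot W Lz) ->
  exists m, go (St 0 gm) (size (boot W Lz)) (St (size (boot W Lz)) m) /\ rep B X astate0 m.
Proof.
move=> C; have X0 : 0 < X by lia.
have [C1 C2] := code_cons C; have [C3 C4] := code_cat C2.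
have [C5 C6] := code_cons C4; have [C7 C8] := code_cat C6.
have [C9 C10] := code_cat C8; have [C11 C12] := code_cons C9.
have [C13 C14] := code_cons C12; have [C15 C16] := code_cons C10.
have [C17 _] := code_cons C16; rewrite {C C2 C4 C6 C8 C9 C10 C12 C16}.
have g0 : small gm by split=> c; [have := gm_lt c; lia | move=> Hc; apply: gm_out; lia].
have G1 : go (St 0 gm) 1 (St 1 gm).
  by apply: (go_small C1) => //; rewrite /= C1 gm0; case: (n) n0.
pose I1 i m := [/\ small m, m 0 = 2 ^ i * n & forall c, c != 0 -> m c = gm c].
have iW i : i <= W -> 2 ^ i * n <= X by move=> iW; rewrite XW leq_mul2r leq_pexp2l ?orbT.
have [||m1 [G2 [S1 E1 F1]]] := go_flatten (I := I1) (m := gm) _ C3.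
- by split=> //; rewrite expn0 mul1n.
- move=> i m b iWW [Sm Em Fm] Ci; have [Cii _] := code_cons Ci.
  have Ev : m 0 + m 0 = 2 ^ i.+1 * n by rewrite Em expnS -mulnA mul2n addnn.
  exists (upd m 0 (2 ^ i.+1 * n)); rewrite addn1; split.
    by apply: (go_small Cii) => //; rewrite /= Cii Ev.
  split=> //; first by apply: small_upd => //; [lia|have := iW _ iWW; lia].
  by move=> c nc; rewrite /upd (negbTE nc) Fm.
rewrite -XW in E1; move: G2; set l1 := size _ => G2; rewrite -/l1 in C5 C7 C11 C13 C14 C15 C17.
pose m2 := upd m1 X (gm 1).
have G3 : go (St (1 + l1) m1) 1 (St (1 + l1).+1 m2).
  by apply: (go_small C5) => //; rewrite /= C5 E1 F1.
(* Cell 0 points to the latest copy. Cell 1 is exempt from the invariant, hence [2 <= j]: its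
   content has been saved and it now holds the increment. *)
pose I2 i m := [/\ small m, m 0 = X + i, forall j, 2 <= j < X -> m j = gm j,
  forall j, j < i.+1 -> m (X + j) = gm j.+1 & forall c, X + i.+1 <= c -> m c = 0].
have [||m3 [G4 [S3 E3 F3 H3 Z3]]] := go_flatten (I := I2) (m := m2) _ C7.
- split=> //.
  + by apply: small_upd => //; [lia|have := gm_lt 1; lia].
  + by rewrite /m2 /upd ifN ?addn0 //; lia.
  + by move=> j Hj; rewrite /m2 /upd ifN ?F1 //; lia.
  + by case=> // _; rewrite addn0 /m2 /upd eqxx.
  + by move=> c Hc; rewrite /m2 /upd ifN ?F1 ?gm_out //; lia.
- move=> i m b iB [Sm Em Fm Hm Zm] Ci.
  have [D1 /code_cons[D2 /code_cons[D3 _]]] := code_cons Ci.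
  pose u1 := upd m 1 1; pose u2 := upd u1 0 (X + i.+1).
  pose u3 := upd u2 (X + i.+1) (gm i.+2).
  have Su1 : small u1 by apply: small_upd => //; lia.
  have Su2 : small u2 by apply: small_upd => //; lia.
  have Su3 : small u3 by apply: small_upd => //; [lia|have := gm_lt i.+2; lia].
  have g1 : go (St b m) 1 (St b.+1 u1) by apply: (go_small D1) => //; rewrite /= D1.
  have g2 : go (St b.+1 u1) 1 (St b.+2 u2).
    apply: (go_small D2) => //; rewrite /= D2; congr St; rewrite /u2; congr upd.
    by rewrite /u1 /upd /= Em addn1 addnS.
  have g3 : go (St b.+2 u2) 1 (St b.+3 u3).
    apply: (go_small D3) => //; rewrite /= D3; congr St; rewrite /u3; congr upd.
    by rewrite /u2 /u1 /upd /= Fm //; lia.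
  exists u3; rewrite addn3; split; first exact: go_trans (go_trans g1 g2) g3.
  have uE c : u3 c = if c == X + i.+1 then gm i.+2 else if c == 0 then X + i.+1
      else if c == 1 then 1 else m c by [].
  split=> //.
  + by rewrite uE ifN //; lia.
  + by move=> j Hj; rewrite uE !ifN ?Fm //; lia.
  + move=> j; rewrite ltnS leq_eqVlt => /predU1P[->|ji]; rewrite uE; first by rewrite eqxx.
    by rewrite !ifN ?Hm //; lia.
  + by move=> c Hc; rewrite uE !ifN ?Zm //; lia.
move: G4; set l2 := size _ => G4; rewrite -/l2 in C11 C13 C14 C15 C17.
set b5 := _ + l2 in G4 C11 C13 C14 C15 C17.
pose m4 := upd m3 1 (2 * B).-1; pose m5 := upd m4 0 X.
have B0 : (2 * B).-1.+1 = 2 * B by lia.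
rewrite B0 in H3 Z3.
have S4 : small m4 by apply: small_upd => //; lia.
have S5 : small m5 by apply: small_upd => //; lia.
have G5 : go (St b5 m3) 1 (St b5.+1 m4) by apply: (go_small C11) => //; rewrite /= C11.
have G6 : go (St b5.+1 m4) 1 (St b5.+2 m5).
  apply: (go_small C13) => //; rewrite /= C13; congr St; rewrite /m5; congr upd.
  by rewrite /m4 /upd /= E3; lia.
pose I3 i m := [/\ small m, m 0 = X, forall j, 2 * B < j < X -> m j = gm j,
  forall j, j < 2 * B -> m (X + j) = gm j.+1
  & (forall c, X + 2 * B <= c -> m c = 0) /\ forall j, j < i -> m j.+1 = 0].
have [||m6 [G7 [S6 E6 F6 H6 [Z6 Y6]]]] := go_flatten (I := I3) (m := m5) _ C14.
- have uE c : m5 c = if c == 0 then X else if c == 1 then (2 * B).-1 else m3 c by [].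
  split=> //.
  + by move=> j Hj; rewrite uE !ifN ?F3 //; lia.
  + by move=> j Hj; rewrite uE !ifN ?H3 //; lia.
  + by split=> // c Hc; rewrite uE !ifN ?Z3 //; lia.
- move=> i m b iB [Sm Em Fm Hm [Zm Ym]] Ci; have [Cii _] := code_cons Ci.
  exists (upd m i.+1 0); rewrite addn1; split.
    by apply: (go_small Cii) => //; rewrite /= Cii.
  split=> //; first by apply: small_upd => //; lia.
  + by move=> j Hj; rewrite /upd ifN ?Fm //; lia.
  + by move=> j Hj; rewrite /upd ifN ?Hm //; lia.
  + split=> [c Hc|j ji]; first by rewrite /upd ifN ?Zm //; lia.
    by rewrite /upd; case: eqP => // nj; apply: Ym; lia.
move: G7; set l3 := size _ => G7; set b7 := _ + l3 in G7.
have e7 : 1 + l1.+1 + l2 + l3.+2 = b7 by rewrite /b7 /b5; lia.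
have st_le : 2 ^ W <= X by rewrite XW leq_pmulr.
pose m7 := upd m6 rST.+1 (2 ^ W); pose m8 := upd m7 rK.+1 (2 * B).+1.
have S7 : small m7 by apply: small_upd => //; lia.
have S8 : small m8 by apply: small_upd => //; lia.
have C15' : nth IHalt p b7 = IConst rST.+1 (2 ^ W).
  by rewrite -C15 /b7 /b5; congr nth; rewrite /l3 /=; lia.
have C17' : nth IHalt p b7.+1 = IConst rK.+1 (2 * B).+1.
  by rewrite -C17 /b7 /b5; congr nth; rewrite /l3 /=; lia.
have G8 : go (St b7 m6) 1 (St b7.+1 m7) by apply: (go_small C15') => //; rewrite /= C15'.
have G9 : go (St b7.+1 m7) 1 (St b7.+2 m8) by apply: (go_small C17') => //; rewrite /= C17'.
exists m8; split.
  have Es : size (boot W Lz) = b7.+2.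
    by rewrite /boot /= size_cat /= size_cat /= size_cat -/l1 -/l2 -/l3 /= /b7 /b5; lia.
  have G14 := go_trans (go_trans (go_trans G1 G2) G3) G4.
  have G19 := go_trans (go_trans (go_trans (go_trans (go_trans G14 G5) G6) G7) G8) G9.
  rewrite Es; apply: go_eq G19 _ _ => //.
  by rewrite /b7 /b5; lia.
have uE c : m8 c = if c == 13 then (2 * B).+1 else if c == 3 then 2 ^ W else m6 c by [].
split=> //=.
- move=> r rB; rewrite uE /upd !eqSS; case: eqP => // _; case: eqP => // _.
  by apply: Y6; lia.
- move=> q i qB iX Hi; have -> : m8 (q * X + i) = m6 (q * X + i) by rewrite uE !ifN //; lia.
  case: q qB Hi => [|[|q]] qB Hi /=.
  + by rewrite mul0n add0n in Hi *; rewrite F6 ?Hi ?iX.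
  + rewrite mul1n; case: ifP => iB; first exact: H6.
    by apply: Z6; lia.
  + by apply: Z6; rewrite !mulSn; lia.
- by move=> r; rewrite /upd; case: eqP => // _; case: eqP.
- move=> q i; case: ifP => _; first by case: ifP.
  by case: ifP => // _; case: ifP.
- exact: small_good.
Qed.

End Boot.

(** Has the shape of [mis_constant] and serves both time and delay; additive constants are absorbed
    because [s] is positive, and the doubled coefficients are slack. *)
Lemma linear_bound t p c1 i1 c2 i2 q z w s : 0 < s ->
  t <= p + c1 * s + i1 + c2 * s + i2 -> w <= q * s ->
  t + w <= (p + 2 * c1 + i1 + 2 * c2 + i2 + q + z + 2) * s.
Proof.
move=> s0 Ht Hw; have := leq_pmulr p s0; have := leq_pmulr i1 s0.
have := leq_pmulr i2 s0; lia.
Qed.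

(** * The assembled program, its constants and the final bounds *)

Section Enumeration.

Variable d : nat.

Definition start_rest := CAsg rv (ECst 0).
Definition start_dfs := CAsg rN (EReg rH) ;; CAsg rU (ECst 0).

(** The sum of all weights, so that one bound serves every piece; the 20 makes room for the
    registers set by the boot code and for the array that is output. *)
Definition Bd := ewt scan_cond + cwt (scanC d) + cwt start_rest + ewt rest_cond +
  cwt restC + cwt start_dfs + ewt dfs_cond + cwt (dfsC d) + 20.
(** Since [2 ^ Wd] exceeds [Wd], the stride [n * 2 ^ Wd] exceeds both the [2 * Bd + 1] reserved
    cells and the last input address [n * d.+1]. *)
Definition Wd := 2 * Bd + d + 3.

Let loop := compL Bd qIN.
Let lsz := lsize Bd qIN.

(** The jump target does not affect the length of the code; the placeholder 0 avoids a circular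
    definition, as the true target depends on [pos1]. *)
Definition pos1 := size (boot Bd Wd 0).
Definition pos2 := pos1 + lsz scan_cond (scanC d) (ECst 0).
Definition pos3 := pos2 + csize Bd start_rest.
Definition pos4 := pos3 + lsz rest_cond restC (ECst 0).
Definition pos5 := pos4 + csize Bd start_dfs.
Definition pos6 := pos5 + lsz dfs_cond (dfsC d) (EReg rFL).

(* The final output instruction serves only the graph without vertices. *)
Definition mis_program : seq instr :=
  boot Bd Wd pos6.+1 ++ loop scan_cond (scanC d) (ECst 0) pos1 ++
  compC Bd start_rest pos2 ++ loop rest_cond restC (ECst 0) pos3 ++
  compC Bd start_dfs pos4 ++ loop dfs_cond (dfsC d) (EReg rFL) pos5 ++
  [:: IHalt; IOut 0].

Definition levelC := d.+1 * (growth d).+1 + (d.+1 * d).+1 * growth d.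

(** In the factor of the search loop, [2 * levelC] pays for all nodes, and 10 for the exit test and
    for the delay [2 * n + 4]. The term [2 * Bd * 2 ^ Wd] bounds memory, and the last 2 pays for the
    run on the empty graph. *)
Definition mis_constant :=
  pos1 + 2 * lsz scan_cond (scanC d) (ECst 0) + csize Bd start_rest +
  2 * lsz rest_cond restC (ECst 0) + csize Bd start_dfs +
  lsz dfs_cond (dfsC d) (EReg rFL) * (2 * levelC + 10) + 2 * Bd * 2 ^ Wd + 2.

Local Notation p := mis_program.
Local Notation C := mis_constant.
Local Arguments mis_program : simpl never.

Lemma size_boot Lz : size (boot Bd Wd Lz) = pos1.
Proof. by []. Qed.

Lemma mis_program_code : [/\ code_at p 0 (boot Bd Wd pos6.+1),
  code_at p pos1 (loop scan_cond (scanC d) (ECst 0) pos1),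
  code_at p pos2 (compC Bd start_rest pos2),
  code_at p pos3 (loop rest_cond restC (ECst 0) pos3) &
  [/\ code_at p pos4 (compC Bd start_dfs pos4),
    code_at p pos5 (loop dfs_cond (dfsC d) (EReg rFL) pos5),
    nth IHalt p pos6 = IHalt, nth IHalt p pos6.+1 = IOut 0 & size p = pos6.+2]].
Proof.
have C0 : code_at p 0 p by [].
have [D1 E1] := code_cat C0; rewrite size_boot add0n in E1.
have [D2 E2] := code_cat E1; rewrite size_compL -/lsz -/pos2 in E2.
have [D3 E3] := code_cat E2; rewrite size_compC -/pos3 in E3.
have [D4 E4] := code_cat E3; rewrite size_compL -/lsz -/pos4 in E4.
have [D5 E5] := code_cat E4; rewrite size_compC -/pos5 in E5.
have [D6 E6] := code_cat E5; rewrite size_compL -/lsz -/pos6 in E6.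
have [H1 /code_cons[H2 _]] := code_cons E6.
split=> //; split=> //.
rewrite /mis_program; do 6! rewrite size_cat; rewrite size_boot !size_compL !size_compC.
by rewrite -/lsz /pos6 /pos5 /pos4 /pos3 /pos2 /=; lia.
Qed.

Lemma mis_constantE : C =
  pos1 + 2 * lsz scan_cond (scanC d) (ECst 0) + csize Bd start_rest +
  2 * lsz rest_cond restC (ECst 0) + csize Bd start_dfs +
  lsz dfs_cond (dfsC d) (EReg rFL) * (2 * levelC + 10) + 2 * Bd * 2 ^ Wd + 2.
Proof. by []. Qed.

Lemma mis_constant_ge2 : 2 <= C.
Proof. exact: leq_addl. Qed.

Lemma Bd13 : 13 < Bd.
Proof. by rewrite /Bd; lia. Qed.

Lemma Bd_weights : [/\ ewt scan_cond <= Bd, cwt (scanC d) <= Bd, cwt start_rest <= Bd,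
  ewt rest_cond <= Bd & [/\ cwt restC <= Bd, cwt start_dfs <= Bd, ewt dfs_cond <= Bd &
  cwt (dfsC d) <= Bd]].
Proof. by rewrite /Bd; split; [| | | |split]; lia. Qed.

Lemma Wd_big : 2 * Bd + d + 3 < 2 ^ Wd.
Proof. exact: ltn_expl. Qed.

#[local] Opaque mis_program mis_constant Bd Wd pos1 pos6.

Lemma stepE b m : step p (St b m) = match nth IHalt p b with
  | IJz a t => if m a == 0 then St t m else St b.+1 m
  | IOut _ => St b.+1 m
  | _ => step p (St b m) end.
Proof. by rewrite /step; case: (nth IHalt p b). Qed.

Section Empty.

Variable e : rel 'I_0.

(** For [n = 0] the stride would be 0. The first instruction therefore jumps to an output, which
    yields the empty set, and the next address is outside the program, so the machine halts. *)
Lemma lists_empty k : lists_all_mis d p C k e.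
Proof.
have [Cb _ _ _ [_ _ _ Lz sp]] := mis_program_code.
have g0 c : graph_mem d e c = 0.
  by rewrite /graph_mem; case: eqP => // _; case: insubP => // -[].
have [P0 _] := code_cons Cb.
have e1 : exec p (St 0 (graph_mem d e)) 1 = St pos6.+1 (graph_mem d e).
  by rewrite -[LHS]/(step p (St 0 _)) stepE P0 g0.
have e2 : exec p (St 0 (graph_mem d e)) 2 = St pos6.+2 (graph_mem d e).
  by rewrite -[2]/(1 + 1) execD e1 -[LHS]/(step p (St _ _)) stepE Lz.
have Send : nth IHalt p pos6.+2 = IHalt by rewrite nth_default ?sp.
have Sall (S : {set 'I_0}) : S = set0 by apply/setP=> -[].
have mall S : mis e S.
  by rewrite misE; [apply/misinP; split; [apply/subsetP=> -[]|case]|case|case].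
have C2 := mis_constant_ge2.
have memE t : t <= 2 -> Defs.mem (exec p (St 0 (graph_mem d e)) t) =1 graph_mem d e.
  by case: t => [|[|[|//]]] _ c; rewrite ?e1 ?e2.
exists 2; split; first by rewrite /halted e2 /= Send.
split; first by case=> [|[|//]] _; rewrite /halted ?e1 /= ?P0 ?Lz.
have -> : [seq t <- iota 0 2 | is_out p (exec p (St 0 (graph_mem d e)) t)] = [:: 1].
  have O0 : is_out p (exec p (St 0 (graph_mem d e)) 0) = false by rewrite /is_out /= P0.
  have O1 : is_out p (exec p (St 0 (graph_mem d e)) 1) by rewrite e1 /is_out /= Lz.
  by cbn [filter iota]; rewrite O0 O1.
rewrite /=; split=> //; split; [|split; [|split; [|split]]].
- by move=> S; rewrite inE mall [S]Sall eq_sym; apply/eqP/Sall.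
- apply: leq_trans C2 _; rewrite add0n leq_pmulr //; apply/card_gt0P.
  by exists set0; rewrite inE mall.
- by rewrite exp1n muln1 andbT; lia.
- by move=> t a t2 _; rewrite memE ?g0.
- by move=> t a t2; rewrite memE ?g0.
Qed.

End Empty.

Section NonEmpty.

Variables (n : nat) (e : rel 'I_n).
Hypotheses (e_sym : symmetric e) (e_irr : irreflexive e) (e_deg : max_degree_le e d).
Hypothesis n_gt0 : 0 < n.

Let st := 2 ^ Wd.
Let X := n * st.
Let gm := graph_mem d e.

Lemma st_big : 2 * Bd + d + 3 < st.
Proof. exact: Wd_big. Qed.

Lemma st_gt0 : 0 < st. Proof. by have := st_big; lia. Qed.
Lemma st_X : st <= X. Proof. by rewrite /X leq_pmull. Qed.
Lemma X_K : (2 * Bd).+1 <= X. Proof. by have := st_big; have := st_X; lia. Qed.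
Lemma X_n : n < X. Proof. by have := st_big; rewrite /X; nia. Qed.
Lemma X_cells : n * d.+1 < X.
Proof. by rewrite /X ltn_pmul2l //; have := st_big; lia. Qed.

Let KX := X_K.
Let nX := X_n.

Lemma gm_lt c : gm c < X.
Proof.
rewrite /gm; case: c => [|c]; first exact: nX.
have [|lt] := leqP n (c %/ d.+1).
  by move=> H; rewrite /graph_mem /= insubN -?leqNgt //; have := nX; lia.
have := gm_row_le e_deg KX nX st_gt0 (erefl _) X_cells (Ordinal lt)
  (r := c %% d.+1); rewrite /= addnS -divn_eq; apply.
by rewrite -ltnS ltn_pmod.
Qed.

Lemma gm_out c : X <= c -> gm c = 0.
Proof.
case: c => [|c] Xc; first by have := nX; lia.
rewrite /gm /graph_mem /= insubN // -leqNgt leq_divRL //.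
by have := X_cells; lia.
Qed.

Lemma scan_init : scan_st d e Bd X st 0 (astate0 Bd X Wd gm).
Proof.
exists (upd (upd (fun=> 0) rST st) rK (2 * Bd).+1), [::].
have z S : S = set0 :> {set 'I_n} -> rarr (fun=> 0) S.
  move=> -> x xn; rewrite /memid; case: existsP => // -[v].
  by rewrite inE andbF.
have i0 : iso e 0 = set0 by apply/setP=> v; rewrite !inE.
have m0 : MO (iso e 0) [::] = set0 by rewrite /MO i0 set0U; apply/setP=> v; rewrite !inE.
split=> //; split=> //=.
- exact: z.
- exact: z.
- exact: z.
- by move=> x ->.
- by move=> x ->.
Qed.

Lemma rows_n v j : rows e n v j = adjid e v j.
Proof. by rewrite /rows ltn_ord. Qed.

Lemma dst_rows g S A M o a :
  dst d e Bd X g S A M o (rows e n) a -> dst d e Bd X g S A M o (adjid e) a.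
Proof. by case=> *; split=> // v j jd; rewrite -rows_n; auto. Qed.

Definition clusters_ok us :=
  (forall v, nbs e v != [::] -> v \notin clusters e us ->
     exists2 y, e v y & y \in clusters e us) /\
  (forall u, u \in us -> nbs e u != [::]) /\
  (forall x, x \in clusters e us -> nbs e x != [::]).

Lemma start_rest_wp a : scan_st d e Bd X st n a ->
  cmd_wp Bd X start_rest (fun a' => exists2 us, clusters_ok us & rest_st d e Bd X us 0 a') a.
Proof.
case=> g [us [D [gV _ _ _ [_ gH]] uo no ho]].
apply: (wp_asg D) => // a' D' _; exists us.
  split; first by move=> v; apply: ho.
  split=> // u us_u; apply: no; apply/flatten_mapP; exists u => //.
  exact: mem_head.
exists (upd g rv 0), [::]; rewrite cats0; split=> //.
Qed.

Definition order_ok us left :=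
  let o := clusters e us ++ left in
  [/\ clusters_ok us, uniq o, iso e n :|: [set x in o] = setT
  & forall x, x \in left -> nbs e x != [::] /\ exists2 y, e x y & y \in clusters e us].

Lemma start_dfs_wp us a : clusters_ok us -> rest_st d e Bd X us n a ->
  cmd_wp Bd X start_dfs (fun a' => exists left g, let o := clusters e us ++ left in
    order_ok us left /\
    dfs_st d e Bd X (iso e n) (MO (iso e n) o) o (DState false (size o) (iso e n)) g a') a.
Proof.
move=> cu [g [left [D [gV gv gH] uo co Hl]]]; set o := _ ++ left in D gH uo co.
have so : size o <= n by apply: size_o.
apply: wp_cat; apply: (wp_asg D) => //; first by rewrite (ev_reg _ D) gH; have := nX; lia.
move=> a1 D1 _; apply: (wp_asg D1) => // a2 D2 _.
exists left, (upd (upd g rN (expr_val X (EReg rH) a)) rU 0); split; last first.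
  split; [|exact: gH|by []|by rewrite /upd /= -gH -(ev_reg _ D)].
  rewrite /= (_ : lv (iso e n) o (size o) = iso e n); first exact: dst_rows D2.
  by apply/setP=> x; rewrite !inE drop_size in_nil orbF.
split=> //; apply/setP=> v; rewrite [RHS]inE; exact: co (ltn_ord v).
Qed.

Let s0 := St 0 gm.

(** An instance of [loop_run] that never outputs. The gap bound is chosen as the whole elapsed time,
    hence trivial; the preprocessing is charged to the first delay later. *)
Lemma silent_loop c body b (I : nat -> astate -> Prop) k t m a :
  ewt c <= Bd -> cwt body <= Bd -> code_at p b (loop c body (ECst 0) b) ->
  (forall i a, i < k -> I i a ->
     [/\ expr_ok Bd X c a, expr_val X c a != 0 & cmd_wp Bd X body (I i.+1) a]) ->
  (forall a, I k a -> expr_ok Bd X c a /\ expr_val X c a = 0) ->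
  conf Bd p X (n := n) s0 t (St b m) [::] -> rep Bd X a m -> I 0 a ->
  exists t' m' a', [/\ rep Bd X a' m', I k a', t' <= t + lsz c body (ECst 0) * k.+1 &
    conf Bd p X (n := n) s0 t' (St (b + lsz c body (ECst 0)) m') [::]].
Proof.
move=> wc wb Cb Hb He Cf R I0; set l := lsz _ _ _; have B13 := Bd13.
have q2 : 0 < 2 < Bd by lia.
have w2 : 2 * 2 + 2 <= Bd by lia.
have w1 : ewt (ECst 0) <= Bd by rewrite /=; lia.
have Tm : timely (n := n) (t + l * k.+1) (l * (k - 0)) [::] t.
  by split=> //=; rewrite !subn0 leq_add2l leq_mul2l leqnSn orbT.
have [|||||t' [m' [a' [L' [[R' I'] T' Cf' S' _]]]]] := loop_run KX nX q2 w2 wc wb w1 Cb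
  (I := I) (k := k) (out := pred0) (os := fun=> set0)
  (pot := fun i => k - i) (P := k) _ He _ _ _ _ Cf R I0 Tm.
- move=> i a1 ik Ia; have [Ok Ev W] := Hb i a1 ik Ia; split=> //.
  by apply: wp_sub W => a2 I2; split.
- by move=> i ik _; lia.
- by move=> i ik; lia.
- by move=> i _; lia.
- exact: leq_addl.
exists t', m', a'; split=> //.
have L0 : L' = [::] by move: S'; rewrite filter_pred0; case: (L').
by move: Cf'; rewrite L0.
Qed.

Section Search.

Variables (us left : seq 'I_n) (v0 : 'I_n).
Hypothesis o_ok : order_ok us left.

Let o := clusters e us ++ left.
Let A0 := iso e n.
Let x0 := DState false (size o) A0.
Let x i := iter i (dstep e A0 o v0) x0.

Lemma order_notin y : y \in o -> y \notin A0.
Proof.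
have [[_ [_ H1]] _ _ H2] := o_ok.
rewrite mem_cat inE ltn_ord => /orP[/H1//|/H2[]//].
Qed.

(** Isolated vertices are never dominated, so the set [A0] of all of them is its own only maximal
    independent subset: the root of the tree. *)
Lemma misin_A0 S : misin e A0 S = (S == A0).
Proof.
have f T w : w \in A0 -> free e T w.
  rewrite inE => /andP[_ /eqP nw]; apply/freeP=> u _; rewrite -mem_nbs nw.
  by rewrite in_nil.
apply/idP/eqP=> [mS|->]; last by apply: indep_misin => //; apply/indepP=> w; apply: f.
apply/eqP; rewrite eqEsubset; apply/andP; split; apply/subsetP=> w.
  exact: misin_sub mS w.
by move=> Aw; apply: misin_in mS Aw (f _ _ Aw).
Qed.

Lemma order_level_sum :
  \sum_(h < (size o).+1) nmis e (lv A0 o h) <= levelC * nmis e setT.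
Proof.
have [[_ [H1 _]] uo eT Hl] := o_ok; rewrite -eT.
apply: (level_sum e_sym e_irr e_deg uo order_notin H1) => y /Hl[_ [z eyz zc]].
by exists z; rewrite // e_sym.
Qed.

Lemma x_valid i : dvalid e A0 o (x i).
Proof.
have [_ uo _ _] := o_ok.
elim: i => [|i IH]; last by apply: dstep_valid => //; exact: order_notin.
rewrite /dvalid /= leqnn andbT (_ : lv A0 o (size o) = A0) ?misin_A0 //.
by apply/setP=> y; rewrite !inE drop_size in_nil orbF.
Qed.

Lemma x_pot i : dpot o (x i) <= 2 * n + 1.
Proof.
have [_ uo _ _] := o_ok; have so : size o <= n by apply: size_o.
have /andP[_ hN] := x_valid i.
by rewrite /dpot; case: ifP => _; lia.
Qed.

Lemma dfs_step_wp M i g a : ~~ dfinal o (x i) ->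
  dfs_st d e Bd X A0 M o (x i) g a ->
  cmd_wp Bd X (dfsC d) (fun a' => expr_ok Bd X (EReg rFL) a' /\
    [/\ exists g', dfs_st d e Bd X A0 M o (x i.+1) g' a',
      (expr_val X (EReg rFL) a' != 0) = dout (x i)
    & dout (x i) -> oset qIN n a' = dset (x i)]) a.
Proof.
move=> nf St; have [_ uo _ _] := o_ok.
apply: (dfsC_wp (v0 := v0) e_sym e_irr e_deg KX nX uo order_notin (x_valid i) nf St).
move=> g' a' St' F'; split=> //; have [D' _ _ _] := St'; split; first by exists g'.
  by rewrite (ev_reg _ D') F'; case: (dout _).
(* The machine outputs after the step has been made; turning round at a leaf leaves the set
   unchanged. *)
move=> out; have -> : dset (x i) = dset (x i.+1).
  rewrite -[x i.+1]/(dstep e A0 o v0 (x i)); move: out; rewrite /dout.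
  by case: (x i) => -[] [|h] S.
apply/setP=> v; rewrite inE (dst_in D' (vid_le v)) memidS.
by case: (_ \in _).
Qed.

Lemma dfs_cond_ev M i g a : dfs_st d e Bd X A0 M o (x i) g a ->
  expr_ok Bd X dfs_cond a /\ (expr_val X dfs_cond a == 0) = dfinal o (x i).
Proof.
case=> D gH gU gN; split=> //.
rewrite -[expr_val _ _ _]/((1 - expr_val X (EReg rU) a) +
  (expr_val X (EReg rN) a - expr_val X (EReg rH) a)).
rewrite !(ev_reg _ D) gH gU gN addn_eq0 /dfinal; have /andP[_ hN] := x_valid i.
by case: (dup _) => //=; rewrite subn_eq0 eqn_leq hN.
Qed.

Lemma search_run M t m g a :
  conf Bd p X (n := n) s0 t (St pos5 m) [::] -> rep Bd X a m ->
  dfs_st d e Bd X A0 M o x0 g a ->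
  let c := lsz dfs_cond (dfsC d) (EReg rFL) in
  exists T m' L', [/\ good Bd X m', T <= t + c * (2 * levelC * nmis e setT).+1,
    conf Bd p X (n := n) s0 T (St pos6 m') L',
    uniq (map snd L') /\ (forall S, (S \in map snd L') = mis e S)
  & timely (n := n) (t + c * (2 * n + 4)) 0 L' T].
Proof.
move=> Cf R St c; have [_ uo eT _] := o_ok; have B13 := Bd13.
have [_ _ _ _ [_ C5 _ _ _]] := mis_program_code.
have [_ _ _ _ [_ _ w1 w2]] := Bd_weights.
have w3 : ewt (EReg rFL) <= Bd by rewrite /=; lia.
have q2 : 0 < 2 < Bd by lia.
have w4 : 2 * 2 + 2 <= Bd by lia.
have [K [Kf Knf [Ku Km] Kle]] := reverse_search e_sym e_irr v0 uo order_notin misin_A0.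
have pot0 : dpot o (x 0) < 2 * n + 3 by have := x_pot 0; lia.
(* The first gap includes the preprocessing time [t]. The potential is shifted by one to be positive
   also at an output, where [dpot] is 0, so it is at most [2 * n + 2]. *)
have Tm : timely (n := n) (t + c * (2 * n + 3)) (c * (dpot o (x 0)).+1) [::] t.
  by split=> //=; rewrite subn0 leq_add2l leq_mul2l pot0 orbT.
have [|||||||t' [m' [a' [L' [[R' I'] T' Cf' S' Tm']]]]] := loop_run KX nX q2 w4 w1 w2 w3 C5
  (I := fun i a => exists g, dfs_st d e Bd X A0 M o (x i) g a) (k := K)
  (out := fun i => dout (x i)) (os := fun i => dset (x i))
  (pot := fun i => (dpot o (x i)).+1) (P := 2 * n + 2) _ _ _ _ _ _ Cf R _ Tm.
- move=> i a1 iK [g1 St1]; have [Ok1 Ev1] := dfs_cond_ev St1.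
  have nf : ~~ dfinal o (x i) by apply: Knf.
  by split; rewrite ?Ev1 //; apply: dfs_step_wp St1.
- move=> a1 [g1 St1]; have [Ok1 Ev1] := dfs_cond_ev St1; split=> //.
  by apply/eqP; rewrite Ev1.
- move=> i iK nout; rewrite ltnS; apply: dpot_step => //; first exact: x_valid.
  exact: Knf.
- by [].
- by move=> i _; have := x_pot i; lia.
- by apply: leq_trans (leq_addl _ _); rewrite leq_mul2l; apply/orP; right; lia.
- by exists g.
exists t', m', L'; split=> //.
- exact: rep_good R'.
- apply: leq_trans T' _; rewrite leq_add2l leq_mul2l ltnS; apply/orP; right.
  by apply: leq_trans Kle _; rewrite -mulnA leq_mul2l order_level_sum orbT.
- by rewrite S'; split=> // S; rewrite Km eT misE.
- case: Tm' => P1 P2; rewrite cat0s in P1 P2; have cE : c * (2 * n + 4) = c * (2 * n + 3) + c.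
    by rewrite !mulnDr; lia.
  rewrite cE addnA; split=> //.
  by rewrite addn0; apply: leq_trans (leq_addr _ _) P2.
Qed.

End Search.

Lemma lists_nonempty : lists_all_mis d p C 1 e.
Proof.
have [Cb C1 C2 C3 [C4 C5 Chalt _ _]] := mis_program_code.
have [w1 w2 w3 w4 [w5 w6 _ _]] := Bd_weights.
have XW : X = 2 ^ Wd * n by rewrite /X mulnC.
have [m1 [G1 R1]] := boot_go n_gt0 XW KX Bd13 (erefl n : gm 0 = n) gm_lt gm_out Cb.
rewrite size_boot in G1.
have Cf0 : conf Bd p X (n := n) s0 0 s0 [::] by split.
have Cf1 := conf_go Cf0 G1; rewrite add0n in Cf1.
have [||t2 [m2 [a2 [R2 I2 T2 Cf2]]]] :=
  silent_loop (I := scan_st d e Bd X st) (k := n) w1 w2 C1 _ _ Cf1 R1 scan_init.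
- move=> i a ik Ia; split=> //.
    case: Ia => g [us [D [_ _ gC _ _] _ _ _]].
    rewrite -[expr_val _ _ _]/(X - expr_val X (EReg rC) a) (ev_reg _ D) gC subn_eq0 -ltnNge.
    by rewrite /X ltn_pmul2r ?st_gt0.
  exact: (scanC_wp e_sym e_irr e_deg KX nX st_gt0 (erefl _) X_cells (v := Ordinal ik) Ia).
- move=> a [g [us [D [_ _ gC _ _] _ _ _]]]; split=> //.
  by rewrite -[expr_val _ _ _]/(X - expr_val X (EReg rC) a) (ev_reg _ D) gC subnn.
have [t3 [m3 [a3 [T3 G3 R3 [us us_ok I3]]]]] := compC_go KX R2 (start_rest_wp I2) w3 C2.
have Cf3 := conf_go Cf2 G3.
have [||t4 [m4 [a4 [R4 I4 T4 Cf4]]]] :=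
  silent_loop (I := rest_st d e Bd X us) (k := n) w4 w5 C3 _ _ Cf3 R3 I3.
- move=> i a ik Ia; split=> //.
    case: Ia => g [left [D [gV gv _] _ _ _]].
    rewrite -[expr_val _ _ _]/(expr_val X (EReg rV) a - expr_val X (EReg rv) a) !(ev_reg _ D) gV gv.
    by rewrite subn_eq0 -ltnNge.
  apply: (restC_wp KX nX st_gt0 (erefl _) X_cells (v := Ordinal ik) _ Ia) => //.
  by case: us_ok.
- move=> a [g [left [D [gV gv _] _ _ _]]]; split=> //.
  rewrite -[expr_val _ _ _]/(expr_val X (EReg rV) a - expr_val X (EReg rv) a) !(ev_reg _ D) gV gv.
  exact: subnn.
have [t5 [m5 [a5 [T5 G5 R5 [left [g5 [o_ok St5]]]]]]] :=
  compC_go KX R4 (start_dfs_wp us_ok I4) w6 C4.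
have Cf5 := conf_go Cf4 G5.
have [T [m6 [L [Gm T6 Cf6 [uL mL] [P6 Q6]]]]] := search_run (Ordinal n_gt0) o_ok Cf5 R5 St5.
have M0 := nmis_gt0 e_sym e_irr setT.
have nE : #|[set S | mis e S]| = nmis e setT.
  by apply: eq_card => S; rewrite !inE (misE e_sym e_irr).
have MB : 2 * Bd * X <= C * n.+1 /\ Bd * X <= C * n.+1.
  have H : 2 * Bd * 2 ^ Wd <= C.
    rewrite mis_constantE -[X in _ <= X]addnA; apply: leq_trans (leq_addr 2 _) (leq_addl _ _).
  suff H2 : 2 * Bd * X <= C * n.+1.
    by split=> //; apply: leq_trans H2; rewrite leq_mul2r leq_pmull ?orbT.
  apply: leq_trans (_ : C * n <= _); last by rewrite leq_mul2l leqnSn orbT.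
  by rewrite XW mulnA leq_mul2r H orbT.
have gT u : u <= T -> good Bd X (Defs.mem (exec p s0 u)).
  rewrite leq_eqVlt => /predU1P[->|]; last exact: (conf_good Cf6).
  by rewrite (conf_exec Cf6).
set c1 := lsz scan_cond (scanC d) (ECst 0) in T2 T3.
set c2 := lsz rest_cond restC (ECst 0) in T4 T5.
set c3 := lsz dfs_cond (dfsC d) (EReg rFL) in T6 P6 Q6.
have Tpre : t4 + t5 <=
    pos1 + c1 * n.+1 + csize Bd start_rest + c2 * n.+1 + csize Bd start_dfs by lia.
have CE : C = pos1 + 2 * c1 + csize Bd start_rest + 2 * c2 + csize Bd start_dfs +
  c3 * (2 * levelC + 10) + 2 * Bd * 2 ^ Wd + 2 by exact: mis_constantE.
have TC : T <= C * (n + #|[set S | mis e S]|).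
  apply: leq_trans T6 _; rewrite nE CE; move: (nmis e setT) M0 => M M0.
  (* At least one maximal independent set exists, so the [n.+1] tests of each preprocessing loop are
     within the budget. *)
  have nM : n.+1 <= n + M by rewrite -addn1 leq_add2l.
  have H : t4 + t5 <= pos1 + c1 * (n + M) + csize Bd start_rest + c2 * (n + M) + csize Bd start_dfs.
    apply: leq_trans Tpre _; rewrite leq_add2r; apply: leq_add; last by rewrite leq_mul2l nM orbT.
    by rewrite leq_add2r leq_add2l leq_mul2l nM orbT.
  apply: linear_bound H _; first by lia.
  rewrite -[X in _ <= X]mulnA leq_mul2l; apply/orP; right; move: levelC => lc; rewrite mulnDl.
  have : 2 * lc * M <= 2 * lc * (n + M) by rewrite leq_mul2l leq_addl orbT.
  by lia.
(* The bound on a gap is the whole preprocessing plus the longest wait within the search. *)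
have DC : t4 + t5 + c3 * (2 * n + 4) <= C * n.+1 ^ 1.
  rewrite expn1 CE.
  apply: linear_bound Tpre _ => //.
  rewrite -[X in _ <= X]mulnA leq_mul2l; apply/orP; right; move: levelC => lc; rewrite mulnDl.
  by lia.
exists T; split; first by rewrite (conf_exec Cf6) /halted /= Chalt.
split; first exact: (conf_halt Cf6).
have tsE : [seq t <- iota 0 T | is_out p (exec p s0 t)] = map fst L.
  by rewrite -(conf_log Cf6) /olog -map_comp map_id_in.
cbv zeta; rewrite -/gm -/s0 tsE.
have oE : [seq out_set p n (exec p s0 t) | t <- map fst L] = map snd L.
  by rewrite -(conf_log Cf6) /olog -!map_comp.
rewrite oE; split=> //; split=> //; split=> //; split; [|split].
- rewrite rcons_path; apply/andP; split.
    by apply: sub_path P6 => y z /leq_trans; apply.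
  by apply: leq_trans DC; move: Q6; rewrite addn0.
- move=> t a tT aC; case: (gT t tT) => _; apply.
  by apply: leq_trans aC; case: MB.
- move=> t a tT; case: (gT t tT) => H _; rewrite expn1.
  by apply: leq_trans (H a) _; case: MB.
Qed.

End NonEmpty.

End Enumeration.

Theorem theorem4 :
  forall d : nat,
  exists (p : seq instr) (C k : nat),
  forall (n : nat) (e : rel 'I_n),
    symmetric e -> irreflexive e -> max_degree_le e d ->
    lists_all_mis d p C k e.
Proof.
move=> d; exists (mis_program d), (mis_constant d), 1 => -[|n] e es ei ed.
  exact: lists_empty.
exact: lists_nonempty.
Qed.
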